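(* Let $G$ be a finite simple graph and let $t$ be an integer with $1\leq t\leq 5$. Then $G$ is ${\cal S}_t$-independent if and only if $G$ is ${\cal C}_t$-independent.
   Context: ${\cal S}_t$-independence: for a graph $G=(V,E)$ the symmetric-tensor matroid ${\cal S}_t(G)$ is the linear matroid on $E$ obtained by choosing a generic map $p:V\to\mathbb{R}^t$ (coordinates algebraically independent over $\mathbb{Q}$) and associating with each edge $ij\in E$ the vector $p_i\otimes p_j+p_j\otimes p_i$. It does not depend on the generic choice. $G$ is ${\cal S}_t$-independent if $\operatorname{rank}{\cal S}_t(G)=|E|$. ${\cal C}_t$-independence: $\bar K_m$ is the edgeless graph on $m$ vertices, $\dot\cup$ is disjoint union, and $G+H$ is the join of $G$ and $H$ (disjoint union plus all edges between $G$ and $H$). Families ${\cal C}_{n,t}$ of $n$-vertex graphs (up to isomorphism), $n,t\ge1$, are defined recursively. Put ${\cal C}_{n,t}=\{\bar K_n\}$ for all $t\geq 1$ and $n\leq t+1$, and ${\cal C}_{n,1}=\{K_n,\bar K_n\}$ for all $n\geq 3$. For $t\geq 2$ and $n\geq t+2$ put $${\cal C}_{n,t}=\{\bar K_n\}\cup\{G+K_1: G\in{\cal C}_{n-1,t-1}\}\cup\{K_{a,b}\,\dot\cup\,\bar K_{n-a-b}: 3\leq a,b\leq t-1,\ t+2\leq a+b\leq n\}.$$ Weights $c_t:\bigcup_{n\ge1}{\cal C}_{n,t}\to\mathbb{Z}$ are defined by: $c_t(\bar K_n)=0$ for $n,t\ge1$; $c_1(K_n)=1$ for $n\geq 3$;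 $c_t(K_{a,b}\dot\cup\bar K_{n-a-b})=ab-\binom{a+b-t}{2}$ for $3\leq a,b\leq t-1$, $t+2\leq a+b\leq n$; and $c_t(G+K_1)=c_{t-1}(G)+t$ for $G\in{\cal C}_{n-1,t-1}$, $t\geq 2$, $n\geq t+2$. A graph $G$ on $n$ vertices is ${\cal C}_t$-independent if $|E(H)|\leq c_t(F)$ for all subgraphs $H$ of $G$ and all $F\in{\cal C}_{n,t}$ with $H\subseteq F$, where $H\subseteq F$ means that $F$ has a subgraph isomorphic to $H$. *)

(* Defs.v *)
From HB Require Import structures.
From mathcomp Require Import mpoly.
From mathcomp Require Import all_boot all_order all_algebra.
From mathcomp Require Import reals.

Set Implicit Arguments.
Unset Strict Implicit.
Unset Printing Implicit Defensive.

Import Order.TTheory GRing.Theory Num.Theory.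

Record sgraph := SGraph {
  vertex :> finType;
  adj : rel vertex;
  adj_sym : symmetric adj;
  adj_irrefl : irreflexive adj
}.

Definition edges (G : sgraph) : {set {set G}} :=
  [set [set x; y] | x in G, y in G & adj x y].

Definition isomorphic (G H : sgraph) : Prop :=
  exists2 f : G -> H, bijective f & forall x y, adj (f x) (f y) = adj x y.

Section Constructions.

Implicit Types G H : sgraph.

Definition subgraph_adj G (U : {set G}) (D : {set {set G}}) :
    rel {x : G | x \in U} :=
  fun x y => adj (val x) (val y) && ([set val x; val y] \in D).

Fact subgraph_sym G (U : {set G}) (D : {set {set G}}) :
  symmetric (subgraph_adj (U := U) D).
Proof. by move=> x y; rewrite /subgraph_adj adj_sym setUC. Qed.

Fact subgraph_irrefl G (U : {set G}) (D : {set {set G}}) :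
  irreflexive (subgraph_adj (U := U) D).
Proof. by move=> x; rewrite /subgraph_adj adj_irrefl. Qed.

(* [subgraph U D] has vertex set [U]; its edges are the edges of [G] that lie
   in [D] and have both ends in [U].  Every subgraph of [G] has this form. *)
Definition subgraph G (U : {set G}) (D : {set {set G}}) : sgraph :=
  SGraph (@subgraph_sym G U D) (@subgraph_irrefl G U D).

Definition has_copy G H : Prop :=
  exists (U : {set G}) (D : {set {set G}}), isomorphic H (subgraph U D).

Fact edgeless_sym n : symmetric (fun _ _ : 'I_n => false).
Proof. by []. Qed.

Fact edgeless_irrefl n : irreflexive (fun _ _ : 'I_n => false).
Proof. by []. Qed.

Definition edgeless n : sgraph := SGraph (@edgeless_sym n) (@edgeless_irrefl n).

Fact complete_sym n : symmetric (fun x y : 'I_n => x != y).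
Proof. by move=> x y; rewrite eq_sym. Qed.

Fact complete_irrefl n : irreflexive (fun x y : 'I_n => x != y).
Proof. by move=> x; rewrite eqxx. Qed.

Definition complete n : sgraph := SGraph (@complete_sym n) (@complete_irrefl n).

Definition sum_adj G H (cross : bool) : rel (G + H)%type :=
  fun u v => match u, v with
             | inl x, inl y => adj x y
             | inr x, inr y => adj x y
             | _, _ => cross
             end.

Fact sum_sym G H cross : symmetric (@sum_adj G H cross).
Proof. by case=> x [] y //=; apply: adj_sym. Qed.

Fact sum_irrefl G H cross : irreflexive (@sum_adj G H cross).
Proof. by case=> x /=; apply: adj_irrefl. Qed.

Definition disjoint_union G H : sgraph :=
  SGraph (@sum_sym G H false) (@sum_irrefl G H false).

Definition join G H : sgraph :=
  SGraph (@sum_sym G H true) (@sum_irrefl G H true).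

Definition complete_bipartite a b : sgraph := join (edgeless a) (edgeless b).

Definition cone G : sgraph := join G (complete 1).

(* $K_{a,b} \dot\cup \bar K_{n-a-b}$ *)
Definition bipartite_on n a b : sgraph :=
  disjoint_union (complete_bipartite a b) (edgeless (n - a - b)).

End Constructions.

(* [calC n t F] : [F] is the chosen representative of an isomorphism class in
   $\mathcal{C}_{n,t}$. *)
Inductive calC : nat -> nat -> sgraph -> Prop :=
| calC_edgeless n t :
    1 <= n -> 1 <= t -> calC n t (edgeless n)
| calC_complete n :
    3 <= n -> calC n 1 (complete n)
| calC_cone n t G :
    2 <= t -> t + 2 <= n -> calC (n - 1) (t - 1) G -> calC n t (cone G)
| calC_bipartite n t a b :
    2 <= t -> t + 2 <= n ->
    3 <= a <= t - 1 -> 3 <= b <= t - 1 -> t + 2 <= a + b <= n ->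
    calC n t (bipartite_on n a b).

(* [weight t F c] : the graph of the function $c_t$, i.e. $c_t(F) = c$. *)
Inductive weight : nat -> sgraph -> int -> Prop :=
| weight_edgeless n t :
    1 <= n -> 1 <= t -> weight t (edgeless n) 0%R
| weight_complete n :
    3 <= n -> weight 1 (complete n) 1%R
| weight_bipartite n t a b :
    3 <= a <= t - 1 -> 3 <= b <= t - 1 -> t + 2 <= a + b <= n ->
    weight t (bipartite_on n a b) ((a * b)%:Z - 'C(a + b - t, 2)%:Z)%R
| weight_cone n t G c :
    2 <= t -> t + 2 <= n -> calC (n - 1) (t - 1) G -> weight (t - 1) G c ->
    weight t (cone G) (c + t%:Z)%R.

Lemma weight_total n t F : calC n t F -> exists c, weight t F c.
Proof.
elim=> {n t F} [n t n_gt0 t_gt0|n n_ge3|n t G t_ge2 tn CG [c cG]|n t a b *].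
- by exists 0%R; apply: weight_edgeless.
- by exists 1%R; apply: weight_complete.
- by exists (c + t%:Z)%R; apply: weight_cone CG cG.
- by exists ((a * b)%:Z - 'C(a + b - t, 2)%:Z)%R; apply: weight_bipartite.
Qed.

Definition C_independent (t : nat) (G : sgraph) : Prop :=
  forall (U : {set G}) (D : {set {set G}}) (F : sgraph) (c : int),
    calC #|G| t F -> weight t F c -> has_copy F (subgraph U D) ->
    (#|edges (subgraph U D)|%:Z <= c)%R.

Section SymmetricTensor.

Local Open Scope ring_scope.

Variable R : realType.

Definition alg_independent_over_rat (I : finType) (x : I -> R) : Prop :=
  forall P : {mpoly rat[#|I|]},
    mmap ratr (fun k => x (enum_val k)) P = 0 -> P = 0.

Variables (t : nat) (G : sgraph).

Definition generic (p : G -> 'rV[R]_t) : Prop :=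
  alg_independent_over_rat (fun ik : G * 'I_t => p ik.1 0 ik.2).

(* $\mathbb{R}^t \otimes \mathbb{R}^t$ is identified with the space of
   $t \times t$ matrices, $x \otimes y$ being $x^T y$ for row vectors. *)
Definition tensor (x y : 'rV[R]_t) : 'M[R]_t := x^T *m y.

Definition edge_vector (p : G -> 'rV[R]_t) (i j : G) : 'M[R]_t :=
  tensor (p i) (p j) + tensor (p j) (p i).

(* Each edge contributes its vector twice, once per orientation, which does
   not affect the span. *)
Definition S_rank (p : G -> 'rV[R]_t) : nat :=
  \dim <<[seq edge_vector p ij.1 ij.2
          | ij <- enum [pred ij : G * G | adj ij.1 ij.2]]>>%VS.

(* The rank is the same for all generic [p]. *)
Definition S_independent : Prop :=
  exists2 p : G -> 'rV[R]_t, generic p & S_rank p = #|edges G|.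

End SymmetricTensor.

(* Main.v *)
(* A stress of a graph with placement $p$ is a weighting of its edges annihilating the
   vectors $p_i\otimes p_j+p_j\otimes p_i$; independence means that zero is the only
   stress.  Being a Zariski open condition, it holds at every generic placement as soon
   as it holds at a single one.

   Necessity.  Projecting from $p_v$ shows that deleting a vertex $v$ and lowering $t$
   by one lowers the rank by at most $t$.  For $K_{a,b}$ with parts placed as the rows of
   $P$ and $Q$, a basis of the relations $UP=WQ$ has $d\ge a+b-t$ rows, and $U^TSW$ is a
   stress for every skew-symmetric $S$ of size $d$.

   Sufficiency.  Special placements reduce $t$ to $t-1$: a vertex of degree $t$ is
   deleted (placed at the last basis vector), or a vertex $v$ of degree $t-1$ together
   with an edge $f$ that avoids $v$ and its neighbours.  Vertices at distance at least
   three may be merged.  So one may assume $t(t+1)/2$ edges and maximum degree at most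
   $t-1$.  If the degree $t-1$ occurs, the forbidden bipartite graphs and small vertex
   covers are exactly what prevents every choice of $(v,f)$ from failing; for $t=5$ the
   choice depends on whether there are three pairwise nonadjacent vertices of degree 4,
   and otherwise on the four vertices covering all edges but $f$, or on a $K_{3,3}$ left
   after deleting $v$ and $f$.  In lower degree vertices are merged, or both ends of an
   edge in no triangle are placed at the last basis vector. *)
From HB Require Import structures.
Require Import Defs.
From mathcomp Require Import mpoly.
From mathcomp Require Import all_boot all_order all_algebra.
From mathcomp Require Import boolp reals.
From mathcomp Require Import zify ring lra.

Set Implicit Arguments.
Unset Strict Implicit.
Unset Printing Implicit Defensive.

Import Order.TTheory GRing.Theory Num.Theory.

(** * Edge sets and stresses *)

(** The forbidden configurations are those with more edges than their weight. Iterated cones over an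
    edgeless graph bound the edges meeting $k<t$ vertices by $t+(t-1)+\dots+(t-k+1)$; for $k=t-1$
    this is $t(t+1)/2-1$, so a graph with all $t(t+1)/2$ edges has no cover by $t-1$ vertices.
    Beyond degrees and covers only the following is needed: no $K_{3,3}$ for $t=4$ (weight $9-1$);
    for $t=5$ no $K_{3,4}$ (weight $12-1$), at most 13 edges between disjoint 4-sets (weight
    $16-3$), and no $K_{3,3}$ left after deleting a vertex of degree 5 (weight $9-1+5$). The
    obstacle is that a reduction must leave a graph meeting the conditions one dimension lower.
    Coning at a vertex of degree $t$ inherits them. Deleting a vertex of degree $t-1$ with an edge
    $f$ also removes $t$ edges, but may leave a new small cover or biclique, which only the choice
    of $(v,f)$ can prevent. Graphs with fewer edges are filled up by disjoint edges, so that these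
    choices are made at an exact edge count. *)

Definition simple (V : finType) (E : {set {set V}}) : Prop :=
  forall e, e \in E -> #|e| = 2.

Definition star (V : finType) (E : {set {set V}}) (v : V) := [set e in E | v \in e].
Definition del (V : finType) (E : {set {set V}}) (v : V) := [set e in E | v \notin e].
Definition nbr (V : finType) (E : {set {set V}}) (v : V) := [set u | [set v; u] \in E].

Section EdgeSets.
Variable V : finType.
Implicit Types (E H : {set {set V}}) (u v w x y : V) (e f : {set V}).

Lemma simple_sub E H : H \subset E -> simple E -> simple H.
Proof. by move=> /subsetP sHE sE e /sHE; apply: sE. Qed.

Lemma del_sub E v : del E v \subset E.
Proof. by apply/subsetP=> e; rewrite inE => /andP[]. Qed.

Lemma simple_del E v : simple E -> simple (del E v).
Proof. exact/simple_sub/del_sub. Qed.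

Lemma card_star_del E v : #|E| = #|star E v| + #|del E v|.
Proof.
rewrite -cardsUI (_ : _ :|: _ = E) => [|]; last first.
  by apply/setP=> e; rewrite !inE; case: (e \in E); case: (v \in e).
rewrite (_ : _ :&: _ = set0) ?cards0 ?addn0 //.
by apply/setP=> e; rewrite !inE; case: (v \in e); rewrite ?andbF.
Qed.

Lemma edge2 E e : simple E -> e \in E -> exists x y, x != y /\ e = [set x; y].
Proof. by move=> sE /sE /eqP /cards2P [x [y [xy ->]]]; exists x, y. Qed.

Lemma edge_at E e v : simple E -> e \in E -> v \in e ->
  exists2 u, u != v & e = [set v; u].
Proof.
move=> sE /(edge2 sE) [x [y [xy ->]]]; rewrite !inE.
case/orP=> /eqP ->; first by exists y; rewrite // eq_sym.
by exists x; rewrite // setUC.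
Qed.

Lemma nbr_neq E u v : simple E -> u \in nbr E v -> u != v.
Proof.
move=> sE; rewrite inE => /sE; apply: contra_eq_neq => ->.
by rewrite setUid cards1.
Qed.

Lemma nbrC E u v : (u \in nbr E v) = (v \in nbr E u).
Proof. by rewrite !inE setUC. Qed.

Lemma set2_inj v : injective (fun u => [set v; u]).
Proof.
move=> x y /setP eq_xy.
have:= eq_xy x; have:= eq_xy y; rewrite !inE !eqxx !orbT.
by case: eqP => [->|_ /= /eqP ->] //= _; case/esym/orP => /eqP.
Qed.

Lemma set2_eq x y v u : [set x; y] = [set v; u] ->
  (x = v /\ y = u) \/ (x = u /\ y = v).
Proof.
move=> eq2; have: v \in [set x; y] by rewrite eq2 set21.
rewrite !inE => /orP[] /eqP eqv; move: eq2; rewrite eqv.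
  by move/set2_inj; left.
by rewrite setUC => /set2_inj; right.
Qed.

Lemma star_nbr E v : simple E -> star E v = (fun u => [set v; u]) @: nbr E v.
Proof.
move=> sE; apply/setP=> e; apply/idP/imsetP.
  rewrite inE => /andP[eE ve]; have [u _ eu] := edge_at sE eE ve.
  by exists u; rewrite // inE -eu.
by case=> u; rewrite !inE => uE ->; rewrite uE set21.
Qed.

Lemma card_nbr E v : simple E -> #|nbr E v| = #|star E v|.
Proof. by move=> sE; rewrite star_nbr // card_imset //; apply: set2_inj. Qed.

End EdgeSets.

Local Open Scope ring_scope.

Section Stress.
Variables (R : realType).

Section Def.
Variables (V : finType).
Implicit Types (E H : {set {set V}}) (u v w x y : V) (e f : {set V}).
Implicit Types (p q : V -> nat -> R) (om : {set V} -> R).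

(* The $(i,j)$ entry of $p_x\otimes p_y+p_y\otimes p_x$ for $e=\{x,y\}$. *)
Definition entry p e i j : R :=
  \sum_(x in e) \sum_(y in e :\ x) p x i * p y j.

(** Placements are infinite coordinate sequences of which only the first [t] entries are read, so
    one placement serves all dimensions at once. *)
Definition stress t E p om :=
  forall i j, (i < t)%N -> (j < t)%N -> \sum_(e in E) om e * entry p e i j = 0.

Definition indep_at t E p :=
  forall om, stress t E p om -> forall e, e \in E -> om e = 0.

Definition indep t E := exists p, indep_at t E p.

Definition gen_pos t p (W : {set V}) :=
  forall (N : {set V}) (c : V -> R), N \subset W -> (#|N| <= t)%N ->
  (forall i, (i < t)%N -> \sum_(u in N) c u * p u i = 0) ->
  forall u, u \in N -> c u = 0.

(** The two consequences of genericity that the reductions use, in all dimensions up to [T]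
    simultaneously: a reduction moves a few vertices of such a placement and reads the others one
    dimension lower. *)
Definition universal T p :=
  (forall t E, (t <= T)%N -> simple E -> indep t E -> indep_at t E p) /\
  forall t, (t <= T)%N -> gen_pos t p setT.

Lemma entry2 p x y i j : x != y ->
  entry p [set x; y] i j = p x i * p y j + p y i * p x j.
Proof.
move=> xy; have yx: y != x by rewrite eq_sym.
rewrite /entry big_setU1 ?inE //= big_set1 setU1K ?inE // big_set1.
by rewrite [[set x; y]]setUC setU1K ?inE // big_set1.
Qed.

Lemma entry2r p x y i j : y != x ->
  entry p [set x; y] i j = p x i * p y j + p y i * p x j.
Proof. by rewrite eq_sym; apply: entry2. Qed.

Lemma eq_entry p q e i j :
  {in e, forall x, p x i = q x i} -> {in e, forall x, p x j = q x j} ->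
  entry p e i j = entry q e i j.
Proof.
move=> Hi Hj; apply: eq_bigr => x xe; apply: eq_bigr => y.
by rewrite !inE => /andP[_ ye]; rewrite Hi ?Hj.
Qed.

Lemma entryC p e i j : entry p e i j = entry p e j i.
Proof.
rewrite /entry (exchange_big_dep (fun x => x \in e)) /=; last first.
  by move=> x y _; rewrite !inE => /andP[].
apply: eq_bigr => x xe; apply: eq_big => [y|y _]; [|exact: mulrC].
by rewrite !inE xe andbT andbC eq_sym.
Qed.

Lemma sum_star_del E v (F : {set V} -> R) : simple E ->
  \sum_(e in E) F e = \sum_(u in nbr E v) F [set v; u] + \sum_(e in del E v) F e.
Proof.
move=> sE; rewrite (bigID (fun e : {set V} => v \in e)) /=; congr (_ + _).
  rewrite -(big_imset F (h := fun u => [set v; u])) /=; last by move=> x y _ _; apply: set2_inj.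
  by rewrite -star_nbr //; apply: eq_bigl => e; rewrite inE.
by apply: eq_bigl => e; rewrite inE.
Qed.

Lemma twice_eq0 (a : R) : a + a = 0 -> a = 0.
Proof. by lra. Qed.

Section Universal.
Variables (T : nat) (q : V -> nat -> R).
Hypothesis uq : universal T q.

(** With $p_v$ at the last basis vector, the entries with both indices below [t] see only [del E v],
    where the stress vanishes by universality. The last column is then a linear dependence among the
    neighbours of [v], at most [t.+1] points in general position; its diagonal entry carries a
    factor 2, removed by [twice_eq0]. *)
Lemma indep_cone t E v : (t < T)%N -> simple E -> (#|star E v| <= t.+1)%N ->
  indep t (del E v) -> indep t.+1 E.
Proof.
move=> tT sE dv ind; pose p x (i : nat) : R := if x == v then (i == t)%:R else q x i.
have pv i : (i < t)%N -> p v i = 0 by rewrite /p eqxx ltn_neqAle; case: eqP.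
have pvt : p v t = 1 by rewrite /p !eqxx.
have pu u i : u != v -> p u i = q u i by rewrite /p => /negPf ->.
exists p => om st.
have om_del: forall e, e \in del E v -> om e = 0.
  apply: (uq.1 _ _ (ltnW tT) (simple_del sE) ind om) => i j it jt.
  have:= st i j (ltnW it) (ltnW jt); rewrite (sum_star_del v _ sE) big1 ?add0r.
    move=> s0; rewrite -[RHS]s0; apply: eq_bigr => e; rewrite inE => /andP[_ ve]; congr (_ * _).
    by apply: eq_entry => x xe; rewrite pu //; apply: contraNneq ve => <-.
  by move=> u /nbr_neq uv; rewrite entry2 ?pv ?mul0r ?mulr0 ?addr0 ?mulr0 // eq_sym uv.
have om_star: forall u, u \in nbr E v -> om [set v; u] = 0.
  apply: (uq.2 t.+1 tT _ (fun u => om [set v; u])); rewrite ?subsetT ?card_nbr // => i.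
  rewrite ltnS => it; have:= st i t it (ltnSn t).
  rewrite (sum_star_del v _ sE) [X in _ + X]big1 => [|e eD]; last first.
    by rewrite om_del ?mul0r.
  rewrite addr0; case: (ltngtP i t) it => // [it|->] _ s0.
    rewrite -[RHS]s0; apply: eq_bigr => u uN; have uv := nbr_neq sE uN.
    by rewrite entry2r // pv // pvt !pu // mul0r add0r mulr1.
  apply: twice_eq0; rewrite -big_split /= -[RHS]s0; apply: eq_bigr => u uN.
  have uv := nbr_neq sE uN.
  by rewrite entry2r // pvt !pu // mul1r mulr1 mulrDr.
move=> e eE; case: (boolP (v \in e)) => ve; last by apply: om_del; rewrite inE eE.
have [u uv eu] := edge_at sE eE ve; rewrite eu; apply: om_star.
by rewrite inE -eu.
Qed.

(* Put $p_v=e_t$ and let only the ends of [f] have a nonzero last coordinate besides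
   [v]: the last diagonal entry then isolates the coefficient of [f].  This is dual
   to a 1-extension of the complement in rigidity theory. *)
Lemma indep_extension t E v f : (t < T)%N -> simple E -> (#|star E v| <= t)%N ->
  f \in E -> v \notin f -> [disjoint f & nbr E v] ->
  indep t (del E v :\ f) -> indep t.+1 E.
Proof.
move=> tT sE dv fE vf dis ind.
pose p x (i : nat) : R := if x == v then (i == t)%:R else
  if i == t then (x \in f)%:R else q x i.
have pv i : (i < t)%N -> p v i = 0 by rewrite /p eqxx ltn_neqAle; case: eqP.
have pvt : p v t = 1 by rewrite /p !eqxx.
have pu u i : u != v -> (i < t)%N -> p u i = q u i.
  by rewrite /p => /negPf -> /ltn_eqF ->.
have put u : u != v -> p u t = (u \in f)%:R by rewrite /p eqxx => /negPf ->.
have nf u : u \in nbr E v -> u \notin f by move=> uN; rewrite (disjointFl dis uN).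
have fD : f \in del E v by rewrite inE fE.
exists p => om st.
have om_f : om f = 0.
  have:= st t t (ltnSn t) (ltnSn t); rewrite (sum_star_del v _ sE) big1 => [|u uN].
    rewrite add0r (bigD1 f) //= big1 => [|e /andP[]].
      have [x [y [xy fxy]]] := edge2 sE fE.
      have xf : x \in f by rewrite fxy set21.
      have yf : y \in f by rewrite fxy set22.
      rewrite addr0 {2}fxy entry2 // !put ?xf ?yf ?mulr1.
      - by rewrite mulrDr mulr1 => /twice_eq0.
      - by apply: contraNneq vf => <-.
      - by apply: contraNneq vf => <-.
    rewrite inE => /andP[eE ve] ef; have [x [y [xy exy]]] := edge2 sE eE.
    have xv : x != v by apply: contraNneq ve => <-; rewrite exy set21.
    have yv : y != v by apply: contraNneq ve => <-; rewrite exy set22.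
    rewrite exy entry2 // !put //.
    case: (boolP (x \in f)) => xf; case: (boolP (y \in f)) => yf;
      rewrite ?mulr0 ?mul0r ?addr0 ?mulr0 //.
    case/eqP: ef; apply/eqP; rewrite eqEcard (sE _ eE) (sE _ fE) leqnn andbT.
    by rewrite exy subUset !sub1set xf.
  have uv := nbr_neq sE uN.
  by rewrite entry2r // pvt put // (negPf (nf u uN)) mul1r mulr1 addr0 mulr0.
have om_del: forall e, e \in del E v -> om e = 0.
  suff om_D : forall e, e \in del E v :\ f -> om e = 0.
    by move=> e eD; case: (eqVneq e f) => [->//|ef]; apply: om_D; rewrite in_setD1 ef.
  have sD : simple (del E v :\ f) by apply: simple_sub (subD1set _ _) (simple_del sE).
  apply: (uq.1 _ _ (ltnW tT) sD ind om) => i j it jt.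
  have:= st i j (ltnW it) (ltnW jt); rewrite (sum_star_del v _ sE) big1 ?add0r.
    rewrite (big_setD1 f) //= om_f mul0r add0r.
    move=> s0; rewrite -[RHS]s0; apply: eq_bigr => g; rewrite !inE => /and3P[_ _ ve]; congr (_ * _).
    by apply: eq_entry => x xe; rewrite pu //; apply: contraNneq ve => <-.
  by move=> u /nbr_neq uv; rewrite entry2 ?pv ?mul0r ?mulr0 ?addr0 ?mulr0 // eq_sym uv.
(* The neighbours of [v] have last coordinate zero, so their dependence lives in dimension [t];
   hence a degree bound one lower than in [indep_cone]. *)
have om_star: forall u, u \in nbr E v -> om [set v; u] = 0.
  apply: (uq.2 t (ltnW tT) _ (fun u => om [set v; u])); rewrite ?subsetT ?card_nbr // => i it.
  have:= st i t (ltnW it) (ltnSn t).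
  rewrite (sum_star_del v _ sE) [X in _ + X]big1 => [|e eD]; last first.
    by rewrite om_del ?mul0r.
  rewrite addr0 => s0; rewrite -[RHS]s0; apply: eq_bigr => u uN.
  have uv := nbr_neq sE uN.
  by rewrite entry2r // pv // pvt (pu u i) // mul0r add0r mulr1.
move=> e eE; case: (boolP (v \in e)) => ve; last by apply: om_del; rewrite inE eE.
have [u uv eu] := edge_at sE eE ve; rewrite eu; apply: om_star.
by rewrite inE -eu.
Qed.

(* Both ends of the edge $uv$ are placed at the last basis vector. *)
Lemma indep_cone_edge t E u v : (t < T)%N -> simple E -> u \in nbr E v ->
  [disjoint nbr E u & nbr E v] ->
  (#|star E v| + #|star (del E v) u| <= t.+1)%N ->
  indep t (del (del E v) u) -> indep t.+1 E.
Proof.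
move=> tT sE uN dis dv ind; have uv := nbr_neq sE uN.
pose p x (i : nat) : R := if x \in [set u; v] then (i == t)%:R else q x i.
have pv i : (i < t)%N -> p v i = 0 by rewrite /p !inE eqxx orbT ltn_neqAle; case: eqP.
have pu i : (i < t)%N -> p u i = 0 by rewrite /p !inE eqxx ltn_neqAle; case: eqP.
have pvt : p v t = 1 by rewrite /p !inE !eqxx orbT.
have put : p u t = 1 by rewrite /p !inE !eqxx.
have pw w i : w != u -> w != v -> p w i = q w i.
  by rewrite /p !inE => /negPf -> /negPf ->.
have sD : simple (del E v) := simple_del sE.
have sDD : simple (del (del E v) u) := simple_del sD.
set D := del E v in sD sDD ind dv *.
have nbrD w : w \in nbr D u -> (w \in nbr E u) && (w != v).
  rewrite !inE negb_or (eq_sym v u) uv /= => /andP[-> /=].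
  by rewrite eq_sym.
exists p => om st.
have split_sum F : \sum_(e in E) F e =
  F [set v; u] + \sum_(w in nbr E v :\ u) F [set v; w]
  + \sum_(w in nbr D u) F [set u; w] + \sum_(e in del D u) F e :> R.
  by rewrite (sum_star_del v _ sE) (sum_star_del u _ sD) (big_setD1 u) //= !addrA.
have om_DD: forall e, e \in del D u -> om e = 0.
  apply: (uq.1 _ _ (ltnW tT) sDD ind om) => i j it jt.
  have z1 : \sum_(w in nbr E v :\ u) om [set v; w] * entry p [set v; w] i j = 0.
    apply: big1 => w; rewrite in_setD1 => /andP[_] /(nbr_neq sE) wv.
    by rewrite entry2r // !pv // mul0r mulr0 addr0 mulr0.
  have z2 : \sum_(w in nbr D u) om [set u; w] * entry p [set u; w] i j = 0.
    apply: big1 => w /(nbr_neq sD) wu.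
    by rewrite entry2r // !pu // mul0r mulr0 addr0 mulr0.
  have:= st i j (ltnW it) (ltnW jt); rewrite split_sum z1 z2 !addr0.
  rewrite entry2r // !pv // !pu // !mul0r addr0 mulr0 add0r.
  move=> s0; rewrite -[RHS]s0; apply: eq_bigr => e; rewrite !inE -andbA.
  case/and3P=> [_ ve ue]; congr (_ * _).
  by apply: eq_entry => x xe; rewrite pw //;
    [apply: contraNneq ue => <- | apply: contraNneq ve => <-
    |apply: contraNneq ue => <- | apply: contraNneq ve => <-].
have s1 F : \sum_(e in E) om e * F e =
  om [set v; u] * F [set v; u] + \sum_(w in nbr E v :\ u) om [set v; w] * F [set v; w]
  + \sum_(w in nbr D u) om [set u; w] * F [set u; w].
  rewrite split_sum [X in _ + X]big1 ?addr0 // => e eD.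
  by rewrite om_DD ?mul0r.
(* As [u] and [v] have no common neighbour, the weights of the edges at [u] and at [v] form one
   function on the union of their neighbourhoods, and the last column makes it a linear dependence.
   The edge [uv] itself shows only in the last diagonal entry. *)
pose c w := if w \in nbr E v then om [set v; w] else om [set u; w].
pose N := nbr E v :\ u :|: nbr D u.
have disN : [disjoint nbr E v :\ u & nbr D u].
  apply/pred0P => w /=; apply/negbTE/negP => /andP[].
  rewrite in_setD1 => /andP[_ wv] /nbrD /andP[wu _].
  by rewrite (disjointFr dis wu) in wv.
have cN : forall w, w \in N -> c w = 0.
  apply: (uq.2 t (ltnW tT)); rewrite ?subsetT //.
    apply: leq_trans (leq_card_setU _ _) _.
    rewrite card_nbr //; move: dv; rewrite -(card_nbr v sE) (cardsD1 u) uN.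
    by rewrite add1n addSn ltnS.
  move=> i it; rewrite (eq_bigl [predU nbr E v :\ u & nbr D u]) => [|w]; last by rewrite !inE.
  rewrite bigU //=.
  have:= st i t (ltnW it) (ltnSn t); rewrite s1 entry2r // (pv i) // (pu i) // !mul0r addr0 mulr0 add0r.
  move=> s0; rewrite -[RHS]s0; congr (_ + _); apply: eq_bigr => w.
    rewrite in_setD1 => /andP[wu wv]; have wv' := nbr_neq sE wv.
    by rewrite /c wv entry2r // pv // pvt (pw w i) // mul0r add0r mulr1.
  move=> wN; have /andP[wu wv] := nbrD w wN; have wu' := nbr_neq sE wu.
  by rewrite /c (disjointFr dis wu) entry2r // (pu i) // put (pw w i) // mul0r add0r mulr1.
have c1 w : w \in nbr E v :\ u -> om [set v; w] = 0.
  move=> wN; have wv : w \in nbr E v by move: wN; rewrite in_setD1 => /andP[].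
  have: c w = 0 by apply: cN; rewrite inE wN.
  by rewrite /c wv.
have c2 w : w \in nbr D u -> om [set u; w] = 0.
  move=> wN; have /andP[wu _] := nbrD w wN.
  have: c w = 0 by apply: cN; rewrite inE wN orbT.
  by rewrite /c (disjointFr dis wu).
have om_uv : om [set v; u] = 0.
  have:= st t t (ltnSn t) (ltnSn t); rewrite s1 !big1 ?addr0.
  - by rewrite entry2r // pvt put mulr1 mulrDr mulr1 => /twice_eq0.
  - by move=> w /c2 ->; rewrite mul0r.
  by move=> w /c1 ->; rewrite mul0r.
move=> e eE; case: (boolP (v \in e)) => ve.
  have [w wv ew] := edge_at sE eE ve; rewrite ew; case: (eqVneq w u) => [->//|wu].
  by apply: c1; rewrite !inE wu -ew.
have eD : e \in D by rewrite inE eE.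
case: (boolP (u \in e)) => ue; last by apply: om_DD; rewrite inE eD.
by have [w wv ew] := edge_at sE eE ue; rewrite ew; apply: c2; rewrite inE -ew.
Qed.

End Universal.
End Def.

(** A stress at [p \o f] pushes forward along [f], and injectivity on each edge and on the edge set
    keeps the weights apart. With [f] an inclusion this restricts a placement; with [f] a merging it
    puts two vertices at one point. *)
Lemma indep_at_image (V V' : finType) (f : V -> V') (E : {set {set V}}) t p :
  simple E -> (forall e, e \in E -> {in e &, injective f}) ->
  {in E &, injective (fun e : {set V} => f @: e)} ->
  indep_at t [set f @: e | e : {set V} in E] p -> indep_at t E (p \o f).
Proof.
move=> sE f_inj im_inj ind om st.
pose om' e' := \sum_(e in E | f @: e == e') om e.
have om'E e : e \in E -> om' (f @: e) = om e.
  move=> eE; rewrite /om' (bigD1 e) ?eE ?eqxx //= big1 ?addr0 // => g.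
  by case/andP=> /andP[gE /eqP fg] /eqP []; apply: im_inj.
have ind0 := ind om' _ _ (imset_f _ _).
move=> e eE; rewrite -om'E //; apply: ind0 => // i j it jt.
rewrite big_imset //= -[RHS](st i j it jt); apply: eq_bigr => g gE.
rewrite om'E //; congr (_ * _); have [x [y [xy gxy]]] := edge2 sE gE.
rewrite gxy imsetU1 imset_set1 !entry2 //.
by apply: contra_neq xy; apply: (f_inj g gE); rewrite ?gxy ?set21 ?set22.
Qed.

Lemma indep_image (V V' : finType) (f : V -> V') (E : {set {set V}}) t :
  simple E -> (forall e, e \in E -> {in e &, injective f}) ->
  {in E &, injective (fun e : {set V} => f @: e)} ->
  indep t [set f @: e | e : {set V} in E] -> indep t E.
Proof.
move=> sE f_inj im_inj [p ind]; exists (p \o f).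
exact: indep_at_image sE f_inj im_inj ind.
Qed.

Lemma indep_at_sub (V : finType) (E H : {set {set V}}) t p :
  H \subset E -> indep_at t E p -> indep_at t H p.
Proof.
move=> sHE ind om st e eH.
have := ind (fun e => if e \in H then om e else 0) _ e (subsetP sHE e eH).
rewrite eH; apply => i j it jt; rewrite (big_setID H) /= (setIidPr sHE).
rewrite [X in _ + X]big1 ?addr0 => [|g]; last by rewrite inE => /andP[/negPf -> _]; rewrite mul0r.
by rewrite -[RHS](st i j it jt); apply: eq_bigr => g ->.
Qed.

Lemma indep_sub (V : finType) (E H : {set {set V}}) t :
  H \subset E -> indep t E -> indep t H.
Proof. by move=> HE [p ind]; exists p; apply: indep_at_sub ind. Qed.

Lemma indep_set0 (V : finType) t : indep t (set0 : {set {set V}}).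
Proof. by exists (fun _ _ => 0) => om _ e; rewrite inE. Qed.

End Stress.

(** * Generic placements *)

Section Transcendence.
Variable R : realType.
Implicit Types (Q : {poly R}) (a b : R).

Lemma root_free_subinterval Q a b : Q != 0 -> a < b ->
  exists c d, [/\ a <= c, c < d, d <= b & forall y, c <= y <= d -> ~~ root Q y].
Proof.
move=> Q0 ab; have [s sQ] : exists s : seq R, forall y, root Q y -> y \in s.
  have [n sz] := ubnP (size Q); elim: n Q Q0 sz => // n IH Q Q0 sz.
  have [[z Qz]|noroot] := pselect (exists z, root Q z); last first.
    by exists [::] => y Qy; case: noroot; exists y.
  have /factor_theorem [q Qq] := Qz.
  have q0 : q != 0 by apply: contraNneq Q0 => q0; rewrite Qq q0 mul0r.
  have [|s qs] := IH q q0.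
    by move: sz; rewrite Qq size_Mmonic ?monicXsubC // size_XsubC addn2.
  exists (z :: s) => y; rewrite Qq rootM root_XsubC inE orbC.
  by case/orP=> [->//|/qs ->]; rewrite orbT.
suff [c [d [ac cd db cds]]] : exists c d, [/\ a <= c, c < d, d <= b &
    forall y, c <= y <= d -> y \notin s].
  by exists c, d; split=> // y /cds; apply: contra => /sQ.
elim: s {sQ} => [|z s [c [d [ac cd db cds]]]]; first by exists a, b.
have [zm|mz] := ltP z ((c + d) / 2).
  exists ((c + d) / 2), d; split=> // [||y /andP[my yd]]; [lra|lra|].
  rewrite inE negb_or cds ?andbT; last by rewrite yd andbT; lra.
  by apply/eqP=> yz; rewrite yz in my; lra.
(* Stopping at the quarter point keeps the closed interval clear of [z], which may be the
   midpoint. *)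
exists c, ((3 * c + d) / 4); split=> // [||y /andP[cy ym]]; [lra|lra|].
rewrite inE negb_or cds ?andbT; last by rewrite cy /=; lra.
by apply/eqP=> yz; rewrite yz in ym; lra.
Qed.

(** Nested closed intervals, each new one free of roots of the next polynomial; the supremum of the
    left ends lies in all of them. *)
Lemma avoid_roots (Q : nat -> {poly R}) : (forall n, Q n != 0) ->
  exists y, forall n, ~~ root (Q n) y.
Proof.
move=> Q0; pose ivl := {ab : R * R | ab.1 < ab.2}.
have step n (I : ivl) : {J : ivl | [/\ (val I).1 <= (val J).1,
    (val J).2 <= (val I).2 &
    forall y, (val J).1 <= y <= (val J).2 -> ~~ root (Q n) y]}.
  case: I => -[a b] /= ab; apply: cid.
  have [c [d [ac cd db cdQ]]] := root_free_subinterval (Q0 n) ab.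
  by exists (exist _ (c, d) cd).
pose I := fix I n : ivl :=
  if n is m.+1 then sval (step m (I m)) else exist _ (0, 1) ltr01.
pose a n := (val (I n)).1; pose b n := (val (I n)).2.
have stepP n : [/\ a n <= a n.+1, b n.+1 <= b n &
    forall y, a n.+1 <= y <= b n.+1 -> ~~ root (Q n) y].
  exact: svalP (step n (I n)).
have a_mono m n : (m <= n)%N -> a m <= a n.
  elim: n => [|n IH]; first by rewrite leqn0 => /eqP ->.
  rewrite leq_eqVlt ltnS => /orP[/eqP ->//|/IH amn]; apply: le_trans amn _.
  by have [] := stepP n.
have b_mono m n : (m <= n)%N -> b n <= b m.
  elim: n => [|n IH]; first by rewrite leqn0 => /eqP ->.
  rewrite leq_eqVlt ltnS => /orP[/eqP ->//|/IH]; apply: le_trans.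
  by have [] := stepP n.
have ab m n : a m <= b n.
  apply: (@le_trans _ _ (a (maxn m n))); first exact/a_mono/leq_maxl.
  apply: (@le_trans _ _ (b (maxn m n))); last exact/b_mono/leq_maxr.
  exact/ltW/(valP (I (maxn m n))).
pose A : classical_sets.set R := fun y => exists n, y = a n.
have supA n : a n <= sup A <= b n.
  apply/andP; split.
    apply: ub_le_sup; last by exists n.
    by exists (b 0%N) => _ [m ->].
  apply: ge_sup; first by exists (a 0%N), 0%N.
  by move=> _ [m ->].
by exists (sup A) => n; have [_ _] := stepP n; apply.
Qed.

(** One coordinate at a time: when the earlier ones are independent, every nonzero polynomial
    specializes to a nonzero univariate one, and the new coordinate only has to avoid the roots of
    countably many of these. *)
Lemma alg_independent_exists n : exists x : 'I_n -> R,
  forall P : {mpoly rat[n]}, mmap ratr x P = 0 -> P = 0.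
Proof.
elim: n => [|n [x indx]].
  exists (fun _ => 0) => P.
  have -> : P = (P@_0%MM)%:MP.
    apply/mpolyP=> m; have -> : m = 0%MM by apply/mnmP; case.
    by rewrite mcoeffC eqxx mulr1.
  by rewrite mmapC => /eqP; rewrite fmorph_eq0 => /eqP ->; rewrite mpolyC0.
pose low (m : 'X_{1..n.+1}) : 'X_{1..n} := [multinom m (widen_ord (leqnSn n) i) | i < n].
have low_inj m1 m2 : low m1 = low m2 -> m1 ord_max = m2 ord_max -> m1 = m2.
  move=> /mnmP lowE maxE; apply/mnmP=> i; case: (unliftP ord_max i) => [j ->|-> //].
  have -> : lift ord_max j = widen_ord (leqnSn n) j.
    by apply: ord_inj; rewrite lift_max.
  by have := lowE j; rewrite !mnmE.
(* [uni P] is [P] with [x] substituted for all variables but the last. Each of its coefficients is a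
   rational polynomial evaluated at [x], so it vanishes only if that polynomial does. *)
pose uni (P : {mpoly rat[n.+1]}) : {poly R} :=
  \sum_(m <- msupp P) (ratr P@_m * mmap1 x (low m)) *: 'X^(m ord_max).
have uni_neq0 (P : {mpoly rat[n.+1]}) : P != 0 -> uni P != 0.
  rewrite -msupp_eq0; case Psupp: (msupp P) => [//|m0 l] _.
  have m0P : m0 \in msupp P by rewrite Psupp mem_head.
  apply: contraTneq m0P => uni0; rewrite mcoeff_msupp negbK.
  pose Pk := \sum_(m <- msupp P | m ord_max == m0 ord_max) P@_m *: 'X_[low m].
  have Pk0 : Pk = 0.
    apply: indx; rewrite raddf_sum /= -[RHS](coef0 R (m0 ord_max)) -uni0 coef_sum.
    rewrite big_mkcond; apply: eq_bigr => m _ /=.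
    rewrite coefZ coefXn mmapZ mmapX eq_sym.
    by case: ifP => _; rewrite ?mulr1 ?mulr0.
  have : (0 : {mpoly rat[n]})@_(low m0) = 0 by rewrite mcoeff0.
  rewrite -[X in X@__]Pk0 raddf_sum /=.
  rewrite big_mkcond (bigD1_seq m0) ?msupp_uniq ?Psupp ?mem_head //= eqxx.
  rewrite mcoeffZ mcoeffX eqxx mulr1 big1 ?addr0 => [->|m mm0]; first exact: eqxx.
  case: eqP => // mk; rewrite mcoeffZ mcoeffX.
  case: eqP => [/low_inj/(_ mk) mE|_]; last by rewrite mulr0.
  by rewrite mE eqxx in mm0.
pose decode (s : seq ('X_{1..n.+1} * rat)) : {mpoly rat[n.+1]} :=
  \sum_(c <- s) c.2 *: 'X_[c.1].
have decodeK (P : {mpoly rat[n.+1]}) : decode [seq (m, P@_m) | m <- msupp P] = P.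
  by rewrite /decode big_map -mpolyE.
(* Polynomials are enumerated through their lists of terms; invalid codes and codes of zero get the
   root-free value 1. *)
pose Q k := if unpickle k is Some s then
  if decode s == 0 then 1 else uni (decode s) else 1.
have [k|y Qy] := @avoid_roots Q.
  rewrite /Q; case: (unpickle k) => [s|]; last exact: oner_neq0.
  by case: (decode s =P 0) => [_|/eqP ds]; [exact: oner_neq0|exact: uni_neq0].
exists (fun i => if unlift ord_max i is Some j then x j else y) => P evP.
apply/eqP/negPn/negP => P0.
have := Qy (pickle [seq (m, P@_m) | m <- msupp P]).
rewrite /Q pickleK decodeK (negPf P0) => /negP; apply.
rewrite /root horner_sum -[X in _ == X]evP; apply/eqP/eq_bigr => m _.
rewrite hornerZ hornerXn -mulrA; congr (_ * _).
rewrite /mmap1 big_ord_recr /= unlift_none; congr (_ * _).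
apply: eq_bigr => i _; have -> : widen_ord (leqnSn n) i = lift ord_max i.
  by apply: ord_inj; rewrite lift_max.
by rewrite liftK mnmE; congr (_ ^+ m _); apply: ord_inj; rewrite lift_max.
Qed.

End Transcendence.

Section Genericity.
Variable R : realType.

Section Transfer.
Variable I : finType.
Implicit Types x : I -> R.

Local Notation eval x := (mmap ratr (fun k => x (enum_val k))).

Definition independent_rows (A B : finType) (S : {set A}) (F : A -> B -> R) :=
  forall c : A -> R, (forall b, \sum_(a in S) c a * F a b = 0) ->
  forall a, a \in S -> c a = 0.

Lemma independent_rowsP (A B : finType) (S : {set A}) (F : A -> B -> R) :
  reflect (independent_rows S F)
    (row_free (\matrix_(k < #|S|, l < #|B|) F (enum_val k) (enum_val l))).
Proof.
set M := \matrix_(k, l) _; apply: (iffP idP) => [fM c c0 a aS|ind].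
  have: (\row_k c (enum_val k)) *m M = 0 *m M.
    rewrite mul0mx; apply/rowP=> l; rewrite !mxE -[RHS](c0 (enum_val l)) [RHS]big_enum_val.
    by apply: eq_bigr => k _; rewrite !mxE.
  move/(row_free_inj fM)/rowP/(_ (enum_rank_in aS a)).
  by rewrite !mxE enum_rankK_in.
apply: inj_row_free => v /rowP vM; apply/rowP => k; rewrite mxE.
pose c a := \sum_(l | enum_val l == a) v 0 l.
have cE l : c (enum_val l) = v 0 l.
  rewrite /c (bigD1 l) //= big1 ?addr0 // => m /andP[/eqP /enum_val_inj ->].
  by rewrite eqxx.
rewrite -cE; apply: ind (enum_valP k) => b.
have := vM (enum_rank b); rewrite !mxE => vb; rewrite -[RHS]vb [LHS]big_enum_val.
by apply: eq_bigr => l _; rewrite cE !mxE enum_rankK.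
Qed.

(** A maximal minor that is nonzero at [x0] is a nonzero polynomial with rational coefficients, so
    it does not vanish at an algebraically independent [x]. *)
Lemma generic_independent_rows (A B : finType) (S : {set A})
    (F : A -> B -> {mpoly rat[#|I|]}) x0 x :
  alg_independent_over_rat x ->
  independent_rows S (fun a b => eval x0 (F a b)) ->
  independent_rows S (fun a b => eval x (F a b)).
Proof.
move=> indx /independent_rowsP; set M0 := (\matrix_(k, l) _) => fM0.
apply/independent_rowsP; set M := (\matrix_(k, l) _).
pose PM := \matrix_(k < #|S|, l < #|B|) F (enum_val k) (enum_val l).
have full0 : row_full M0^T by rewrite /row_full mxrank_tr.
pose f := fullrankfun full0.
have detE y : (\det (rowsub f (map_mx (eval y) PM)^T)) = eval y (\det (rowsub f PM^T)) :> R.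
  by rewrite -(det_map_mx (eval y)); congr (\det _); apply/matrixP=> i j; rewrite !mxE.
have ME y : (\matrix_(k < #|S|, l < #|B|) (eval y (F (enum_val k) (enum_val l)))) = map_mx (eval y) PM :> matrix R _ _.
  by apply/matrixP=> i j; rewrite !mxE.
have: \det (rowsub f M0^T) != 0.
  by rewrite -unitfE -unitmxE; apply: fullrowsub_unit.
rewrite /M0 ME detE => P0.
have {P0} : \det (rowsub f M^T) != 0.
  rewrite /M ME detE; apply: contraNneq P0 => /indx ->; exact/eqP/rmorph0.
rewrite -unitfE -unitmxE => Mu; apply: inj_row_free => v vM.
have: rowsub f M^T *m v^T = 0.
  rewrite mul_rowsub_mx -trmx_mul vM; apply/matrixP=> i j; by rewrite !mxE.
move/(canRL (mulKmx Mu)); rewrite mulmx0 => v0.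
by rewrite -[v]trmxK v0 trmx0.
Qed.

End Transfer.

Variables (V : finType) (T : nat).
Implicit Types (q : V -> nat -> R).

(** Both clauses of [universal] assert independence of rows with polynomial entries, so each
    transfers from one suitable special placement. *)
Lemma generic_universal q :
  alg_independent_over_rat (fun xi : V * 'I_T => q xi.1 xi.2) -> universal T q.
Proof.
move=> gq; pose I : finType := (V * 'I_T)%type.
pose eval x := mmap (ratr : rat -> R) (fun k : 'I_#|I| => x (enum_val k : I)).
pose X x (i : 'I_T) : {mpoly rat[#|I|]} := 'X_(enum_rank ((x, i) : I)).
pose pt (p : V -> nat -> R) (xi : I) : R := p xi.1 xi.2.
have evalX p x i : eval (pt p) (X x i) = p x i.
  by rewrite /eval /X mmapX mmap1U enum_rankK.
split=> [t E tT sE [p ind] om st e eE | t tT].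
  pose F (e : {set V}) (b : 'I_t * 'I_t) := \sum_(x in e) \sum_(y in e :\ x)
    X x (widen_ord tT b.1) * X y (widen_ord tT b.2).
  have evalF p' e' b : eval (pt p') (F e' b) = entry p' e' b.1 b.2.
    rewrite /F /eval raddf_sum; apply: eq_bigr => x _; rewrite raddf_sum.
    by apply: eq_bigr => y _; rewrite [LHS](rmorphM (mmap ratr _)); congr (_ * _); apply: evalX.
  refine (generic_independent_rows (F := F) (x0 := pt p) gq _ _ eE).
    move=> c c0 a aE; apply: (ind c) => // i j it jt.
    rewrite -[RHS](c0 (Ordinal it, Ordinal jt)); apply: eq_bigr => g _.
    by congr (_ * _); apply/esym/(evalF p).
  move=> b; rewrite -[RHS](st b.1 b.2 (ltn_ord _) (ltn_ord _)); apply: eq_bigr => g _.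
  by congr (_ * _); apply: (evalF q).
(* For general position the special placement sends the vertices of [N] to distinct basis vectors,
   which exist because $|N|\le t$. *)
move=> N c _ Nt c0 u uN; pose p x i : R := (index x (enum N) == i)%:R.
pose F x (i : 'I_t) := X x (widen_ord tT i).
refine (generic_independent_rows (F := F) (x0 := pt p) gq _ _ uN).
  move=> d d0 a aN.
  have ia : (index a (enum N) < t)%N by rewrite (leq_trans _ Nt) // cardE index_mem mem_enum.
  have dE b : d b * eval (pt p) (F b (Ordinal ia)) = d b * (index b (enum N) == index a (enum N))%:R.
    by rewrite evalX.
  have := d0 (Ordinal ia); rewrite (eq_bigr _ (fun b _ => dE b)) => <-.
  rewrite (bigD1 a) //= big1 ?addr0 => [|b /andP[bN ba]]; first by rewrite eqxx mulr1.
   case: eqP => [|_]; last by rewrite mulr0.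
  by move/index_inj => bE; rewrite bE ?mem_enum ?eqxx // in ba.
move=> i; rewrite -[RHS](c0 i (ltn_ord i)); apply: eq_bigr => a _.
by congr (_ * _); apply: (evalX q).
Qed.

Lemma generic_exists : exists q : V -> nat -> R,
  alg_independent_over_rat (fun xi : V * 'I_T => q xi.1 xi.2).
Proof.
have [x indx] := alg_independent_exists R #|{: V * 'I_T}|.
exists (fun v i => if insub i is Some j then x (enum_rank (v, j)) else 0) => P evP.
apply: indx; rewrite -[RHS]evP; apply: eq_bigr => m _; congr (_ * _).
apply: eq_bigr => k _; congr (_ ^+ _).
by rewrite valK -surjective_pairing enum_valK.
Qed.

Lemma universal_exists : exists q : V -> nat -> R, universal T q.
Proof. by have [q /generic_universal] := generic_exists; exists q. Qed.

End Genericity.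

(** * Rank bounds for the graphs of the families C(n, t) *)

Section RankBound.
Variables (R : realType).

Section Bound.
Variable V : finType.
Implicit Types (E H : {set {set V}}) (u v w x y : V) (e f : {set V}) (A B W : {set V}).
Implicit Types (p q : V -> nat -> R) (om : {set V} -> R).

(* The edge vectors have rank at most [c], in dual form. *)
Definition rank_bound t E p (c : nat) :=
  exists L : nat -> {set V} -> R, forall om,
    (forall k, (k < c)%N -> \sum_(e in E) L k e * om e = 0) -> stress t E p om.

Lemma rank_bound_card t E p c : indep_at t E p -> rank_bound t E p c -> (#|E| <= c)%N.
Proof.
move=> ind [L LP].
have /independent_rowsP : independent_rows E (fun e (k : 'I_c) => L k e).
  move=> om om0; apply: ind; apply: LP => k kc.
  by rewrite -[RHS](om0 (Ordinal kc)); apply: eq_bigr => e _; rewrite mulrC.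
by move/eqP <-; apply: leq_trans (rank_leq_col _) _; rewrite card_ord.
Qed.

Lemma entry_project p e i j k beta :
  entry (fun u l => p u l - p u k * beta l) e i j =
  entry p e i j - entry p e i k * beta j - entry p e k j * beta i
  + entry p e k k * (beta i * beta j).
Proof.
rewrite /entry !mulr_suml -!sumrB -big_split /=; apply: eq_bigr => x _.
rewrite !mulr_suml -!sumrB -big_split /=; apply: eq_bigr => y _; ring.
Qed.

(* The coordinates of the projection from $p_v$, with coordinate [k] dropped. *)
Definition project p v k u i := p u (bump k i) - p u k * (p v (bump k i) / p v k).

(** Once the weighted entries of column [k] vanish, replacing [p] by its projection from $p_v$
    changes no weighted sum ([entry_project]), and the projection sends [v] to zero, which removes
    all edges at [v]. The functionals numbered from [c] on are these column entries. *)
Lemma rank_bound_cone t E p v k c : simple E -> (k <= t)%N -> p v k != 0 ->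
  rank_bound t (del E v) (project p v k) c -> rank_bound t.+1 E p (c + t.+1).
Proof.
move=> sE kt pvk [L LP].
exists (fun l e => if (l < c)%N then (e \in del E v)%:R * L l e else entry p e (l - c) k).
move=> om om0; have S0 i : (i < t.+1)%N -> \sum_(e in E) om e * entry p e i k = 0.
  move=> it; have := om0 (c + i)%N; rewrite ltn_add2l it => /(_ isT).
  rewrite ltnNge leq_addr /= addKn => s0; rewrite -[RHS]s0.
  by apply: eq_bigr => e _; rewrite mulrC.
have S0' i : (i < t.+1)%N -> \sum_(e in E) om e * entry p e k i = 0.
  by move=> it; rewrite -[RHS](S0 i it); apply: eq_bigr => e _; rewrite entryC.
pose beta i := p v i / p v k; pose p' u l := p u l - p u k * beta l.
have SE i j : (i < t.+1)%N -> (j < t.+1)%N ->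
    \sum_(e in E) om e * entry p e i j = \sum_(e in del E v) om e * entry p' e i j.
  move=> it jt; have -> : \sum_(e in E) om e * entry p e i j = \sum_(e in E) om e * entry p' e i j.
    under [RHS]eq_bigr => e _ do rewrite entry_project mulrDr !mulrBr !mulrA.
    rewrite big_split /= !sumrB -!mulr_suml S0 // S0' // S0 // !mul0r.
    by rewrite !subr0 addr0.
  rewrite (sum_star_del v _ sE) big1 ?add0r // => u /(nbr_neq sE) uv.
  have p'v l : p' v l = 0 by rewrite /p' /beta mulrC divfK ?subrr.
  by rewrite entry2r // !p'v mul0r mulr0 addr0 mulr0.
have st : stress t (del E v) (project p v k) om.
  apply: LP => l lc; have := om0 l; rewrite ltn_addr // lc => /(_ isT) s0.
  rewrite -[RHS]s0 (sum_star_del v _ sE) [X in _ = X + _]big1 => [|u _]; last first.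
    by rewrite inE set21 andbF !mul0r.
  by rewrite add0r; apply: eq_bigr => e ->; rewrite mul1r.
move=> i j it jt; case: (eqVneq j k) => [->|jk]; first exact: S0.
case: (eqVneq i k) => [->|ik]; first exact: S0'.
rewrite SE //.
have unb l : (l < t.+1)%N -> l != k -> (unbump k l < t)%N /\ bump k (unbump k l) = l.
  move=> lt lk; split; last exact: unbumpK.
  by rewrite /unbump; case: (ltnP k l) lk => ? /eqP; lia.
have [it' bi] := unb i it ik; have [jt' bj] := unb j jt jk.
rewrite -[RHS](st _ _ it' jt'); apply: eq_bigr => e _; congr (_ * _).
by rewrite /entry /project bi bj.
Qed.

Lemma gen_pos_neq0 t p W v : gen_pos t.+1 p W -> v \in W ->
  exists2 k, (k <= t)%N & p v k != 0.
Proof.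
move=> gp vW; apply: contrapT => no.
have c0 i : (i < t.+1)%N -> \sum_(u in [set v]) 1 * p u i = 0.
  rewrite big_set1 mul1r => it; apply/eqP/negPn/negP => pvi.
  by apply: no; exists i.
have := gp [set v] (fun _ => 1); rewrite sub1set cards1.
by move=> /(_ vW isT c0 v (set11 v)) /eqP; rewrite oner_eq0.
Qed.

(** A dependence among the projected points lifts: [v] receives the coefficient that makes
    coordinate [k] vanish too. *)
Lemma gen_pos_project t p W v k : gen_pos t.+1 p W -> v \in W -> (k <= t)%N -> p v k != 0 ->
  gen_pos t (project p v k) (W :\ v).
Proof.
move=> gp vW kt pvk N c NW Nt c0 u uN.
have vN : v \notin N by apply/negP => /(subsetP NW); rewrite !inE eqxx.
pose c' u := if u == v then - (\sum_(w in N) c w * p w k / p v k) else c u.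
have c'N w : w \in N -> c' w = c w by rewrite /c'; case: eqP vN => // -> /negPf ->.
rewrite -c'N //; apply: (gp (v |: N)); rewrite ?inE ?uN ?orbT //.
- by rewrite subUset sub1set vW (subset_trans NW) // subD1set.
- by rewrite cardsU1 vN.
move=> i it; rewrite big_setU1 //= {1}/c' eqxx.
rewrite [X in _ + X](eq_bigr (fun w => c w * p w i)); last first.
  by move=> w wN; rewrite c'N.
rewrite mulNr mulr_suml addrC -sumrB; case: (eqVneq i k) => [->|ik].
  by apply: big1 => w _; rewrite divfK // subrr.
have bi : bump k (unbump k i) = i by apply: unbumpK.
have it' : (unbump k i < t)%N by rewrite /unbump; case: (ltnP k i) ik => ? /eqP; lia.
rewrite -[RHS](c0 _ it'); apply: eq_bigr => w _; rewrite /project bi; ring.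
Qed.

Lemma card_ltn_pairs d : #|[set ij : 'I_d * 'I_d | (ij.1 < ij.2)%N]| = 'C(d, 2).
Proof.
rewrite -sum1dep_card -(pair_big_dep predT (fun i j : 'I_d => (i < j)%N) (fun _ _ => 1%N)) /=.
rewrite (exchange_big_dep predT) //= -bin2_sum big_mkord; apply: eq_bigr => j _.
by rewrite (big_ord_narrow (ltnW (ltn_ord j))) sum1_card card_ord.
Qed.

End Bound.

Section Bipartite.
Variables (a b t : nat) (P : 'M[R]_(a, t)) (Q : 'M[R]_(b, t)).

Definition bip_stress (L : 'M[R]_(a, b)) : 'M[R]_t :=
  P^T *m L *m Q + (P^T *m L *m Q)^T.

Fact bip_stress_linear : linear bip_stress.
Proof.
move=> c L M; rewrite /bip_stress mulmxDr mulmxDl -scalemxAr -scalemxAl.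
by rewrite linearD linearZ /= scalerDr addrACA.
Qed.

HB.instance Definition _ :=
  GRing.isLinear.Build R 'M[R]_(a, b) 'M[R]_t _ bip_stress bip_stress_linear.

(* If $UP=WQ$ then $U^TSW$ is a stress for every skew-symmetric $S$; [U] and [W]
   come from a basis of the relations between the rows of [P] and [Q]. *)
Lemma rank_bip_stress : row_free P -> row_free Q ->
  (\rank (lin_mx bip_stress) + 'C(a + b - t, 2) <= a * b)%N.
Proof.
move=> fP fQ; set d := \rank (kermx (col_mx P (- Q))).
pose K : 'M_(d, a + b) := row_base (kermx (col_mx P (- Q))).
have dd : (a + b - t <= d)%N by rewrite /d mxrank_ker leq_sub2l // rank_leq_col.
have KPQ : K *m col_mx P (- Q) = 0 by apply/sub_kermxP; rewrite eq_row_base.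
have fK : row_free K by apply: row_base_free.
pose U := lsubmx K; pose W := rsubmx K.
have UW : U *m P = W *m Q.
  apply/eqP; rewrite -subr_eq0 -mulmxN -mul_row_col hsubmxK; exact/eqP.
(* A row vector killed by [U] is killed by [W], because [Q] is row free, and hence by the row free
   [K]. *)
have fU : row_free U.
  apply: inj_row_free => v vU; have vW : v *m W = 0.
    by apply: (row_free_inj fQ); rewrite -mulmxA -UW mulmxA vU !mul0mx.
  apply: (row_free_inj fK); rewrite -[K]hsubmxK mul_mx_row mul0mx vU.
  by rewrite -/W vW row_mx0.
have fW : row_free W.
  apply: inj_row_free => v vW; have vU : v *m U = 0.
    by apply: (row_free_inj fP); rewrite -mulmxA UW mulmxA vW !mul0mx.
  by apply: (row_free_inj fU); rewrite vU mul0mx.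
(* The matrices [D ij] with $i<j$ are the standard basis of the skew-symmetric matrices of size [d],
   whence the binomial coefficient. *)
pose S := [set ij : 'I_d * 'I_d | (ij.1 < ij.2)%N].
pose D (ij : 'I_d * 'I_d) : 'M[R]_d := delta_mx ij.1 ij.2 - delta_mx ij.2 ij.1.
pose Z := \matrix_(k < #|S|) mxvec (U^T *m D (enum_val k) *m W).
have ZE (v : 'rV_#|S|) : v *m Z = mxvec (U^T *m (\sum_k v 0 k *: D (enum_val k)) *m W).
  rewrite mulmx_sum_row mulmx_sumr mulmx_suml linear_sum; apply: eq_bigr => k _.
  by rewrite rowK -scalemxAr -scalemxAl linearZ.
have fZ : row_free Z.
  apply: inj_row_free => v; rewrite ZE => /eqP; rewrite mxvec_eq0 => /eqP UDW.
  have /(congr1 trmx) : U^T *m (\sum_k v 0 k *: D (enum_val k)) = 0.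
    by apply: (row_free_inj fW); rewrite UDW mul0mx.
  rewrite trmx_mul trmxK trmx0 => DU.
  have /(congr1 trmx) : (\sum_k v 0 k *: D (enum_val k))^T = 0.
    by apply: (row_free_inj fU); rewrite DU mul0mx.
  rewrite trmxK trmx0 => D0; apply/rowP => k; rewrite mxE.
  have DE l : D (enum_val l) (enum_val k).1 (enum_val k).2 = (l == k)%:R.
    have := enum_valP l; have := enum_valP k; rewrite !inE -(inj_eq enum_val_inj).
    case: (enum_val l) => i' j'; case: (enum_val k) => i j /= ij ij'.
    rewrite !mxE xpair_eqE [i == i']eq_sym [j == j']eq_sym.
    have -> : (i == j') && (j == i') = false.
      apply/negP => /andP[/eqP ii /eqP jj]; move: ij; rewrite ii jj => /ltnW.
      by rewrite leqNgt ij'.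
    by rewrite subr0.
  have /matrixP/(_ (enum_val k).1 (enum_val k).2) := D0.
  rewrite summxE [RHS]mxE (bigD1 k) //= big1 ?addr0 => [|l lk].
    by rewrite mxE DE eqxx mulr1.
  by rewrite mxE DE (negPf lk) mulr0.
have Zker : Z *m lin_mx bip_stress = 0.
  apply/row_matrixP => k; rewrite row_mul rowK mul_vec_lin row0.
  apply/eqP; rewrite mxvec_eq0; apply/eqP.
  have PU : P^T *m U^T = Q^T *m W^T by rewrite -!trmx_mul UW.
  (* Since $UP=WQ$, the symmetrized product becomes $(WQ)^T(D+D^T)WQ$, which is zero for skew
     $D$. *)
  have bE : bip_stress (U^T *m D (enum_val k) *m W) =
      (W *m Q)^T *m (D (enum_val k) + (D (enum_val k))^T) *m (W *m Q).
    have A : P^T *m (U^T *m D (enum_val k) *m W) *m Q =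
        (W *m Q)^T *m D (enum_val k) *m (W *m Q) by rewrite trmx_mul !mulmxA PU.
    rewrite /bip_stress A; move: (W *m Q) (D _) => X Y.
    by rewrite mulmxDr mulmxDl [(_ *m X)^T]trmx_mul [(X^T *m Y)^T]trmx_mul trmxK mulmxA.
  have D0 : D (enum_val k) + (D (enum_val k))^T = 0.
    by rewrite /D linearB /= !trmx_delta addrA subrK subrr.
  by apply: etrans bE _; rewrite D0 mulmx0 mul0mx.
have rankZ : \rank Z = 'C(d, 2) by move: fZ => /eqP ->; rewrite card_ltn_pairs.
have : (\rank Z <= \rank (kermx (lin_mx bip_stress)))%N.
  by apply: mxrankS; apply/sub_kermxP.
rewrite mxrank_ker rankZ => le_C.
have := leq_bin2l 2 dd; have := rank_leq_row (lin_mx bip_stress); lia.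
Qed.

End Bipartite.

Lemma row_free_gen_pos (V : finType) t p (W A : {set V}) :
  gen_pos t p W -> A \subset W -> (#|A| <= t)%N ->
  row_free (\matrix_(k < #|A|, i < t) p (enum_val k) i : 'M[R]_(_, _)).
Proof.
move=> gp AW At; apply: inj_row_free => v /rowP vP; apply/rowP => k; rewrite mxE.
pose c a := \sum_(l | enum_val l == a) v 0 l.
have cE l : c (enum_val l) = v 0 l.
  rewrite /c (bigD1 l) //= big1 ?addr0 // => m /andP[/eqP /enum_val_inj ->].
  by rewrite eqxx.
rewrite -cE; apply: (gp A c) (enum_valP k) => // i it.
have := vP (Ordinal it); rewrite !mxE => v0; rewrite -[RHS]v0 [LHS]big_enum_val.
by apply: eq_bigr => l _; rewrite cE !mxE.
Qed.

(** The edge weights form a matrix [L], and the functionals are the columns of a column basis of the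
    linear map [bip_stress]: if they vanish on [L], so does the map. The set [E] may be any part of
    the complete bipartite graph. *)
Lemma rank_bound_bip (V : finType) t (E : {set {set V}}) p (A B : {set V}) :
  [disjoint A & B] ->
  (forall e, e \in E -> exists2 a, a \in A & exists2 b, b \in B & e = [set a; b]) ->
  gen_pos t p (A :|: B) -> (#|A| <= t)%N -> (#|B| <= t)%N ->
  exists2 r : nat, rank_bound t E p r & (r + 'C(#|A| + #|B| - t, 2) <= #|A| * #|B|)%N.
Proof.
move=> dAB EAB gp At Bt.
pose P : 'M[R]_(_, t) := \matrix_(k < #|A|, i < t) p (enum_val k) i.
pose Q : 'M[R]_(_, t) := \matrix_(k < #|B|, i < t) p (enum_val k) i.
have fP : row_free P by apply: row_free_gen_pos gp (subsetUl _ _) At.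
have fQ : row_free Q by apply: row_free_gen_pos gp (subsetUr _ _) Bt.
pose N := lin_mx (bip_stress P Q).
exists (\rank N); last exact: rank_bip_stress.
pose M (e : {set V}) : 'M[R]_(#|A|, #|B|) :=
  \matrix_(i, j) ([set enum_val i; enum_val j] == e)%:R.
exists (fun k e => if insub k is Some i then (mxvec (M e) *m col_base N) 0 i else 0).
move=> om om0; pose L := \sum_(e in E) om e *: M e.
have LC : mxvec L *m col_base N = 0.
  apply/rowP => k; rewrite [RHS]mxE -[RHS](om0 k (ltn_ord k)).
  rewrite /L linear_sum mulmx_suml summxE; apply: eq_bigr => e _.
  by rewrite valK linearZ -scalemxAl mxE mulrC.
have /eqP : mxvec L *m N = 0 by rewrite -[N]mulmx_base mulmxA LC mul0mx.
rewrite mul_vec_lin mxvec_eq0 => /eqP L0 i j it jt.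
have LE : bip_stress P Q L = \sum_(e in E) om e *: bip_stress P Q (M e).
  by rewrite /L linear_sum; apply: eq_bigr => e _; rewrite linearZ.
have /matrixP/(_ (Ordinal it) (Ordinal jt)) := etrans (esym LE) L0.
rewrite summxE [RHS]mxE => s0; rewrite -[RHS]s0; apply: eq_bigr => e eE.
have [a aA [b bB eab]] := EAB e eE.
have ab : a != b by apply: contraTneq aA => ->; rewrite (disjointFl dAB).
have ME : M e = delta_mx (enum_rank_in aA a) (enum_rank_in bB b).
  apply/matrixP => k l; rewrite !mxE; congr (_%:R); congr nat_of_bool.
  apply/eqP/andP; rewrite eab.
    have kA := enum_valP k; have lB := enum_valP l.
    case/set2_eq => [[ka lb]|[kb la]].
      by split; apply/eqP/enum_val_inj; rewrite enum_rankK_in.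
    by move: kA; rewrite kb (disjointFl dAB).
  by move=> [/eqP -> /eqP ->]; rewrite !enum_rankK_in.
rewrite mxE; congr (_ * _); rewrite ME eab entry2 //.
have PQ (k l : 'I_t) : (P^T *m delta_mx (enum_rank_in aA a) (enum_rank_in bB b) *m Q) k l
    = p a k * p b l.
  rewrite -mulmxA mxE (bigD1 (enum_rank_in aA a)) //= big1 ?addr0 => [|m ma].
    rewrite !mxE enum_rankK_in //; congr (_ * _).
    rewrite (bigD1 (enum_rank_in bB b)) //= big1 ?addr0 => [|m mb].
      by rewrite !mxE !eqxx mul1r enum_rankK_in.
    by rewrite mxE (negPf mb) andbF mul0r.
  rewrite [X in _ * X]mxE big1 ?mulr0 // => l' _.
  by rewrite mxE (negPf ma) mul0r.
by rewrite [RHS]mxE PQ mxE PQ mulrC [X in _ + X]mulrC.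
Qed.

Lemma gen_pos_comp (V V' : finType) (f : V -> V') t p :
  injective f -> gen_pos t p setT -> gen_pos t (p \o f : V -> nat -> R) setT.
Proof.
move=> f_inj gp N c _ Nt c0 u uN.
pose c' x := \sum_(w in N | f w == x) c w.
have c'E w : w \in N -> c' (f w) = c w.
  move=> wN; rewrite /c' (bigD1 w) ?wN ?eqxx //= big1 ?addr0 // => z.
  by case/andP=> /andP[_ /eqP /f_inj ->]; rewrite eqxx.
rewrite -c'E //; apply: (gp (f @: N)); rewrite ?subsetT ?card_imset ?imset_f // => i it.
rewrite big_imset /=; last by move=> x y _ _; apply: f_inj.
by rewrite -[RHS](c0 i it); apply: eq_bigr => w wN; rewrite c'E.
Qed.

Lemma calC_inhabited n t F : calC n t F -> exists x : F, True.
Proof.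
case=> [m s m0 _|m m3|m s G _ _ _|m s a b _ _ /andP[a3 _] _ _].
- by exists (Ordinal m0).
- by exists (Ordinal (ltn_trans (isT : (0 < 2)%N) m3)).
- by exists (inr ord0).
- by exists (inl (inl (Ordinal (ltn_trans (isT : (0 < 2)%N) a3)))).
Qed.

(** Enlarging a side by one adds [b] to the product and only $a+b-t\le b$ to the binomial, so the
    weight grows with the sides while they stay below [t]. A subgraph may fill only part of the
    sides of its copy. *)
Lemma bip_weight_mono1 t a a' b r : (a' <= a)%N -> (a < t)%N ->
  (r + 'C(a' + b - t, 2) <= a' * b)%N -> (r + 'C(a + b - t, 2) <= a * b)%N.
Proof.
elim: a => [|a IH]; first by rewrite leqn0 => /eqP ->.
rewrite leq_eqVlt ltnS => /orP[/eqP ->//|a'a] aS /(IH a'a (ltnW aS)) {IH} IH.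
have : ('C(a.+1 + b - t, 2) <= 'C(a + b - t, 2) + b)%N.
  have [tab|abt] := leqP t (a + b); last by rewrite (_ : a.+1 + b - t = 0)%N //; lia.
  by rewrite addSn subSn // binS bin1 leq_add2l; lia.
by rewrite mulSn; lia.
Qed.

Lemma bip_weight_mono t a b a' b' r :
  (a' <= a)%N -> (b' <= b)%N -> (a < t)%N -> (b < t)%N ->
  (r + 'C(a' + b' - t, 2) <= a' * b')%N -> (r + 'C(a + b - t, 2) <= a * b)%N.
Proof.
move=> a'a b'b at1 bt1 /(bip_weight_mono1 a'a at1).
rewrite addnC [in X in (_ <= X)%N]mulnC [(a + b')%N]addnC addnC.
by move/(bip_weight_mono1 b'b bt1); rewrite addnC mulnC [(b + a)%N]addnC addnC.
Qed.

Lemma rank_bound_set0 (V : finType) t p : rank_bound t (set0 : {set {set V}}) p 0.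
Proof. by exists (fun _ _ => 0) => om _ i j _ _; rewrite big_set0. Qed.

(** Stated for edges inside [W] and a map injective on [W] only, so that the induction can drop the
    vertex over the apex of a cone without changing the vertex type. *)
Lemma weight_rank_bound t F c : weight t F c ->
  forall (V : finType) (E : {set {set V}}) (phi : V -> F) (W : {set V}) p,
  simple E -> (forall e, e \in E -> e \subset W) -> {in W &, injective phi} ->
  (forall x y, [set x; y] \in E -> adj (phi x) (phi y)) ->
  gen_pos t p W -> exists2 r : nat, rank_bound t E p r & r%:Z <= c.
Proof.
elim=> {t F c}.
- move=> n t _ _ V E phi W p sE _ _ Ephi _; exists 0%N => //.
  have -> : E = set0; last exact: rank_bound_set0.
  apply/setP => e; rewrite inE; apply/negP => eE; have [x [y [_ exy]]] := edge2 sE eE.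
  by have := Ephi x y; rewrite -exy => /(_ eE).
- move=> n n3 V E phi W p _ _ _ _ _; exists 1%N => //.
  exists (fun _ e => entry p e 0 0) => om /(_ 0%N isT) s0 [|//] [|//] _ _.
  by rewrite -[RHS]s0; apply: eq_bigr => e _; rewrite mulrC.
- move=> n t a b /andP[a3 at_] /andP[b3 bt] /andP[abt abn] V E phi W p sE EW inj Ephi gp.
  pose A := [set x in W | if phi x is inl (inl _) then true else false].
  pose B := [set x in W | if phi x is inl (inr _) then true else false].
  have dAB : [disjoint A & B].
    apply/pred0P => x /=; rewrite !inE; case: (phi x) => [[]|] *; rewrite ?andbF //.
  have Aa : (#|A| <= a)%N.
    pose g x : option 'I_a := if phi x is inl (inl i) then Some i else None.
    have gA : {in A &, injective g}.
      move=> x y; rewrite !inE /g => /andP[xW px] /andP[yW py] gxy.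
      apply: inj => //; move: px py gxy.
      by case: (phi x) => [[i|]|] //; case: (phi y) => [[j|]|] // _ _ [->].
    rewrite -[a]card_ord -(card_in_imset gA) -(card_imset 'I_a (@Some_inj _)).
    apply: subset_leq_card; apply/subsetP => _ /imsetP[x + ->].
    rewrite inE /g => /andP[_]; case: (phi x) => [[i|]|] // _; exact: imset_f.
  have Bb : (#|B| <= b)%N.
    pose g x : option 'I_b := if phi x is inl (inr i) then Some i else None.
    have gB : {in B &, injective g}.
      move=> x y; rewrite !inE /g => /andP[xW px] /andP[yW py] gxy.
      apply: inj => //; move: px py gxy.
      by case: (phi x) => [[|i]|] //; case: (phi y) => [[|j]|] // _ _ [->].
    rewrite -[b]card_ord -(card_in_imset gB) -(card_imset 'I_b (@Some_inj _)).
    apply: subset_leq_card; apply/subsetP => _ /imsetP[x + ->].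
    rewrite inE /g => /andP[_]; case: (phi x) => [[|i]|] // _; exact: imset_f.
  have [||||r rE rAB] := @rank_bound_bip V t E p A B dAB.
  + move=> e eE; have [x [y [xy exy]]] := edge2 sE eE.
    have := EW e eE; rewrite exy subUset !sub1set => /andP[xW yW].
    have := Ephi x y; rewrite -exy => /(_ eE).
    case px: (phi x) => [[i|i]|i] //; case py: (phi y) => [[j|j]|j] // _.
      by exists x; rewrite ?inE ?xW ?px //; exists y; rewrite ?inE ?yW ?py.
    by exists y; rewrite ?inE ?yW ?py //; exists x; rewrite ?inE ?xW ?px // setUC.
  + move=> N c NW; apply: gp; apply: subset_trans NW _; apply/subsetP => x.
    by rewrite !inE => /orP[] /andP[].
  + by lia.
  + by lia.
  exists r => //; have := bip_weight_mono Aa Bb _ _ rAB.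
  by lia.
move=> n t G c t2 tn CG wG IH V E phi W p sE EW inj Ephi gp.
have [g0 _] := calC_inhabited CG.
have [W0|[v0 v0W]] := set_0Vmem W.
  (* The induction hypothesis for the empty edge set serves only to show that $c$ is nonnegative. *)
  have [|||||r _ rc] := IH V (set0 : {set {set V}}) (fun _ => g0) set0 p.
  - by move=> e; rewrite inE.
  - by move=> e; rewrite inE.
  - by move=> x y; rewrite inE.
  - by move=> x y; rewrite inE.
  - move=> N d; rewrite subset0 => /eqP -> _ _ u; by rewrite inE.
  exists 0%N; last by lia.
  have -> : E = set0; last exact: rank_bound_set0.
  apply/setP => e; rewrite inE; apply/negP => eE; have [x [y [_ exy]]] := edge2 sE eE.
  by have := EW e eE; rewrite exy W0 subUset sub1set inE.
(* If no vertex of [W] lies over the apex, any vertex of [W] can be removed in its place. *)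
have [v vW vP] : exists2 v, v \in W & forall u, u \in W -> u != v ->
    if phi u is inl _ then true else false.
  have [/exists_inP [v vW pv]|/exists_inPn no] :=
      boolP [exists x in W, if phi x is inr _ then true else false].
    exists v => // u uW; apply: contra_neqT; case pu: (phi u) => [|i] // _.
    apply: inj => //; move: pv; rewrite pu; case: (phi v) => // j _.
    by rewrite [i]ord1 [j]ord1.
  exists v0 => // u uW _; by have := no u uW; case: (phi u).
case: t t2 tn CG wG IH gp => [//|t] t2 tn; rewrite !subn1 /= => CG wG IH gp.
have [k kt pvk] := gen_pos_neq0 gp vW.
have [|||||r rE rc] := IH V (del E v) (fun u => if phi u is inl g then g else g0)
    (W :\ v) (project p v k).
- exact: simple_del.
- move=> e; rewrite inE => /andP[eE ve]; apply/subsetP => x xe; rewrite !inE.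
  by rewrite (subsetP (EW e eE) x xe) andbT; apply: contraNneq ve => <-.
- move=> x y; rewrite !inE => /andP[xv xW] /andP[yv yW] /= pxy; apply: inj => //.
  have := vP x xW xv; have := vP y yW yv; move: pxy.
  by case: (phi x) => // i; case: (phi y) => // j ->.
- move=> x y; rewrite inE => /andP[xyE vxy]; have := Ephi x y xyE.
  have := EW _ xyE; rewrite subUset !sub1set => /andP[xW yW].
  have xv : x != v by apply: contraNneq vxy => <-; rewrite set21.
  have yv : y != v by apply: contraNneq vxy => <-; rewrite set22.
  have := vP x xW xv; have := vP y yW yv.
  by case: (phi x) => // i; case: (phi y).
- exact: gen_pos_project.
exists (r + t.+1)%N; last by lia.
exact: rank_bound_cone rE.
Qed.

End RankBound.

(** * From the rank of the tensors to stresses, and necessity *)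

Section Edges.
Variable G : sgraph.

Lemma edgesE x y : ([set x; y] \in edges G) = adj x y.
Proof.
apply/imset2P/idP => [[u v _]|xy]; last by exists x y; rewrite ?inE.
rewrite inE => /andP[_ uv] /set2_eq [[-> ->]|[-> ->]] //; by rewrite adj_sym.
Qed.

Lemma simple_edges : simple (edges G).
Proof.
move=> _ /imset2P [x y _ + ->]; rewrite inE cards2 => /andP[_ xy].
by case: eqP xy => // ->; rewrite adj_irrefl.
Qed.

End Edges.

Section Independence.
Variables (R : realType) (t : nat) (G : sgraph).
Implicit Types p : G -> 'rV[R]_t.

Definition coords p (x : G) (i : nat) : R := if insub i is Some j then p x 0 j else 0.

Lemma coordsE p x (i : 'I_t) : coords p x i = p x 0 i.
Proof. by rewrite /coords valK. Qed.

Lemma generic_coords p : generic p ->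
  alg_independent_over_rat (fun xi : G * 'I_t => coords p xi.1 xi.2).
Proof.
move=> gp P evP; apply: gp; rewrite -[RHS]evP; apply: eq_bigr => m _.
by congr (_ * _); apply: eq_bigr => k _; rewrite coordsE.
Qed.

(** Listing one vector per edge instead of one per orientation does not change the span, and
    freeness of that list is the absence of nonzero stresses. *)
Lemma S_rankP p : reflect (indep_at t (edges G) (coords p)) (S_rank p == #|edges G|).
Proof.
pose vec (e : {set G}) : 'M[R]_t := \matrix_(i, j) entry (coords p) e i j.
have vecE x y : x != y -> vec [set x; y] = edge_vector p x y.
  move=> xy; apply/matrixP => i j; rewrite !mxE entry2 // !big_ord1 !mxE.
  by rewrite !coordsE.
pose X := map_tuple vec (enum_tuple (edges G)).
have -> : S_rank p = \dim <<X>>.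
  rewrite /S_rank; congr (\dim _); apply/eqP; rewrite eqEsubv; apply/andP; split.
    apply/span_subvP => u /mapP[[x y]]; rewrite mem_enum inE /= => xy ->.
    apply: memv_span; apply/mapP; exists [set x; y]; first by rewrite mem_enum edgesE.
    by rewrite vecE //; apply: contraTneq xy => ->; rewrite adj_irrefl.
  apply/span_subvP => u /mapP[e]; rewrite mem_enum => eE ->.
  have [x [y [xy exy]]] := edge2 (@simple_edges G) eE.
  apply: memv_span; apply/mapP; exists (x, y); last by rewrite exy vecE.
  by rewrite mem_enum inE /= -edgesE -exy.
have XE (i : 'I_#|edges G|) : X`_i = vec (enum_val i).
  by rewrite -tnth_nth tnth_map (tnth_nth set0) (enum_val_nth set0).
rewrite -[X in _ == X](size_tuple X) -[_ == _]/(free X).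
apply: (iffP freeP) => [fX om st e eE|ind c c0 k].
  have := fX (fun k => om (enum_val k)) _ (enum_rank_in eE e).
  rewrite enum_rankK_in //; apply; apply/matrixP => i j.
  rewrite summxE [RHS]mxE -[RHS](st i j (ltn_ord i) (ltn_ord j)) [RHS]big_enum_val.
  by apply: eq_bigr => k _; rewrite XE !mxE.
pose om e := \sum_(l | enum_val l == e) c l.
have omE l : om (enum_val l) = c l.
  rewrite /om (bigD1 l) //= big1 ?addr0 // => m /andP[/eqP /enum_val_inj ->].
  by rewrite eqxx.
rewrite -omE; apply: ind (enum_valP k) => i j it jt.
have /matrixP/(_ (Ordinal it) (Ordinal jt)) := c0.
rewrite summxE [RHS]mxE => s0; rewrite -[RHS]s0 [LHS]big_enum_val.
by apply: eq_bigr => l _; rewrite omE XE !mxE.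
Qed.

(** A generic placement exists and is universal, so an arbitrary independent placement is as good as
    a generic one. *)
Lemma S_independentP : S_independent R t G <-> indep R t (edges G).
Proof.
split=> [[p gp /eqP/S_rankP ind]|ind]; first by exists (coords p).
have [q gq] := generic_exists R G t.
pose p (x : G) : 'rV[R]_t := \row_i q x i.
have cp x (i : 'I_t) : coords p x i = q x i by rewrite coordsE mxE.
exists p.
  move=> P evP; apply: gq; rewrite -[RHS]evP; apply: eq_bigr => m _.
  by congr (_ * _); apply: eq_bigr => k _; rewrite mxE.
apply/eqP/S_rankP; apply: (generic_universal _).1 (leqnn t) (@simple_edges G) ind.
move=> P evP; apply: gq; rewrite -[RHS]evP; apply: eq_bigr => m _.
by congr (_ * _); apply: eq_bigr => k _; rewrite cp.
Qed.

(** A subgraph is placed by restricting [p]. It stays independent and in general position, so its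
    edge count is bounded by any rank bound and thus by the weight of [F]. *)
Lemma S_independent_C : S_independent R t G -> C_independent t G.
Proof.
case=> p /generic_coords/generic_universal [_ gp] /eqP/S_rankP ind U D F c CF wF [U' [D' [f f_bij fE]]].
pose H := subgraph U D; have f_inj : injective f := bij_inj f_bij.
have val_E : [set val @: e | e : {set H} in edges H] \subset edges G.
  apply/subsetP => _ /imsetP[e eH ->]; have [x [y [xy exy]]] := edge2 (@simple_edges H) eH.
  rewrite exy imsetU1 imset_set1 edgesE.
  by move: eH; rewrite exy edgesE => /andP[].
have indH : indep_at t (edges H) (coords p \o val).
  apply: indep_at_image (indep_at_sub val_E ind) => [|e _|].
  - exact: simple_edges.
  - by move=> x y _ _; apply: val_inj.
  - by move=> e1 e2 _ _; apply/imset_inj/val_inj.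
have gpH : gen_pos t (coords p \o val : H -> nat -> R) setT.
  exact: gen_pos_comp val_inj (gp _ (leqnn t)).
have [|||r rE rc] := weight_rank_bound wF (phi := fun x : H => val (f x)) (@simple_edges H) _ _ _ gpH.
- by move=> e _; apply: subsetT.
- by move=> x y _ _ /val_inj /f_inj.
- by move=> x y; rewrite edgesE -fE => /andP[].
by apply: le_trans rc; rewrite lez_nat (rank_bound_card indH rE).
Qed.

End Independence.

Local Open Scope nat_scope.

(** * Embedding subgraphs into the families C(n, t) *)

Definition touching (V : finType) (E : {set {set V}}) (S : {set V}) :=
  [set e in E | ~~ [disjoint e & S]].

(* For disjoint [A] and [B] and a graph [E], the edges between [A] and [B]. *)
Definition cross (V : finType) (E : {set {set V}}) (A B : {set V}) :=
  touching E A :&: touching E B.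

Lemma set2_disjoint (V : finType) (x y : V) (S : {set V}) :
  [disjoint [set x; y] & S] = (x \notin S) && (y \notin S).
Proof.
apply/pred0P/andP => [dis|[xS yS] z].
  by have := dis x; have := dis y; rewrite /= !inE !eqxx orbT /= => -> ->.
by rewrite /= !inE; apply/negP => /andP[/orP[]/eqP->]; apply/negP.
Qed.

Section Fits.
Variable V : finType.
Implicit Types (E : {set {set V}}) (W S A B : {set V}).

(** Relative to a vertex set [W], so that apexes of cones can be removed one after another inside a
    fixed type; edges leaving [W] are ignored. *)
Definition fits t W E (c : int) := exists (F : sgraph) (phi : V -> F),
  [/\ calC #|W| t F, weight t F c, {in W &, injective phi} &
    forall x y, x \in W -> y \in W -> [set x; y] \in E -> adj (phi x) (phi y)].

Lemma index_ltn S x : x \in S -> index x (enum S) < #|S|.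
Proof. by rewrite cardE index_mem mem_enum. Qed.

Lemma index_injective S : {in S &, injective (fun x => index x (enum S))}.
Proof. by move=> x y xS yS; apply: index_inj; rewrite ?mem_enum. Qed.

Lemma fits_edgeless t W E : 0 < t -> 0 < #|W| ->
  (forall x y, x \in W -> y \in W -> [set x; y] \notin E) -> fits t W E 0.
Proof.
move=> t0 W0 noE; exists (edgeless #|W|).
exists (fun x => insubd (Ordinal W0) (index x (enum W))); split.
- exact: calC_edgeless.
- exact: weight_edgeless.
- move=> x y xW yW /(congr1 val); rewrite !val_insubd !index_ltn //.
  exact: index_injective.
- by move=> x y xW yW /(negP (noE x y xW yW)).
Qed.

Lemma fits_complete W E : simple E -> 2 < #|W| -> fits 1 W E 1.
Proof.
move=> sE W3; have W0 : 0 < #|W| by apply: leq_trans W3.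
pose phi x : 'I_#|W| := insubd (Ordinal W0) (index x (enum W)).
have inj : {in W &, injective phi}.
  move=> x y xW yW /(congr1 val); rewrite !val_insubd !index_ltn //.
  exact: index_injective.
exists (complete #|W|), phi; split=> //.
- exact: calC_complete.
- exact: weight_complete.
move=> x y xW yW xyE /=; apply/eqP => /inj xy.
by have := sE _ xyE; rewrite xy // setUid cards1.
Qed.

Lemma fits_cone t W E v c : simple E -> t.+3 <= #|W| -> 0 < t -> v \in W ->
  fits t (W :\ v) E c -> fits t.+1 W E (c + t.+1%:Z)%R.
Proof.
move=> sE tW t0 vW [F [phi [CF wF inj adjE]]].
have WE : #|W :\ v| = #|W|.-1 by rewrite (cardsD1 v W) vW.
exists (cone F), (fun x => if x == v then inr ord0 else inl (phi x)); split.
- by apply: calC_cone; rewrite ?addn2 // !subn1 /= -WE.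
- by apply: (weight_cone (n := #|W|)); rewrite ?addn2 // !subn1 /= -?WE.
- move=> x y xW yW; case: eqP => [->|/eqP xv]; case: eqP => [->|/eqP yv] //.
  by case=> /inj; apply; rewrite !inE ?xv ?yv.
move=> x y xW yW xyE; have xy : x != y.
  by apply/eqP => xy; have := sE _ xyE; rewrite xy setUid cards1.
case: (x =P v) => [xv|/eqP xv]; case: (y =P v) => [yv|/eqP yv] //.
  by rewrite xv yv eqxx in xy.
by apply: adjE; rewrite // !inE ?xv ?yv.
Qed.

Lemma fits_bipartite t W E A B : t.+2 <= #|W| ->
  A \subset W -> B \subset W -> [disjoint A & B] ->
  3 <= #|A| < t -> 3 <= #|B| < t -> t.+2 <= #|A| + #|B| ->
  (forall x y, x \in W -> y \in W -> [set x; y] \in E ->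
     (x \in A) && (y \in B) || (x \in B) && (y \in A)) ->
  fits t W E ((#|A| * #|B|)%:Z - 'C(#|A| + #|B| - t, 2)%:Z)%R.
Proof.
move=> tW AW BW dAB /andP[A3 At] /andP[B3 Bt] ABt EAB.
have ABW : #|A :|: B| = #|A| + #|B|.
  by rewrite cardsU (disjoint_setI0 dAB) cards0 subn0.
have le_W : #|A| + #|B| <= #|W| by rewrite -ABW subset_leq_card // subUset AW.
pose Z := W :\: (A :|: B).
have ZE : #|Z| = #|W| - #|A| - #|B|.
  by rewrite cardsDS ?subUset ?AW // ABW subnDA.
have A0 : 0 < #|A| by apply: leq_trans A3.
have B0 : 0 < #|B| by apply: leq_trans B3.
pose fA x : 'I_#|A| := insubd (Ordinal A0) (index x (enum A)).
pose fB x : 'I_#|B| := insubd (Ordinal B0) (index x (enum B)).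
(* Vertices outside both sides go to the isolated vertices; the final default is never reached on
   [W]. *)
pose phi x : bipartite_on #|W| #|A| #|B| :=
  if x \in A then inl (inl (fA x)) else if x \in B then inl (inr (fB x)) else
  if (insub (index x (enum Z)) : option 'I_(#|W| - #|A| - #|B|)) is Some i
  then inr i else inl (inl (Ordinal A0)).
have BnA x : x \in B -> x \in A = false by move=> xB; rewrite (disjointFl dAB).
have pA x : x \in A -> phi x = inl (inl (fA x)) by rewrite /phi => ->.
have pB x : x \in B -> phi x = inl (inr (fB x)) by rewrite /phi => xB; rewrite BnA ?xB.
have pZ x : x \in Z -> exists2 i : 'I_(#|W| - #|A| - #|B|),
    phi x = inr i & val i = index x (enum Z).
  move=> xZ; have := index_ltn xZ; rewrite ZE => ix.
  exists (Ordinal ix) => //; rewrite /phi; move: xZ; rewrite !inE negb_or.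
  by case/andP=> /andP[/negPf -> /negPf ->] _; rewrite insubT.
have inWP x : x \in W -> [\/ x \in A, x \in B | x \in Z].
  move=> xW; rewrite [x \in Z]inE xW inE andbT.
  by case: (x \in A); case: (x \in B); constructor.
exists (bipartite_on #|W| #|A| #|B|), phi; split.
- by apply: calC_bipartite; lia.
- by apply: weight_bipartite; lia.
- move=> x y /inWP[xA|xB|xZ] /inWP[yA|yB|yZ].
  + rewrite !pA // => -[] /(congr1 val); rewrite !val_insubd !index_ltn //.
    exact: index_injective.
  + by rewrite pA // pB.
  + by rewrite pA //; case: (pZ y yZ) => i ->.
  + by rewrite pB // pA.
  + rewrite !pB // => -[] /(congr1 val); rewrite !val_insubd !index_ltn //.
    exact: index_injective.
  + by rewrite pB //; case: (pZ y yZ) => i ->.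
  + by case: (pZ x xZ) => i ->; rewrite pA.
  + by case: (pZ x xZ) => i ->; rewrite pB.
  case: (pZ x xZ) => i -> iE; case: (pZ y yZ) => j -> jE [ij].
  by apply: (index_injective xZ yZ); rewrite -iE ij.
move=> x y xW yW /(EAB x y xW yW) /orP[]/andP[xS yS].
  by rewrite pA // pB.
by rewrite pB // pA.
Qed.

(** The vertices of [S] become apexes of successive cones over an edgeless graph, contributing $t$,
    $t-1$ and so on. *)
Lemma fits_cover t W E S : simple E -> t.+2 <= #|W| -> #|S| < t -> S \subset W ->
  (forall x y, x \in W -> y \in W -> [set x; y] \in E -> (x \in S) || (y \in S)) ->
  fits t W E (\sum_(i < #|S|) (t - i))%:Z.
Proof.
move kE: #|S| => k sE; elim: k => [|k IH] in t W S kE *.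
  move=> tW t0 SW ES; rewrite big_ord0; apply: fits_edgeless => //.
    by apply: leq_trans tW.
  move=> x y xW yW; apply/negP => /(ES _ _ xW yW).
  by rewrite (cards0_eq kE) !inE.
case: t => // t tW kt SW ES; have [v vS] : exists v, v \in S.
  by apply/card_gt0P; rewrite kE.
have vW := subsetP SW v vS.
have -> : (\sum_(i < k.+1) (t.+1 - i))%:Z = ((\sum_(i < k) (t - i))%:Z + t.+1%:Z)%R.
  by rewrite big_ord_recl subn0 addnC PoszD.
apply: (fits_cone sE _ _ vW) => //; first exact: leq_ltn_trans (leq0n k) kt.
apply: (IH t (W :\ v) (S :\ v)).
- by apply/eqP; rewrite -eqSS -kE (cardsD1 v S) vS.
- by move: tW; rewrite (cardsD1 v W) vW.
- by [].
- exact: setSD.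
move=> x y; rewrite !inE => /andP[xv xW] /andP[yv yW] /(ES _ _ xW yW).
by rewrite xv yv.
Qed.

(** Coning down to dimension one, where the complete graph has weight 1, gives
    $t+(t-1)+\dots+2+1$. *)
Lemma fits_all t W E : simple E -> 0 < t -> t.+2 <= #|W| -> fits t W E 'C(t.+1, 2)%:Z.
Proof.
move=> sE; elim: t => [//|[|t] IH] in W * => _ tW; first exact: fits_complete.
have [v vW] : exists v, v \in W by apply/card_gt0P; apply: leq_trans tW.
rewrite binS bin1 PoszD; apply: (fits_cone sE _ _ vW) => //; apply: IH => //.
by move: tW; rewrite (cardsD1 v W) vW.
Qed.

End Fits.

Lemma has_copy_of (F H : sgraph) (f : H -> F) : injective f ->
  (forall x y, adj x y -> adj (f x) (f y)) -> has_copy F H.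
Proof.
move=> f_inj f_adj; pose U := f @: [set: H].
exists U, [set f @: e | e : {set H} in edges H].
have fU x : f x \in U by apply: imset_f; rewrite inE.
exists (fun x => exist (fun y => y \in U) (f x) (fU x)).
  apply: inj_card_bij => [x y /(congr1 val) /f_inj //|].
  by rewrite card_sig card_imset // cardsT.
move=> x y; rewrite /= /subgraph_adj /=; apply/andP/idP => [[_]|xy].
  case/imsetP=> e eH; have [a [b [_ eab]]] := edge2 (@simple_edges H) eH.
  rewrite eab imsetU1 imset_set1 => /set2_eq; rewrite eab edgesE in eH.
  by case=> [[/f_inj -> /f_inj ->]|[/f_inj -> /f_inj ->]] //; rewrite adj_sym.
split; first exact: f_adj.
apply/imsetP; exists [set x; y]; first by rewrite edgesE.
by rewrite imsetU1 imset_set1.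
Qed.

(** All uses of ${\cal C}_t$-independence pass through spanning subgraphs, for which a copy in [F]
    is just an edge-preserving injection. *)
Lemma C_independent_card t (G : sgraph) (D : {set {set G}}) c :
  C_independent t G -> D \subset edges G -> fits t [set: G] D c -> (#|D|%:Z <= c)%R.
Proof.
move=> CG DG [F [phi [CF wF inj adjD]]]; rewrite cardsT in CF.
pose H := subgraph [set: G] D.
have cHF : has_copy F H.
  apply: (@has_copy_of F H (fun x => phi (val x))).
    by move=> x y /inj xy; apply/val_inj/xy; rewrite inE.
  by move=> x y /= /andP[_ xyD]; apply: adjD; rewrite ?inE.
have := CG _ _ _ _ CF wF cHF; suff -> : #|edges H| = #|D| by [].
rewrite -(card_imset _ (imset_inj (@val_inj _ _ H))).
apply: eq_card => e; apply/imsetP/idP => [[e' e'H ->]|eD].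
  have {}e'H : e' \in edges H := e'H.
  have [x [y [_ exy]]] := edge2 (@simple_edges H) e'H.
  rewrite exy imsetU1 imset_set1; move: e'H; rewrite exy (@edgesE H).
  by case/andP.
have [x [y [xy exy]]] := edge2 (@simple_edges G) (subsetP DG e eD).
pose x' : H := exist _ x (in_setT x); pose y' : H := exist _ y (in_setT y).
exists [set x'; y']; last by rewrite imsetU1 imset_set1.
rewrite (@edgesE H) /= /subgraph_adj /= -exy eD andbT -edgesE -exy.
exact: (subsetP DG).
Qed.

Section Consequences.
Variables (t : nat) (G : sgraph).
Hypotheses (CG : C_independent t G) (t0 : 0 < t) (tG : t.+2 <= #|G|).
Let sE := @simple_edges G.
Implicit Types (S A B : {set G}).

Lemma C_independent_cover S : #|S| < t ->
  #|touching (edges G) S| <= \sum_(i < #|S|) (t - i).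
Proof.
move=> St; rewrite -lez_nat; have DE : touching (edges G) S \subset edges G.
  by apply/subsetP => e; rewrite inE => /andP[].
apply: (C_independent_card CG DE); apply: fits_cover; rewrite ?cardsT //.
  exact: simple_sub sE.
move=> x y _ _; rewrite inE => /andP[_]; apply: contraNT; rewrite negb_or => /andP[xS yS].
by rewrite set2_disjoint xS.
Qed.

Lemma C_independent_size : #|edges G| <= 'C(t.+1, 2).
Proof.
rewrite -lez_nat; apply: (C_independent_card CG (subxx _)).
by apply: fits_all; rewrite ?cardsT.
Qed.

Lemma cross_between E A B x y : [disjoint A & B] -> [set x; y] \in cross E A B ->
  (x \in A) && (y \in B) || (x \in B) && (y \in A).
Proof.
move=> dAB; rewrite !inE -!andbA => /and4P[_ + _].
rewrite !set2_disjoint !negb_and !negbK.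
have := disjointFr dAB (x := x); have := disjointFr dAB (x := y).
case: (x \in A); case: (y \in A); case: (x \in B); case: (y \in B) => //.
- by move=> _ /(_ isT).
- by move=> /(_ isT).
Qed.

Lemma C_independent_bipartite A B : [disjoint A & B] ->
  3 <= #|A| < t -> 3 <= #|B| < t -> t.+2 <= #|A| + #|B| ->
  #|cross (edges G) A B| + 'C(#|A| + #|B| - t, 2) <= #|A| * #|B|.
Proof.
move=> dAB At Bt ABt; have DE : cross (edges G) A B \subset edges G.
  by apply/subsetP => e; rewrite !inE => /andP[/andP[]].
suff : (#|cross (edges G) A B|%:Z <= (#|A| * #|B|)%:Z - 'C(#|A| + #|B| - t, 2)%:Z)%R by lia.
apply: (C_independent_card CG DE); apply: fits_bipartite; rewrite ?cardsT ?subsetT //.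
by move=> x y _ _; apply: cross_between.
Qed.

End Consequences.

(** The member of the family is the cone with apex [v] over a bipartite graph one dimension
    lower. *)
Lemma C_independent_cone_bipartite t (G : sgraph) (v : G) (A B : {set G}) : C_independent t.+1 G ->
  t.+3 <= #|G| -> v \notin A :|: B -> [disjoint A & B] ->
  3 <= #|A| < t -> 3 <= #|B| < t -> t.+2 <= #|A| + #|B| ->
  #|star (edges G) v :|: cross (edges G) A B| + 'C(#|A| + #|B| - t, 2)
    <= #|A| * #|B| + t.+1.
Proof.
move=> CG tG; rewrite inE negb_or => /andP[vA vB] dAB At Bt ABt.
set D := star _ v :|: _; have DE : D \subset edges G.
  by apply/subsetP => e; rewrite !inE => /orP[/andP[]|/andP[/andP[]]].
have sE := @simple_edges G.
suff : (#|D|%:Z <= (#|A| * #|B|)%:Z - 'C(#|A| + #|B| - t, 2)%:Z + t.+1%:Z)%R by lia.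
apply: (C_independent_card CG DE); apply: (fits_cone (v := v)); rewrite ?cardsT ?inE //.
- exact: simple_sub sE.
- by lia.
apply: fits_bipartite => //.
- by have := cardsD1 v [set: G]; rewrite cardsT inE; lia.
- by apply/subsetP => x xA; rewrite !inE andbT; apply: contraTneq xA => ->.
- by apply/subsetP => x xB; rewrite !inE andbT; apply: contraTneq xB => ->.
move=> x y; rewrite !in_setD1 => /andP[xv _] /andP[yv _].
rewrite [_ \in D]inE => /orP[|/cross_between -> //].
by rewrite !inE (eq_sym v x) (negPf xv) (eq_sym v y) (negPf yv) andbF.
Qed.

(** * Reductions and the cases t <= 3 *)

(* Linear arithmetic on cardinals: equal cardinals may be written with different
   inferred instances, which [lia] alone would treat as distinct atoms. *)
Ltac clia :=
  repeat match goal with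
         | H : is_true (leq _ _) |- _ => revert H
         | H : @eq nat _ _ |- _ => revert H
         end;
  repeat (let n := fresh "n" in set n := #|_|; clearbody n); try clear; intros; lia.

Lemma cardD1_in (T : finType) (x : T) (A : {set T}) : x \in A -> #|A| = #|A :\ x|.+1.
Proof. by move=> xA; rewrite (cardsD1 x) xA. Qed.

Lemma setD1_notin (T : finType) (A : {set T}) y : y \notin A -> A :\ y = A.
Proof. by move=> yA; apply/setDidPl; rewrite disjoint_sym disjoints1. Qed.

Lemma card_D1_ge (T : finType) (A : {set T}) y : #|A| <= #|A :\ y|.+1.
Proof. by rewrite (cardsD1 y A) -add1n leq_add2r; case: (_ \in _). Qed.

Lemma sub_cards_eq (T : finType) (A B : {set T}) k : A \subset B -> #|A| = k -> #|B| <= k -> A = B.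
Proof. by move=> AB Ak Bk; apply/eqP; rewrite eqEcard AB Ak Bk. Qed.

Lemma setU1_cards (T : finType) (C A : {set T}) x k : x \notin A -> x \in C -> A \subset C -> #|A| = k ->
  #|C| <= k -> False.
Proof.
move=> xA xC AC Ak Ck; have : x |: A \subset C by rewrite subUset sub1set xC.
by move/subset_leq_card; rewrite cardsU1 xA Ak => h; move: (leq_trans h Ck); rewrite add1n ltnn.
Qed.

Lemma cards3_eq (T : finType) (A : {set T}) p q r : #|A| <= 3 -> p \in A -> q \in A -> r \in A ->
  p != q -> p != r -> q != r -> A = [set p; q; r].
Proof.
move=> A3 pA qA rA pq pr qr; apply/esym/eqP; rewrite eqEcard !subUset !sub1set pA qA rA /=.
by rewrite -setUA cardsU1 cards2 qr !inE negb_or pq pr.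
Qed.

Lemma uniq4P (T : eqType) (x y z w : T) : uniq [:: x; y; z; w] ->
  [/\ x != y, x != z, x != w & [/\ y != z, y != w & z != w]].
Proof.
by rewrite /= !inE !negb_or => /and4P[/and3P[-> -> ->] /andP[-> ->] ->].
Qed.

Definition covers (V : finType) (C : {set V}) (E : {set {set V}}) :=
  forall e, e \in E -> ~~ [disjoint e & C].

Definition biclique (V : finType) (E : {set {set V}}) (A B : {set V}) :=
  forall a b, a \in A -> b \in B -> [set a; b] \in E.

Section GraphBasics.
Variable V : finType.
Implicit Types (E H : {set {set V}}) (u v w x y : V) (e f : {set V}) (A B C N : {set V}).

Lemma nbr_del E v y : y != v -> nbr (del E v) y = nbr E y :\ v.
Proof.
move=> yv; apply/setP => u; rewrite !inE negb_or eq_sym yv andbC /=.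
by rewrite eq_sym.
Qed.

Lemma nbr_del_self E v : nbr (del E v) v = set0.
Proof. by apply/setP => u; rewrite !inE eqxx andbF. Qed.

Lemma nbr_sub E H v : H \subset E -> nbr H v \subset nbr E v.
Proof. by move=> /subsetP HE; apply/subsetP => u; rewrite !inE => /HE. Qed.

Lemma nbr_remove E a x : nbr (E :\ [set a; x]) a = nbr E a :\ x.
Proof.
apply/setP => u; rewrite !inE; congr (~~ _ && _).
by apply/eqP/eqP => [/set2_inj|->].
Qed.

Lemma nbr_remove_notin E f y : y \notin f -> nbr (E :\ f) y = nbr E y.
Proof.
move=> yf; apply/setP => u; rewrite !inE; case: eqP => // fE.
by rewrite -fE set21 in yf.
Qed.

Lemma card_del E v : simple E -> #|E| = #|nbr E v| + #|del E v|.
Proof. by move=> sE; rewrite (card_star_del E v) card_nbr. Qed.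

Lemma cover_nbr C E v : covers C E -> v \notin C -> nbr E v \subset C.
Proof.
move=> cC vC; apply/subsetP => u; rewrite inE => /cC.
by rewrite set2_disjoint vC negbK.
Qed.

Lemma covers_del C E v : covers C (del E v) -> covers (v |: C) E.
Proof.
move=> cC e eE; apply/pred0Pn; case: (boolP (v \in e)) => ve.
  by exists v; rewrite /= ve !inE eqxx.
have /cC/pred0Pn [z /= /andP[ze zC]] : e \in del E v by rewrite inE eE.
by exists z; rewrite /= ze inE zC orbT.
Qed.

Lemma card_bigcup_le (I : finType) (S : {set I}) (F : I -> {set V}) k :
  (forall i, i \in S -> #|F i| <= k) -> #|\bigcup_(i in S) F i| <= #|S| * k.
Proof.
move=> Fk; rewrite -sum_nat_const; apply: (@leq_trans (\sum_(i in S) #|F i|)).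
  elim/big_rec2: _ => [|i m A _ IH]; first by rewrite cards0.
  by apply: leq_trans (leq_card_setU _ _) _; rewrite leq_add2l.
exact: leq_sum.
Qed.

Lemma touch_sub_nbr E N f : simple E -> f \in E -> ~~ [disjoint f & N] ->
  f \in \bigcup_(y in N) star E y.
Proof.
move=> sE fE /pred0Pn [y /= /andP[yf yN]].
by apply/bigcupP; exists y; rewrite // inE fE.
Qed.

End GraphBasics.

Section Pick.
Variable V : finType.
Implicit Types (E H : {set {set V}}) (u v w x y : V) (e f : {set V}) (A B C N : {set V}).

Lemma pick_disjoint_edge E N k : simple E ->
  (forall y, y \in N -> #|nbr E y| <= k) -> #|N| * k < #|E| ->
  exists2 f, f \in E & [disjoint f & N].
Proof.
move=> sE Nk NE; apply/exists_inP; apply: contraTT NE => /exists_inPn no.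
rewrite -leqNgt; apply: (@leq_trans #|\bigcup_(y in N) star E y|).
  by apply/subset_leq_card/subsetP => f fE; apply: touch_sub_nbr => //; apply: no.
by apply: card_bigcup_le => y yN; rewrite -card_nbr //; apply: Nk.
Qed.

Lemma handshake E k : simple E -> (forall y, #|nbr E y| <= k) ->
  #|E| * 2 <= #|[set y | nbr E y != set0]| * k.
Proof.
move=> sE Ek; rewrite -!sum_nat_const.
apply: (@leq_trans (\sum_(y in [set y | nbr E y != set0]) #|nbr E y|)); last first.
  exact: leq_sum.
have -> : \sum_(y in [set y | nbr E y != set0]) #|nbr E y| = \sum_y #|nbr E y|.
  rewrite big_mkcond; apply: eq_bigr => y _; rewrite inE; case: eqP => //= ->.
  by rewrite cards0.
have -> : \sum_(e in E) 2 = \sum_(e in E) \sum_(y in e) 1.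
  by apply: eq_bigr => e /sE; rewrite sum1_card.
rewrite (exchange_big_dep predT) //=; apply: leq_sum => y _.
rewrite card_nbr // -sum1_card leq_eqVlt; apply/orP; left; apply/eqP.
by apply: eq_bigl => e; rewrite inE.
Qed.

(** At most $1+\deg(u)\,k$ vertices lie within distance two of [u], each neighbour accounting for
    itself and at most $k-1$ further vertices. By [handshake] more vertices than that are not
    isolated. *)
Lemma far_vertex E u k : simple E -> (forall y, #|nbr E y| <= k) ->
  (1 + #|nbr E u| * k) * k < #|E| * 2 ->
  exists w, [/\ w != u, w \notin nbr E u, [disjoint nbr E u & nbr E w] & nbr E w != set0].
Proof.
move=> sE Ek big; pose X := u |: \bigcup_(y in nbr E u) (y |: (nbr E y :\ u)).
have Xk : #|X| <= 1 + #|nbr E u| * k.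
  rewrite /X; apply: leq_trans (leq_card_setU _ _) _; rewrite cards1 leq_add2l.
  apply: card_bigcup_le => y uy; apply: leq_trans (leq_card_setU _ _) _.
  rewrite cards1; apply: leq_trans (Ek y); rewrite [X in _ <= X](cardsD1 u).
  by rewrite nbrC uy.
have : ~~ ([set y | nbr E y != set0] \subset X).
  apply/negP => /subset_leq_card leX.
  have := handshake sE Ek; rewrite leqNgt => /negP; apply; apply: leq_ltn_trans big.
  by rewrite leq_mul2r (leq_trans leX Xk) orbT.
case/subsetPn => w; rewrite !inE negb_or => w0 /andP[wu wX].
have wN y : y \in nbr E u -> (w != y) && (w \notin nbr E y).
  move=> uy; have : w \notin y |: (nbr E y :\ u).
    by apply: contra wX => wy; apply/bigcupP; exists y.
  by rewrite !inE !negb_or wu /=.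
exists w; split => //.
  by apply/negP => /wN; rewrite eqxx.
apply/pred0P => y /=; apply/negbTE/negP => /andP[/wN /andP[_ wy]].
by rewrite nbrC (negPf wy).
Qed.

End Pick.

Section Reductions.
Variable R : realType.

Section SameVertices.
Variable V : finType.
Implicit Types (E H : {set {set V}}) (u v w x y : V) (e f : {set V}) (A B C N : {set V}).

Lemma cone_reduction t E v : simple E -> #|nbr E v| <= t.+1 ->
  indep R t (del E v) -> indep R t.+1 E.
Proof.
move=> sE dv; have [q uq] := universal_exists R V t.+1.
by apply: (indep_cone uq) => //; rewrite -card_nbr.
Qed.

Lemma extension_reduction t E v f : simple E -> #|nbr E v| <= t ->
  f \in del E v -> [disjoint f & nbr E v] ->
  indep R t (del E v :\ f) -> indep R t.+1 E.
Proof.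
move=> sE dv fD; have [q uq] := universal_exists R V t.+1.
move: fD; rewrite inE => /andP[fE vf].
by apply: (indep_extension uq) => //; rewrite -card_nbr.
Qed.

(** The bound is [t.+2] because the edge [uv] is counted at both ends. *)
Lemma edge_cone_reduction t E u v : simple E -> u \in nbr E v ->
  [disjoint nbr E u & nbr E v] -> #|nbr E u| + #|nbr E v| <= t.+2 ->
  indep R t (del (del E v) u) -> indep R t.+1 E.
Proof.
move=> sE uv dis duv; have [q uq] := universal_exists R V t.+1.
apply: (indep_cone_edge uq) => //; rewrite -!card_nbr //; last exact: simple_del.
have vu : v \in nbr E u by rewrite nbrC.
rewrite nbr_del ?(nbr_neq sE uv) // addnC -ltnS -addSn; move: duv.
by rewrite (cardsD1 v (nbr E u)) vu.
Qed.

(** Degrees are at most [t], so vertices can be coned off one by one. This settles graphs on at most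
    [t.+1] vertices, where the family consists of the edgeless graph. *)
Lemma indep_small t E (W : {set V}) : simple E -> (forall e, e \in E -> e \subset W) ->
  #|W| <= t.+1 -> indep R t E.
Proof.
move=> sE EW; elim: t => [|t IH] in E W sE EW *.
  move=> W1; have -> : E = set0; last exact: indep_set0.
  apply/setP => e; rewrite inE; apply/negP => eE.
  by have := subset_leq_card (EW e eE); rewrite (sE e eE) leqNgt ltnS W1.
move=> Wt; have [W0|[v vW]] := set_0Vmem W.
  have -> : E = set0; last exact: indep_set0.
  apply/setP => e; rewrite inE; apply/negP => eE.
  by have := subset_leq_card (EW e eE); rewrite (sE e eE) W0 cards0.
have WD : #|W :\ v| <= t.+1 by move: Wt; rewrite (cardsD1 v W) vW.
apply: (@cone_reduction t E v) => //.
  apply: leq_trans WD; apply/subset_leq_card/subsetP => u uN.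
  rewrite !inE (nbr_neq sE uN) /=; move: uN; rewrite inE => /EW.
  by rewrite subUset !sub1set => /andP[].
apply: (IH _ (W :\ v)) => //; first exact: simple_del.
move=> e; rewrite inE => /andP[eE ve]; apply/subsetP => x xe; rewrite !inE.
by rewrite (subsetP (EW e eE) x xe) andbT; apply: contraNneq ve => <-.
Qed.

Definition merge u w x := if x == u then w else x.

Section Merge.
Variables (E : {set {set V}}) (u w : V).
Hypotheses (sE : simple E) (wu : w != u) (wuN : w \notin nbr E u)
  (dis : [disjoint nbr E u & nbr E w]).

Let E' := [set merge u w @: e | e : {set V} in E].

Lemma merge_set2 x y : merge u w @: [set x; y] = [set merge u w x; merge u w y].
Proof. by rewrite imsetU1 imset_set1. Qed.

Lemma merge_inj e : e \in E -> {in e &, injective (merge u w)}.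
Proof.
move=> eE x y xe ye; rewrite /merge; case: (x =P u) => [xu|_]; case: (y =P u) => [yu|_] //.
- by rewrite xu yu.
- move=> wy; case/negP: wuN; rewrite inE.
  have [x1 [x2 [x12 ex]]] := edge2 sE eE.
  suff -> : [set u; w] = e by [].
  apply/eqP; rewrite eqEcard (sE eE) cards2 eq_sym wu andbT subUset !sub1set.
  by rewrite -xu xe wy ye.
- move=> xw; case/negP: wuN; rewrite inE.
  suff -> : [set u; w] = e by [].
  apply/eqP; rewrite eqEcard (sE eE) cards2 eq_sym wu andbT subUset !sub1set.
  by rewrite -yu ye -xw xe.
Qed.

(** Two edges with the same image would join [u] and [w] to a common neighbour. *)
Lemma merge_imset_inj : {in E &, injective (fun e : {set V} => merge u w @: e)}.
Proof.
have mE x : x != u -> merge u w x = x by rewrite /merge => /negPf ->.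
have mu : merge u w u = w by rewrite /merge eqxx.
move=> e e' eE e'E /=.
wlog ue : e e' eE e'E / u \in e => [IH eq|].
  case: (boolP (u \in e)) => [ue|ue]; first exact: IH.
  case: (boolP (u \in e')) => [ue'|ue']; first by apply/esym/IH.
  have id_ (g : {set V}) : u \notin g -> merge u w @: g = g.
    move=> ug; rewrite -[RHS]imset_id; apply: eq_in_imset => x xg; apply: mE.
    by apply: contraNneq ug => <-.
  by rewrite -(id_ e) // eq id_.
have [x xu ex] := edge_at sE eE ue; rewrite ex merge_set2 mu mE //.
have xN : x \in nbr E u by rewrite inE -ex.
case: (boolP (u \in e')) => [ue'|ue'].
  have [y yu ey] := edge_at sE e'E ue'; rewrite ey merge_set2 mu mE //.
  by move/set2_inj ->.
have [a [b [ab eab]]] := edge2 sE e'E; rewrite eab merge_set2.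
have au : a != u by apply: contraNneq ue' => <-; rewrite eab set21.
have bu : b != u by apply: contraNneq ue' => <-; rewrite eab set22.
rewrite !mE // => eq; have : [set w; x] \in E by rewrite eq -eab.
by move=> wx; have := disjointFr dis xN; rewrite inE wx.
Qed.

Lemma simple_merge : simple E'.
Proof.
move=> _ /imsetP[e eE ->]; rewrite card_in_imset ?sE //; exact: merge_inj.
Qed.

Lemma card_merge : #|E'| = #|E|.
Proof. exact: card_in_imset merge_imset_inj. Qed.

Let mE x : x != u -> merge u w x = x.
Proof. by rewrite /merge => /negPf ->. Qed.

Let mu : merge u w u = w.
Proof. by rewrite /merge eqxx. Qed.

Let m_id e : u \notin e -> merge u w @: e = e.
Proof.
move=> ue; rewrite -[RHS]imset_id; apply: eq_in_imset => x xe; apply: mE.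
by apply: contraNneq ue => <-.
Qed.

Lemma nbr_merge : nbr E' w = nbr E u :|: nbr E w.
Proof.
apply/setP => y; rewrite !inE; apply/imsetP/orP => [[e eE]|[uy|wy]].
- case: (boolP (u \in e)) => ue; last by rewrite m_id // => ->; right.
  have [x xu ex] := edge_at sE eE ue; rewrite ex merge_set2 mu mE // => /set2_inj ->.
  by left; rewrite -ex.
- exists [set u; y] => //; rewrite merge_set2 mu mE //.
  by apply: (nbr_neq sE); rewrite inE.
exists [set w; y] => //; rewrite merge_set2 !mE //; apply: contraNneq wuN => <-.
by rewrite inE setUC.
Qed.

Lemma del_merge : del E' w = del (del E u) w.
Proof.
apply/setP => e; rewrite !inE; apply/andP/andP => [[/imsetP[g gE ->]]|[/andP[eE ue] we]].
  case: (boolP (u \in g)) => ug wg; last by move: wg; rewrite m_id ?gE.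
  by case/negP: wg; apply/imsetP; exists u.
by split=> //; apply/imsetP; exists e; rewrite ?m_id.
Qed.

Lemma nbr_merge_self : nbr E' u = set0.
Proof.
apply/setP => y; rewrite !inE; apply/negP => /imsetP[e eE uy].
have : u \in merge u w @: e by rewrite -uy set21.
case/imsetP => x xe; rewrite /merge; case: (x =P u) => [_ uw|xu ux].
  by move: wu; rewrite -uw eqxx.
by rewrite ux in xu.
Qed.

Lemma card_nbr_merge y : y != w -> #|nbr E' y| <= #|nbr E y|.
Proof.
move=> yw; have [->|yu] := eqVneq y u; first by rewrite nbr_merge_self cards0.
apply: (@leq_trans #|merge u w @: nbr E y|); last exact: leq_imset_card.
apply/subset_leq_card/subsetP => z; rewrite inE => /imsetP[e eE yz].
have ye : y \in e.
  have : y \in merge u w @: e by rewrite -yz set21.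
  case/imsetP => x xe; rewrite /merge; case: eqP => [_ yx|_ -> //].
  by rewrite yx eqxx in yw.
have [x xy ex] := edge_at sE eE ye; move: yz; rewrite ex merge_set2 (mE yu).
by move/set2_inj ->; apply: imset_f; rewrite inE -ex.
Qed.

Lemma indep_merge t : indep R t E' -> indep R t E.
Proof. apply: indep_image => //; [exact: merge_inj | exact: merge_imset_inj]. Qed.

Lemma card_nbr_merged : #|nbr E' w| = #|nbr E u| + #|nbr E w|.
Proof. by rewrite nbr_merge cardsU (disjoint_setI0 dis) cards0 subn0. Qed.

Lemma merge_cone t : #|nbr E u| + #|nbr E w| <= t.+1 ->
  indep R t (del (del E u) w) -> indep R t.+1 E.
Proof.
move=> uwt ind; apply: indep_merge; apply: (cone_reduction (v := w) simple_merge).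
  by rewrite card_nbr_merged.
by rewrite del_merge.
Qed.

(** Each neighbour of the merged vertex loses an edge when [u] and [w] are deleted and keeps at most
    [k]. So at most $tk$ of the remaining edges meet these neighbours, and some [f] avoids them. *)
Lemma merge_extension t k :
  #|nbr E u| + #|nbr E w| <= t -> (forall y, #|nbr E y| <= k.+1) ->
  t * k < #|del (del E u) w| ->
  (forall f, f \in del (del E u) w -> indep R t (del (del E u) w :\ f)) ->
  indep R t.+1 E.
Proof.
move=> uwt Ek big ind; have sD : simple (del (del E u) w) by do 2!apply: simple_del.
have [|||f fD fN] := @pick_disjoint_edge _ (del (del E u) w) (nbr E u :|: nbr E w) k.
- exact: sD.
- move=> y yN; have /orP[yu|yw] : (y \in nbr E u) || (y \in nbr E w) by rewrite -in_setU.
    apply: leq_trans (subset_leq_card (nbr_sub y (del_sub _ w))) _.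
    rewrite nbr_del ?(nbr_neq sE yu) //; have := Ek y; rewrite (cardsD1 u) nbrC yu.
    by rewrite add1n ltnS.
  have [yeq|yu] := eqVneq y u.
    by move: yw; rewrite yeq nbrC (negPf wuN).
  apply: leq_trans (_ : #|nbr (del E w) y| <= _).
    apply/subset_leq_card/nbr_sub/subsetP => g.
    by rewrite !inE => /andP[/andP[-> _] ->].
  rewrite nbr_del ?(nbr_neq sE yw) //; have := Ek y; rewrite (cardsD1 w) nbrC yw.
  by rewrite add1n ltnS.
- by rewrite -nbr_merge card_nbr_merged; apply: leq_ltn_trans big; rewrite leq_mul2r uwt orbT.
apply: indep_merge; apply: (extension_reduction (v := w) (f := f) simple_merge).
- by rewrite card_nbr_merged.
- by rewrite del_merge.
- by rewrite nbr_merge.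
by rewrite del_merge; apply: ind.
Qed.

End Merge.
End SameVertices.

(** * Padding by disjoint edges *)

Section Pad.

Definition pad_vertex (V : finType) (x : V) : option (option V) := Some (Some x).

Definition pad (V : finType) (E : {set {set V}}) : {set {set option (option V)}} :=
  [set None; Some None] |: [set @pad_vertex V @: e | e : {set V} in E].

Variable V : finType.
Implicit Types (E : {set {set V}}).

Let pv := @pad_vertex V.

Lemma pad_vertex_inj : injective pv. Proof. by move=> x y []. Qed.

Lemma simple_pad E : simple E -> simple (pad E).
Proof.
move=> sE e; rewrite inE => /orP[|/imsetP[g gE ->]]; first by rewrite inE => /eqP ->; rewrite cards2.
by rewrite card_imset ?sE //; apply: pad_vertex_inj.
Qed.

Lemma pad_set2 E x y : ([set pv x; pv y] \in pad E) = ([set x; y] \in E).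
Proof.
rewrite inE; have -> : ([set pv x; pv y] \in [set [set None; Some None]]) = false.
  apply/negbTE; rewrite inE; apply/eqP => /setP/(_ (pv x)).
  by rewrite !inE eqxx.
have -> : [set pv x; pv y] = pv @: [set x; y] by rewrite imsetU1 imset_set1.
by rewrite /= mem_imset //; apply: (imset_inj pad_vertex_inj).
Qed.

Lemma nbr_pad E x : nbr (pad E) (pv x) = pv @: nbr E x.
Proof.
apply/setP => y; apply/idP/imsetP => [|[z + ->]]; last by rewrite inE => zN; rewrite inE (pad_set2 E).
case: y => [[y|]|]; last 2 first.
- rewrite inE => /setU1P[/setP/(_ (pv x))|/imsetP[e _ /setP/(_ (Some None))]].
    by rewrite !inE eqxx.
  rewrite !inE eqxx orbT => /esym/imsetP[z _] //.
- rewrite inE => /setU1P[/setP/(_ (pv x))|/imsetP[e _ /setP/(_ None)]].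
    by rewrite !inE eqxx.
  rewrite !inE eqxx orbT => /esym/imsetP[z _] //.
rewrite inE (pad_set2 E x y) => xy; exists y => //; by rewrite inE.
Qed.

Lemma card_nbr_pad_new E y : y = None \/ y = Some None -> #|nbr (pad E) y| <= 1.
Proof.
move=> yn; rewrite -(cards1 (if y is None then Some None else None : option (option V))).
apply/subset_leq_card/subsetP => z; rewrite !inE => /orP[/eqP/set2_eq[[-> ->]|[-> ->]] //|/imsetP[e _ eE]].
have : y \in pv @: e by rewrite -eE set21.
by case/imsetP => x _ yx; case: yn; rewrite yx.
Qed.

Lemma card_nbr_pad E k : 0 < k -> (forall y, #|nbr E y| <= k) ->
  forall y, #|nbr (pad E) y| <= k.
Proof.
move=> k0 Ek [[y|]|].
- by rewrite (nbr_pad E y) card_imset //; apply: pad_vertex_inj.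
- by apply: leq_trans k0; apply: card_nbr_pad_new; right.
by apply: leq_trans k0; apply: card_nbr_pad_new; left.
Qed.

Lemma card_pad E : #|pad E| = #|E|.+1.
Proof.
rewrite cardsU1 card_imset; last exact: (imset_inj pad_vertex_inj).
rewrite (_ : _ \notin _) //; apply/imsetP => -[e _ /setP/(_ None)].
by rewrite !inE eqxx => /esym/imsetP[].
Qed.

Lemma indep_pad t E : simple E -> indep R t (pad E) -> indep R t E.
Proof.
move=> sE ind; apply: (indep_image (f := pv)) => //.
- by move=> e _ x y _ _; apply: pad_vertex_inj.
- by move=> e g _ _; apply/imset_inj/pad_vertex_inj.
by apply: indep_sub ind; apply: subsetUr.
Qed.

(* The ends of the added edge have degree one, so they lie in no large biclique. *)
Lemma biclique_pad E (A B : {set option (option V)}) : 1 < #|A| -> 1 < #|B| -> biclique (pad E) A B ->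
  exists A' B' : {set V}, [/\ #|A'| = #|A|, #|B'| = #|B| & biclique E A' B'].
Proof.
move=> A1 B1 bAB.
have old y (S : {set option (option V)}) : 1 < #|S| -> (forall b, b \in S -> [set y; b] \in pad E) -> exists x, y = pv x.
  move=> S1 yS; case: y yS => [[x|]|] yS; first by exists x.
    have: #|S| <= 1.
      apply: leq_trans (card_nbr_pad_new E (or_intror erefl)).
      by apply/subset_leq_card/subsetP => b bS; rewrite inE yS.
    by rewrite leqNgt S1.
  have: #|S| <= 1.
    apply: leq_trans (card_nbr_pad_new E (or_introl erefl)).
    by apply/subset_leq_card/subsetP => b bS; rewrite inE yS.
  by rewrite leqNgt S1.
have AE a : a \in A -> exists x, a = pv x.
  by move=> aA; apply: (old a B) => // b; apply: bAB.
have BE b : b \in B -> exists x, b = pv x.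
  by move=> bB; apply: (old b A) => // a aA; rewrite setUC; apply: bAB.
have preE (S : {set option (option V)}) : (forall a, a \in S -> exists x, a = pv x) ->
    #|pv @^-1: S| = #|S|.
  move=> SE; rewrite -(card_imset _ pad_vertex_inj); congr #|pred_of_set _|.
  apply/setP => a; apply/imsetP/idP => [[x + ->]|aS]; first by rewrite inE.
  by have [x ax] := SE a aS; exists x; rewrite // inE -/pv -ax.
exists (pv @^-1: A), (pv @^-1: B); split; rewrite ?preE // => a b.
by rewrite !inE => aA bB; rewrite -(pad_set2 E); apply: bAB.
Qed.

End Pad.

(** Independence of the padded graph implies that of the original, so a class closed under padding
    below [m] edges has to be treated at exactly [m] edges only. *)
Lemma pad_induction (Q : forall V : finType, {set {set V}} -> Prop) t m :
  (forall V E, Q V E -> simple E) ->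
  (forall V E, Q V E -> #|E| < m -> Q _ (pad E)) ->
  (forall V E, Q V E -> #|E| = m -> indep R t E) ->
  forall V E, Q V E -> #|E| <= m -> indep R t E.
Proof.
move=> Qs Qpad Qind V E QE Em; have [k kE] : exists k, #|E| + k = m.
  by exists (m - #|E|); rewrite subnKC.
elim: k => [|k IH] in V E QE Em kE *; first by apply: Qind; rewrite // -kE addn0.
have lt_m : #|E| < m by rewrite -kE addnS ltnS leq_addr.
apply: indep_pad; first exact: Qs QE.
by apply: IH; rewrite ?card_pad //; [apply: Qpad | rewrite -kE addSnnS].
Qed.

(** * Dimensions one to three *)

Section SmallDimension.
Variable V : finType.
Implicit Types (E H : {set {set V}}) (C : {set V}).

Lemma indep_dim1 E : simple E -> #|E| <= 1 -> indep R 1 E.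
Proof.
move=> sE E1; have [->|[e eE]] := set_0Vmem E; first exact: indep_set0.
have [x [y [xy exy]]] := edge2 sE eE.
have EW : E = [set [set x; y]].
  apply/esym/eqP; rewrite eqEcard sub1set -exy eE cards1 E1 //.
apply: (indep_small (W := [set x; y])) => //; last by rewrite cards2 xy.
by move=> g; rewrite EW inE => /eqP ->.
Qed.

(** Coning at a vertex of degree 2 leaves at most one edge. Otherwise the edges form a matching, and
    if there are three, an extension removes two of them. *)
Lemma indep_dim2 E : simple E -> #|E| <= 3 -> (forall y, #|nbr E y| <= 2) -> indep R 2 E.
Proof.
move=> sE E3 dE; have [->|[e eE]] := set_0Vmem E; first exact: indep_set0.
have [[v v2]|no2] := pselect (exists v, #|nbr E v| = 2).
  apply: (cone_reduction (v := v)) => //; apply: indep_dim1; first exact: simple_del.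
  by have := card_del v sE; clia.
have d1 y : #|nbr E y| <= 1.
  have := dE y; rewrite leq_eqVlt => /orP[/eqP y2|//]; by case: no2; exists y.
have [x [y [xy exy]]] := edge2 sE eE.
have x1 : 0 < #|nbr E x| by apply/card_gt0P; exists y; rewrite inE -exy.
have := card_del x sE => cD.
have [D1|D1] := leqP #|del E x| 1.
  by apply: (cone_reduction (v := x)) => //; apply: indep_dim1; [exact: simple_del|].
have [|||f fD fN] := @pick_disjoint_edge _ (del E x) (nbr E x) 0.
- exact: simple_del.
- move=> z zN; rewrite nbr_del ?(nbr_neq sE zN) //.
  by have := d1 z; rewrite (cardsD1 x) nbrC zN.
- by rewrite muln0; clia.
apply: (extension_reduction (v := x) (f := f)) => //.
apply: indep_dim1; first by apply: simple_sub (subD1set _ _) (simple_del sE).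
by have := cardD1_in fD; clia.
Qed.

(** Coning at a vertex of degree 3 leaves at most three edges, which fail in dimension 2 only when
    they form a star; then two vertices cover all six edges. A vertex of degree 2 takes an edge [f]
    along if four edges remain. In a larger matching two far vertices are first merged into one of
    degree 2. *)
Lemma indep_dim3 E : simple E -> #|E| <= 6 -> (forall y, #|nbr E y| <= 3) ->
  (forall C, #|E| = 6 -> #|C| <= 2 -> covers C E -> False) -> indep R 3 E.
Proof.
move=> sE E6 dE nC.
have d2 H : H \subset E -> #|H| <= 3 -> (forall y, #|nbr E y| <= 2) -> indep R 2 H.
  move=> HE H3 dE2; apply: indep_dim2 => //; first exact: simple_sub sE.
  by move=> y; apply: leq_trans (dE2 y); apply/subset_leq_card/nbr_sub.
have [[v v3]|no3] := pselect (exists v, #|nbr E v| = 3).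
  have cD := card_del v sE; apply: (cone_reduction (v := v)) => //.
  apply: indep_dim2; [exact: simple_del|clia|] => y; rewrite leqNgt; apply/negP => y3.
  have cDy := card_del y (simple_del (v := v) sE).
  apply: (nC [set v; y]); [clia|by rewrite cards2; case: eqP|].
  apply: covers_del; have DD0 : del (del E v) y = set0 by apply: cards0_eq; clia.
  move=> e eD; rewrite disjoint_sym disjoints1 negbK; apply/negPn/negP => ye.
  have : e \in del (del E v) y by rewrite inE eD.
  by rewrite DD0 inE.
have E2 y : #|nbr E y| <= 2.
  have := dE y; rewrite leq_eqVlt => /orP[/eqP y2|//]; by case: no3; exists y.
have [[v v2]|no2] := pselect (exists v, #|nbr E v| = 2).
  have cD := card_del v sE.
  have [D3|D3] := leqP #|del E v| 3.
    by apply: (cone_reduction (v := v)); rewrite ?v2 //; apply: d2 => //; apply: del_sub.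
  have [|||f fD fN] := @pick_disjoint_edge _ (del E v) (nbr E v) 1.
  - exact: simple_del.
  - move=> z zN; rewrite nbr_del ?(nbr_neq sE zN) //.
    by have := E2 z; rewrite (cardsD1 v) nbrC zN.
  - by rewrite v2; clia.
  apply: (extension_reduction (v := v) (f := f)); rewrite ?v2 //; apply: d2 => //.
    by apply: subset_trans (subD1set _ _) (del_sub _ _).
  by have := cardD1_in fD; clia.
have E1 y : #|nbr E y| <= 1.
  have := E2 y; rewrite leq_eqVlt => /orP[/eqP y2|//]; by case: no2; exists y.
have [->|[e eE]] := set_0Vmem E; first exact: indep_set0.
have [u [y [uy euy]]] := edge2 sE eE.
have u1 : 0 < #|nbr E u| by apply/card_gt0P; exists y; rewrite inE -euy.
have cD := card_del u sE; have := E1 u => u1'.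
have [D3|D3] := leqP #|del E u| 3.
  by apply: (cone_reduction (v := u)); [|clia|]; rewrite //; apply: d2 => //; apply: del_sub.
have [|w [wu wuN dis w0]] := @far_vertex _ E u 1 sE E1; first by clia.
have w1 : #|nbr E w| = 1 by have := E1 w; move: w0; rewrite -card_gt0; clia.
have cDw := card_del w (simple_del (v := u) sE).
have wD : nbr (del E u) w = nbr E w by rewrite nbr_del //; apply/setDidPl; rewrite disjoint_sym disjoints1 nbrC.
rewrite wD in cDw.
apply: (@merge_extension _ E u w sE wu wuN dis 2 0); [clia| by [] | clia |] => f fD.
apply: d2 => //; last by have := cardD1_in fD; clia.
by do 2!apply: subset_trans (del_sub _ _); apply: subset_trans (subD1set _ _) _.
Qed.

End SmallDimension.
End Reductions.

(** * The case t = 4 *)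

Section DimensionFour.
Variables (R : realType).

Definition no_biclique (V : finType) (E : {set {set V}}) i j :=
  forall A B : {set V}, #|A| = i -> #|B| = j -> biclique E A B -> False.

Section Covers.
Variable V : finType.
Implicit Types (E H : {set {set V}}) (A B C : {set V}).

Lemma covers_card E C k : simple E -> (forall y, #|nbr E y| <= k) -> covers C E ->
  #|E| <= #|C| * k.
Proof.
move=> sE Ek cC; rewrite leqNgt; apply/negP => big.
by have [f fE] := pick_disjoint_edge sE (fun y _ => Ek y) big; rewrite (negPf (cC f fE)).
Qed.

Lemma card_nbr_sub E H y : H \subset E -> #|nbr H y| <= #|nbr E y|.
Proof. by move=> HE; apply/subset_leq_card/nbr_sub. Qed.

Lemma no_biclique_sub E H i j : H \subset E -> no_biclique E i j -> no_biclique H i j.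
Proof.
by move=> /subsetP HE nK A B Ai Bj AB; apply: (nK A B Ai Bj) => a b aA bB; apply/HE/AB.
Qed.

Lemma indep_dim3_low E : simple E -> #|E| <= 6 -> (forall y, #|nbr E y| <= 2) -> indep R 3 E.
Proof.
move=> sE E6 E2; apply: indep_dim3 => // [y|C cE C2 cC]; first by apply: leq_trans (E2 y) _.
have := covers_card sE E2 cC; rewrite cE; move: C2; clia.
Qed.

(** Far vertices [u] and [w] are merged: degree sum 4 allows a cone and degree sum 3 an extension,
    both leaving six edges of maximum degree 2. Two leaves merge to a vertex of degree 2, and the
    number of non-isolated vertices drops. *)
Lemma indep_dim4_low E : simple E -> #|E| = 10 -> (forall y, #|nbr E y| <= 2) -> indep R 4 E.
Proof.
have [n] := ubnP #|[set y | nbr E y != set0]|; elim: n E => // n IH E ltn sE cE E2.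
have [E0|[e eE]] := set_0Vmem E; first by rewrite E0 cards0 in cE.
have [u [y [uy euy]]] := edge2 sE eE.
have yu : y \in nbr E u by rewrite inE -euy.
have u1 : 0 < #|nbr E u| by apply/card_gt0P; exists y.
have [|w [wu wuN dis w0]] := @far_vertex _ E u 2 sE E2.
  by have := E2 u; rewrite cE; clia.
have cDu := card_del u sE; have cDw := card_del w (simple_del (v := u) sE).
have wD : nbr (del E u) w = nbr E w.
  by rewrite nbr_del //; apply/setDidPl; rewrite disjoint_sym disjoints1 nbrC.
have w1 : 0 < #|nbr E w| by rewrite card_gt0.
rewrite wD in cDw.
have sD : simple (del (del E u) w) by do 2!apply: simple_del.
have DE : del (del E u) w \subset E by apply: subset_trans (del_sub _ _) (del_sub _ _).
have D2 y' : #|nbr (del (del E u) w) y'| <= 2 by apply: leq_trans (card_nbr_sub _ DE) (E2 _).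
have [s4|s3] := leqP 4 (#|nbr E u| + #|nbr E w|).
  have := E2 u; have := E2 w => w2 u2.
  apply: (merge_cone sE wu wuN dis); first by clia.
  by apply: indep_dim3_low => //; clia.
have [s3'|s2] := leqP 3 (#|nbr E u| + #|nbr E w|).
  apply: (@merge_extension _ _ E u w sE wu wuN dis 3 1); [clia|by []|by clia|] => f fD.
  apply: indep_dim3_low; first by apply: simple_sub sD; apply: subD1set.
    by have := cardD1_in fD; clia.
  by move=> z; apply: leq_trans (card_nbr_sub _ (subD1set _ _)) (D2 z).
apply: (indep_merge sE wu wuN dis); apply: IH.
- rewrite -ltnS; apply: leq_trans ltn; rewrite ltnS; apply/proper_card/properP; split.
    apply/subsetP => z; rewrite !inE; have [->|zw] := eqVneq z w; first by [].
    have := card_nbr_merge sE wu zw; rewrite -!card_gt0; clia.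
  exists u; rewrite !inE; first by rewrite -card_gt0.
  by rewrite nbr_merge_self ?eqxx.
- exact: simple_merge.
- by rewrite card_merge.
move=> z; have [->|zw] := eqVneq z w; first by rewrite card_nbr_merged //; clia.
exact: leq_trans (card_nbr_merge sE wu zw) (E2 z).
Qed.

(* After deleting [v] and the edge [ax], two vertices covering the rest would have to
   be [a] and [b], but these miss [f]. *)
Lemma indep_dim4_choice E v a b x f : simple E -> #|E| = 10 ->
  (forall y, #|nbr E y| <= 3) -> #|nbr E v| = 3 -> #|nbr E a| = 3 -> #|nbr E b| = 3 ->
  a != v -> b != v -> a != b -> a \notin nbr E v -> b \notin nbr E v ->
  b \notin nbr E a -> x \in nbr E a -> x \notin nbr E v ->
  f \in del E v -> a \notin f -> b \notin f -> indep R 4 E.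
Proof.
move=> sE cE E3 v3 a3 b3 av bv ab avN bvN baN xa xv fD af bf.
have sD : simple (del E v) := simple_del sE.
have ax : [set a; x] \in del E v.
  have := xa; rewrite !inE => ->; rewrite negb_or eq_sym av /=.
  by apply: contraNneq avN => ->; rewrite nbrC.
have xb : x != b by apply: contraNneq baN => <-.
have na : nbr (del E v) a = nbr E a.
  by rewrite nbr_del //; apply/setDidPl; rewrite disjoint_sym disjoints1 nbrC.
have nb : nbr (del E v) b = nbr E b.
  by rewrite nbr_del //; apply/setDidPl; rewrite disjoint_sym disjoints1 nbrC.
apply: (extension_reduction (v := v) (f := [set a; x])); rewrite ?v3 ?set2_disjoint ?avN ?xv //.
have cD := card_del v sE; have cD1 := cardD1_in ax.
have sH : simple (del E v :\ [set a; x]) by apply: simple_sub sD; apply: subD1set.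
apply: indep_dim3 => //; first by clia.
  move=> y; apply: leq_trans (card_nbr_sub _ (subD1set _ _)) _.
  exact: leq_trans (card_nbr_sub _ (del_sub _ _)) (E3 y).
move=> C _ C2 cC.
have bC : b \in C.
  apply/negPn/negP => /(cover_nbr cC) /subset_leq_card.
  rewrite nbr_remove_notin ?nb ?b3; last by rewrite !inE negb_or eq_sym ab eq_sym xb.
  by move: C2; clia.
have [aC|aC] := boolP (a \in C).
  have CE : C = [set a; b].
    by apply/esym/eqP; rewrite eqEcard subUset !sub1set aC bC cards2 ab.
  have fH : f \in del E v :\ [set a; x].
    by rewrite in_setD1 fD andbT; apply: contraNneq af => ->; rewrite set21.
  have := cC f fH; have [z1 [z2 [z12 fz]]] := edge2 sD fD.
  by rewrite CE disjoint_sym set2_disjoint af bf.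
have := cover_nbr cC aC; rewrite nbr_remove na => sub.
have : b |: (nbr E a :\ x) \subset C by rewrite subUset sub1set bC.
move/subset_leq_card; rewrite cardsU1 !inE (negPf (_ : [set a; b] \notin E)) ?andbF.
  by have := cardD1_in xa; rewrite add1n; clia.
by move: baN; rewrite inE.
Qed.

(** Some [f] avoids the neighbours of [v], and six edges remain. If two vertices [a] and [b] cover
    them, both have kept all their three edges, so they are not adjacent to [v] and avoid [f]. A
    neighbour of [a] or [b] outside [nbr E v] gives a better edge; without one, the three
    neighbourhoods agree and form a $K_{3,3}$. *)
Lemma indep_dim4_deg3 E v : simple E -> #|E| = 10 -> (forall y, #|nbr E y| <= 3) ->
  no_biclique E 3 3 -> #|nbr E v| = 3 -> indep R 4 E.
Proof.
move=> sE cE E3 nK v3; have sD : simple (del E v) := simple_del sE.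
have cD := card_del v sE.
have [|||f fD fN] := @pick_disjoint_edge _ (del E v) (nbr E v) 2.
- exact: simple_del.
- move=> z zN; rewrite nbr_del ?(nbr_neq sE zN) //.
  by have := E3 z; rewrite (cardsD1 v) nbrC zN.
- by rewrite v3; clia.
set H := del E v :\ f; have HD : H \subset del E v by apply: subD1set.
have HE : H \subset E by apply: subset_trans HD (del_sub _ _).
have sH : simple H by apply: simple_sub sE.
have cH : #|H| = 6 by have := cardD1_in fD; rewrite -/H; clia.
have H3 y : #|nbr H y| <= 3 by apply: leq_trans (card_nbr_sub _ HE) (E3 y).
have [[C [C2 cC]]|noC] := pselect (exists C : {set V}, #|C| <= 2 /\ covers C H); last first.
  apply: (extension_reduction (v := v) (f := f)); rewrite ?v3 //.
  apply: indep_dim3 => //; first by rewrite cH.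
  by move=> C _ C2 cC; apply: noC; exists C.
have C2' : #|C| = 2 by have := covers_card sH H3 cC; rewrite cH; clia.
have /cards2P [a [b [ab CE]]] : #|C| == 2 by rewrite C2'.
have := card_del a sH; have := card_del b (simple_del (v := a) sH).
have -> : del (del H a) b = set0.
  apply/setP => e; rewrite !inE; apply/negP => /andP[/andP[eH ae] be].
  have := cC e; rewrite CE disjoint_sym set2_disjoint ae be.
  have eH' : e \in H by rewrite !inE.
  by move=> /(_ eH').
rewrite cards0 addn0 nbr_del 1?eq_sym // cH => -> cH'.
have [a3 b3] : #|nbr H a| = 3 /\ #|nbr H b :\ a| = 3.
  have := H3 a; have := H3 b; have := subset_leq_card (subD1set (nbr H b) a); clia.
have baN : a \notin nbr H b.
  apply/negP => /cardD1_in ab1; have := H3 b; rewrite ab1 b3 //.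
have {}b3 : #|nbr H b| = 3.
  by apply/eqP; rewrite eqn_leq H3 -[X in X <= _]b3 subset_leq_card ?subD1set.
(* Degree 3 is the maximum already in [E], so [y] has lost no edge on the way to [H]. *)
have full y : #|nbr H y| = 3 -> [/\ nbr H y = nbr E y, y != v, y \notin nbr E v & y \notin f].
  move=> y3; have HEy : nbr H y = nbr E y by apply/eqP; rewrite eqEcard nbr_sub // y3 E3.
  have yv : y != v.
    apply/eqP => yv; have := card_nbr_sub y HD; rewrite y3 yv nbr_del_self cards0 //.
  split=> //.
    rewrite nbrC -HEy; apply/negP => /(subsetP (nbr_sub y HD)).
    by rewrite nbr_del // !inE eqxx.
  apply/negP => yf; have [z zy fz] := edge_at sD fD yf.
  have zH : z \in nbr H y by rewrite HEy inE -fz; apply: (subsetP (del_sub E v)).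
  by move: zH; rewrite inE -fz !inE eqxx.
have [na av avN af] := full a a3; have [nb bv bvN bf] := full b b3.
rewrite na in a3; rewrite nb in b3.
have abN : b \notin nbr E a by rewrite nbrC -nb.
have [NaN|] := boolP (nbr E a \subset nbr E v); last first.
  case/subsetPn => x xa xv; exact: (indep_dim4_choice sE cE E3 v3 a3 b3 av bv ab avN bvN abN xa xv fD af bf).
have [NbN|] := boolP (nbr E b \subset nbr E v); last first.
  case/subsetPn => x xb xv; rewrite eq_sym in ab; rewrite nbrC in abN.
  exact: (indep_dim4_choice sE cE E3 v3 b3 a3 bv av ab bvN avN abN xb xv fD bf af).
case: (nK [set v; a; b] (nbr E v)) => //.
  by rewrite -setUA cardsU1 cards2 ab !inE negb_or eq_sym av eq_sym bv.
have Na : nbr E a = nbr E v by apply/eqP; rewrite eqEcard NaN a3 v3.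
have Nb : nbr E b = nbr E v by apply/eqP; rewrite eqEcard NbN b3 v3.
move=> y z; rewrite !inE -orbA => /or3P[]/eqP -> zN.
- by [].
- by move/setP/(_ z): Na; rewrite !inE => ->.
by move/setP/(_ z): Nb; rewrite !inE => ->.
Qed.

End Covers.

Lemma indep_dim4_deg_le3 (V : finType) (E : {set {set V}}) : simple E -> #|E| <= 10 ->
  (forall y, #|nbr E y| <= 3) -> no_biclique E 3 3 -> indep R 4 E.
Proof.
move=> sE cE E3 nK; pose Q (V : finType) (E : {set {set V}}) :=
  [/\ simple E, forall y, #|nbr E y| <= 3 & no_biclique E 3 3].
apply: (@pad_induction R Q 4 10) cE; rewrite // {V E sE E3 nK}.
- by move=> V E [].
- move=> V E [sE E3 nK] _; split; [exact: simple_pad|exact: card_nbr_pad|] => A B A3 B3 AB.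
  have [||A' [B' [A'3 B'3]]] := biclique_pad _ _ AB; rewrite ?A3 ?B3 //.
  by apply: nK; rewrite ?A'3 ?B'3.
move=> V E [sE E3 nK] cE; have [[v v3]|no3] := pselect (exists v, #|nbr E v| = 3).
  exact: indep_dim4_deg3 v3.
apply: indep_dim4_low => // y; have := E3 y; rewrite leq_eqVlt => /orP[/eqP y3|//].
by case: no3; exists y.
Qed.

(** After coning at a vertex [v] of degree 4 the pair bound leaves degrees at most $7-4$, and a
    cover of the rest by two vertices extends by [v] to a cover by three. *)
Lemma indep_dim4 (V : finType) (E : {set {set V}}) : simple E -> #|E| <= 10 ->
  (forall y, #|nbr E y| <= 4) ->
  (forall a b, a != b -> #|nbr E a| + #|nbr (del E a) b| <= 7) ->
  (forall C : {set V}, #|E| = 10 -> #|C| <= 3 -> covers C E -> False) ->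
  no_biclique E 3 3 -> indep R 4 E.
Proof.
move=> sE cE E4 pair nC nK.
have [[v v4]|no4] := pselect (exists v, #|nbr E v| = 4); last first.
  apply: indep_dim4_deg_le3 => // y; have := E4 y; rewrite leq_eqVlt => /orP[/eqP y4|//].
  by case: no4; exists y.
have cD := card_del v sE; apply: (cone_reduction (v := v)) => //.
apply: indep_dim3; [exact: simple_del|clia| |].
  move=> y; have [->|yv] := eqVneq y v; first by rewrite nbr_del_self cards0.
  by have := pair v y; rewrite eq_sym yv v4 => /(_ isT); clia.
move=> C c6 C2 cC; apply: (nC (v |: C)); [clia| |exact: covers_del].
by apply: leq_trans (leq_card_setU _ _) _; rewrite cards1; clia.
Qed.

End DimensionFour.

(** * The case t = 5 with a vertex of degree 4 *)

(* Degrees [D] and adjacencies [B] of a quadruple covering all edges but one. *)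
Definition quad_type (D : nat -> nat) (B : nat -> nat -> bool) (i j k l : nat) :=
  let apart := [&& ~~ B i k, ~~ B i l, ~~ B j k & ~~ B j l] in
  apart &&
  [|| [&& D i == 4, D j == 4, D k == 4, D l == 4, B i j & B k l],
      [&& D i == 4, D j == 4, D k == 4, D l == 3, B i j & ~~ B k l] |
      [&& D i == 4, D j == 4, D k == 3, D l == 3, ~~ B i j & ~~ B k l]].

Definition quad_table (b01 b02 b03 b12 b13 b23 : bool) i j :=
  nth false (nth [::] [:: [:: false; b01; b02; b03]; [:: b01; false; b12; b13];
                          [:: b02; b12; false; b23]; [:: b03; b13; b23; false]] i) j.

Definition quad_triple (D : nat -> nat) (B : nat -> nat -> bool) i j k :=
  [&& D i == 4, D j == 4, D k == 4, ~~ B i j, ~~ B i k & ~~ B j k].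

(** The 14 covered edges meet the quadruple, those inside it twice, so its degrees sum to 14 plus
    the number of inner edges. Two inner edges force all degrees to be 4, and they form a matching,
    since a path would leave an independent triple; one inner edge gives degrees 4, 4, 4, 3 with the
    edge between two of the 4s; no inner edge gives 4, 4, 3, 3. *)
Definition quad_claim d0 d1 d2 d3 b01 b02 b03 b12 b13 b23 :=
  let D := nth 0 [:: d0; d1; d2; d3] in
  let B := quad_table b01 b02 b03 b12 b13 b23 in
  if [&& 14 + (b01 + b02 + b03 + b12 + b13 + b23) == d0 + d1 + d2 + d3,
      ~~ quad_triple D B 0 1 2, ~~ quad_triple D B 0 1 3,
      ~~ quad_triple D B 0 2 3 & ~~ quad_triple D B 1 2 3]
  then has (fun s => if s is [:: i; j; k; l] then quad_type D B i j k l else false)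
         (permutations (iota 0 4))
  else true.

Lemma quad_claim_true d0 d1 d2 d3 b01 b02 b03 b12 b13 b23 :
  d0 <= 4 -> d1 <= 4 -> d2 <= 4 -> d3 <= 4 -> quad_claim d0 d1 d2 d3 b01 b02 b03 b12 b13 b23.
Proof.
pose r := iota 0 5; pose bb := [:: true; false].
(* All $5^4\cdot 2^6$ combinations of degrees and adjacencies are checked by computation. *)
have all_true : all (fun d0 => all (fun d1 => all (fun d2 => all (fun d3 =>
    all (fun b01 => all (fun b02 => all (fun b03 => all (fun b12 => all (fun b13 =>
    all (fun b23 => quad_claim d0 d1 d2 d3 b01 b02 b03 b12 b13 b23)
    bb) bb) bb) bb) bb) bb) r) r) r) r by vm_compute.
have inb b : b \in bb by case: b.
move=> h0 h1 h2 h3; have inr d : d <= 4 -> d \in r by rewrite mem_iota add0n ltnS.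
move: all_true => /allP/(_ _ (inr _ h0)) /allP/(_ _ (inr _ h1)) /allP/(_ _ (inr _ h2)).
move=> /allP/(_ _ (inr _ h3)) /allP/(_ _ (inb b01)) /allP/(_ _ (inb b02)) /allP/(_ _ (inb b03)).
by move=> /allP/(_ _ (inb b12)) /allP/(_ _ (inb b13)) /allP/(_ _ (inb b23)).
Qed.

Section DimensionFive.
Variables (R : realType) (V : finType).
Implicit Types (E H : {set {set V}}) (A B C S : {set V}).

Lemma biclique_disjoint E A B : simple E -> biclique E A B -> [disjoint A & B].
Proof.
move=> sE AB; apply/pred0P => x /=; apply/negbTE/negP => /andP[xA xB].
by have := sE _ (AB x x xA xB); rewrite setUid cards1.
Qed.

Lemma bicliqueC E A B : biclique E A B -> biclique E B A.
Proof. by move=> AB b a bB aA; rewrite setUC; apply: AB. Qed.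

Lemma biclique_cross E A B : simple E -> biclique E A B ->
  #|A| * #|B| <= #|cross E A B|.
Proof.
move=> sE AB; have dAB := biclique_disjoint sE AB; rewrite -cardsX.
have inj : {in setX A B &, injective (fun p : V * V => [set p.1; p.2])}.
  move=> [a b] [a' b'] /setXP[/= aA bB] /setXP[/= a'A b'B] /set2_eq[[-> ->] //|[ab _]].
  by move: aA; rewrite ab (disjointFl dAB).
rewrite -(card_in_imset inj); apply/subset_leq_card/subsetP => e /imsetP[[a b]].
move=> /setXP[/= aA bB] ->; rewrite !inE AB //= !set2_disjoint !negb_and !negbK.
by rewrite aA bB !orbT.
Qed.

Lemma noncross_le1 H A B : simple H -> #|H| <= 10 -> #|A| = 3 -> #|B| = 3 ->
  biclique H A B -> #|H :\: cross H A B| <= 1.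
Proof.
move=> sH cH A3 B3 AB; have := biclique_cross sH AB; rewrite A3 B3 => ge9.
have -> : H :\: cross H A B = H :\: (H :&: cross H A B) by rewrite setDIr setDv set0U.
rewrite cardsD setIA setIid (setIidPr _); first by clia.
by apply/subsetP => e; rewrite !inE => /andP[/andP[]].
Qed.

Lemma noncross2 H A B e1 e2 : simple H -> #|H| <= 10 -> #|A| = 3 -> #|B| = 3 ->
  biclique H A B -> e1 \in H -> e2 \in H -> e1 != e2 ->
  [disjoint e1 & A] || [disjoint e1 & B] -> [disjoint e2 & A] || [disjoint e2 & B] -> False.
Proof.
move=> sH cH A3 B3 AB e1H e2H e12 d1 d2.
have := noncross_le1 sH cH A3 B3 AB; rewrite leqNgt => /negP; apply.
apply: (@leq_trans #|[set e1; e2]|); first by rewrite cards2 e12.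
by apply/subset_leq_card; rewrite subUset !sub1set !inE e1H e2H /= !andbT !negb_and !negbK d1 d2.
Qed.

(* Nine of the at most ten edges of [H] lie in the biclique. *)
Lemma biclique_contains H A B y : simple H -> #|H| <= 10 -> #|A| = 3 -> #|B| = 3 ->
  biclique H A B -> 1 < #|nbr H y| -> (y \in A) || (y \in B).
Proof.
move=> sH cH A3 B3 AB y2; apply/negPn/negP; rewrite negb_or => /andP[yA yB].
have dAB := biclique_disjoint sH AB.
have [z1 [z2 [z1y z2y z12]]] : exists z1 z2, [/\ z1 \in nbr H y, z2 \in nbr H y & z1 != z2].
  by have /card_gt1P [z1 [z2 [? ? ?]]] := y2; exists z1, z2.
have dz z : [disjoint [set y; z] & A] || [disjoint [set y; z] & B].
  rewrite !set2_disjoint yA yB /=; case: (boolP (z \in A)) => // zA.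
  by rewrite (disjointFr dAB zA).
apply: (noncross2 (e1 := [set y; z1]) (e2 := [set y; z2]) sH cH A3 B3 AB);
  rewrite ?dz //; try by move: z1y z2y; rewrite !inE.
by apply: contra_neq z12 => /set2_inj.
Qed.

Lemma biclique_side H A B p q : simple H -> biclique H A B -> q \notin nbr H p ->
  (p \in A) || (p \in B) -> (q \in A) || (q \in B) ->
  (p \in A) && (q \in A) || (p \in B) && (q \in B).
Proof.
move=> sH AB qp /orP[pA|pB] /orP[qA|qB]; rewrite ?pA ?pB ?qA ?qB ?orbT //.
  by case/negP: qp; rewrite inE AB.
by case/negP: qp; rewrite inE setUC AB.
Qed.

(** The three stars account for nine of the ten edges, and [f] is the tenth. A cover by three
    vertices that omits one centre equals its neighbourhood, hence omits the other centres and
    equals theirs; the cover by all three centres misses [f]. A $K_{3,3}$ contains the centres, on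
    one side as they are not adjacent, and its other side is their common neighbourhood. *)
Lemma three_stars_good H p q r f : simple H -> #|H| = 10 ->
  p != q -> p != r -> q != r ->
  #|nbr H p| = 3 -> #|nbr H q| = 3 -> #|nbr H r| = 3 ->
  q \notin nbr H p -> r \notin nbr H p -> r \notin nbr H q ->
  f \in H -> p \notin f -> q \notin f -> r \notin f ->
  ~ (nbr H q = nbr H p /\ nbr H r = nbr H p) ->
  (forall C, #|C| <= 3 -> covers C H -> False) /\ no_biclique H 3 3.
Proof.
move=> sH cH pq pr qr p3 q3 r3 qp rp rq fH pf qf rf neq; split.
  move=> C C3 cC; have eqN y : #|nbr H y| = 3 -> y \notin C -> nbr H y = C.
    by move=> y3 yC; apply: sub_cards_eq (cover_nbr cC yC) y3 C3.
  have [pC|pC] := boolP (p \in C); last first.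
    have pE := eqN p p3 pC; apply: neq.
    by split; rewrite pE; apply: eqN; rewrite // -pE.
  have [qC|qC] := boolP (q \in C); last first.
    by have qE := eqN q q3 qC; move: qp; rewrite nbrC qE pC.
  have [rC|rC] := boolP (r \in C); last first.
    by have rE := eqN r r3 rC; move: rp; rewrite nbrC rE pC.
  have CE := cards3_eq C3 pC qC rC pq pr qr.
  have := cC f fH; have [x [y [_ fxy]]] := edge2 sH fH.
  rewrite disjoint_sym CE => /pred0Pn [z /= /andP[]].
  rewrite !inE -orbA => /or3P[]/eqP ->; by apply/negP.
suff side A B : #|A| = 3 -> #|B| = 3 -> biclique H A B -> p \in A -> False.
  move=> A B A3 B3 AB; have : (p \in A) || (p \in B).
    by apply: (biclique_contains sH _ A3 B3 AB); rewrite ?cH ?p3.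
  by case/orP => [|pB]; [apply: side AB | apply: (side B A) => //; apply: bicliqueC].
move=> A3 B3 AB pA.
have cont y : #|nbr H y| = 3 -> (y \in A) || (y \in B).
  by move=> y3; apply: (biclique_contains sH _ A3 B3 AB); rewrite ?cH ?y3.
have inA y : #|nbr H y| = 3 -> y \notin nbr H p -> y \in A.
  move=> y3 yp; case/orP: (cont y y3) => // yB.
  by case/negP: yp; rewrite inE AB.
have NE y : y \in A -> #|nbr H y| = 3 -> B = nbr H y.
  move=> yA y3; apply: (sub_cards_eq (k := 3)); rewrite ?y3 //.
  by apply/subsetP => b bB; rewrite inE AB.
have pB := NE p pA p3.
by apply: neq; split; rewrite -pB; apply/esym/NE => //; apply: inA.
Qed.

(** The edge [zb] lies inside the side [A'], and an edge between what is left of [A] and of [B] lies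
    inside [B']; ten edges leave room for only one edge outside a $K_{3,3}$. *)
Lemma near_biclique_aux H A B a b A' B' z : simple H -> #|H| <= 10 ->
  #|A| = 3 -> #|B| = 3 -> [disjoint A & B] -> a \in A -> b \in B ->
  (forall x y, x \in A -> y \in B -> (x != a) || (y != b) -> [set x; y] \in H) ->
  #|A'| = 3 -> #|B'| = 3 -> biclique H A' B' -> A :|: B \subset A' :|: B' ->
  a \in A' -> b \in A' -> z \in A' -> z \in A -> z != a -> False.
Proof.
move=> sH cH A3 B3 dAB aA bB HAB A'3 B'3 AB' sub aA' bA' zA' zA za.
have dAB' := biclique_disjoint sH AB'.
have ab : a != b by apply: contraTneq aA => ->; rewrite (disjointFl dAB).
have zb : z != b by apply: contraTneq zA => ->; rewrite (disjointFl dAB).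
have A'E : A' = [set a; b; z] by apply: cards3_eq; rewrite ?A'3 // eq_sym.
have inB' x : x \in A :|: B -> x != a -> x != b -> x != z -> x \in B'.
  move=> /(subsetP sub); rewrite inE A'E !inE -!orbA.
  by case/or4P => [/eqP ->|/eqP ->|/eqP ->|//]; rewrite ?eqxx.
have [a2] : exists a2, a2 \in A :\ a :\ z.
  apply/card_gt0P; have zAa : z \in A :\ a by rewrite !inE za.
  by have := cardD1_in aA; have := cardD1_in zAa; clia.
rewrite !inE => /and3P[a2z a2a a2A].
have [b1] : exists b1, b1 \in B :\ b.
  by apply/card_gt0P; have := cardD1_in bB; clia.
rewrite !inE => /andP[b1b b1B].
have a2B' : a2 \in B'.
  apply: inB'; rewrite ?inE ?a2A //.
  by apply: contraTneq a2A => ->; rewrite (disjointFl dAB).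
have b1B' : b1 \in B'.
  apply: inB'; rewrite ?inE ?b1B ?orbT //.
    by apply: contraTneq b1B => ->; rewrite (disjointFr dAB).
  by apply: contraTneq b1B => ->; rewrite (disjointFr dAB).
apply: (noncross2 (e1 := [set z; b]) (e2 := [set a2; b1]) sH cH A'3 B'3 AB').
- by apply: HAB; rewrite ?za.
- by apply: HAB; rewrite ?a2a.
- apply/eqP => /set2_eq [[zE _]|[zE _]]; first by rewrite zE eqxx in a2z.
  by move: zA; rewrite zE (disjointFl dAB).
- by rewrite [X in _ || X]set2_disjoint (disjointFr dAB' zA') (disjointFr dAB' bA') orbT.
by rewrite set2_disjoint (disjointFl dAB' a2B') (disjointFl dAB' b1B').
Qed.

(** A $K_{3,3}$ must contain all six vertices, as they have degree at least 2. The missing edge puts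
    [a] and [b] on one side, whose third vertex lies in [A] or, symmetrically, in [B]. *)
Lemma near_biclique_no_biclique H A B a b : simple H -> #|H| <= 10 ->
  #|A| = 3 -> #|B| = 3 -> [disjoint A & B] -> a \in A -> b \in B ->
  (forall x y, x \in A -> y \in B -> (x != a) || (y != b) -> [set x; y] \in H) ->
  [set a; b] \notin H -> (forall x, x \in A :|: B -> 1 < #|nbr H x|) ->
  no_biclique H 3 3.
Proof.
move=> sH cH A3 B3 dAB aA bB HAB abH deg2.
suff side A' B' : #|A'| = 3 -> #|B'| = 3 -> biclique H A' B' -> A :|: B \subset A' :|: B' ->
    a \in A' -> b \in A' -> False.
  move=> A' B' A'3 B'3 AB'.
  have cont x : x \in A :|: B -> (x \in A') || (x \in B').
    by move=> /deg2; apply: (biclique_contains sH cH A'3 B'3 AB').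
  have sub : A :|: B \subset A' :|: B' by apply/subsetP => x /cont; rewrite inE.
  have abN : b \notin nbr H a by rewrite inE.
  have aAB : a \in A :|: B by rewrite inE aA.
  have bAB : b \in A :|: B by rewrite inE bB orbT.
  case/orP: (biclique_side sH AB' abN (cont a aAB) (cont b bAB)) => /andP[].
    by move=> aA' bA'; apply: (side A' B').
  move=> aB' bB'; apply: (side B' A') => //; first exact: bicliqueC.
  by rewrite [B' :|: A']setUC.
move=> A'3 B'3 AB' sub aA' bA'.
have dAB' := biclique_disjoint sH AB'.
have ab : b != a by apply: contraTneq aA => <-; rewrite (disjointFl dAB).
have subE : A :|: B = A' :|: B'.
  apply: (sub_cards_eq (k := 6) sub).
    by rewrite cardsU (disjoint_setI0 dAB) cards0 A3 B3.
  by rewrite cardsU (disjoint_setI0 dAB') cards0 A'3 B'3.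
have [z] : exists z, z \in A' :\ a :\ b.
  apply/card_gt0P; have bAa : b \in A' :\ a by rewrite !inE ab.
  by have := cardD1_in aA'; have := cardD1_in bAa; clia.
rewrite !inE => /and3P[zb za zA'].
have : z \in A :|: B by rewrite subE inE zA'.
rewrite inE => /orP[zA|zB].
  exact: (near_biclique_aux sH cH A3 B3 dAB aA bB HAB A'3 B'3 AB' sub aA' bA' zA' zA za).
apply: (near_biclique_aux (A := B) (B := A) (a := b) (b := a) (z := z) sH cH B3 A3 _ bB aA _ A'3 B'3 AB') => //.
- by rewrite disjoint_sym.
- by move=> x y xB yA; rewrite orbC setUC; apply: HAB.
by rewrite setUC.
Qed.

Section ExactlyFifteen.
Variable E : {set {set V}}.
Hypotheses (sE : simple E) (cE : #|E| = 15) (E4 : forall y, #|nbr E y| <= 4).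
Hypothesis no_cover4 : forall C, #|C| <= 4 -> covers C E -> False.
Hypothesis noK34 : no_biclique E 3 4.

Lemma card_del_remove v f : #|nbr E v| = 4 -> f \in del E v -> #|del E v :\ f| = 10.
Proof. by move=> v4 fD; have := card_del v sE; have := cardD1_in fD; clia. Qed.

Lemma simple_del_remove v f : simple (del E v :\ f).
Proof. by apply: simple_sub (simple_del (v := v) sE); apply: subD1set. Qed.

Lemma del_remove_le4 v f y : #|nbr (del E v :\ f) y| <= 4.
Proof.
apply: leq_trans (card_nbr_sub _ (subD1set _ _)) _.
exact: leq_trans (card_nbr_sub _ (del_sub _ _)) (E4 y).
Qed.

(** What [indep_dim4] asks of the graph left by an extension, beyond its size and maximum degree. *)
Definition good_pair v f :=
  [/\ forall a b, a != b ->
        #|nbr (del E v :\ f) a| + #|nbr (del (del E v :\ f) a) b| <= 7,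
      forall C, #|C| <= 3 -> covers C (del E v :\ f) -> False &
      no_biclique (del E v :\ f) 3 3].

Lemma good_pair_indep v f : #|nbr E v| = 4 -> f \in del E v -> [disjoint f & nbr E v] ->
  good_pair v f -> indep R 5 E.
Proof.
move=> v4 fD fN [pair cov nK]; apply: (extension_reduction (v := v) (f := f)) => //.
apply: indep_dim4; rewrite ?card_del_remove //; first exact: simple_del_remove.
- exact: del_remove_le4.
- by move=> C _; apply: cov.
Qed.

Definition independent_triple v a b :=
  [/\ [/\ #|nbr E v| = 4, #|nbr E a| = 4 & #|nbr E b| = 4],
      [/\ a != v, b != v & a != b] &
      [/\ a \notin nbr E v, b \notin nbr E v & b \notin nbr E a]].

Lemma bad_pair_degrees v f a b : a != b ->
  7 < #|nbr (del E v :\ f) a| + #|nbr (del (del E v :\ f) a) b| ->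
  #|nbr (del E v :\ f) a| = 4 /\ #|nbr (del E v :\ f) b| = 4.
Proof.
move=> ab; have := del_remove_le4 v f a; have := del_remove_le4 v f b.
have := card_nbr_sub b (del_sub (del E v :\ f) a); clia.
Qed.

(** Two vertices meeting eight of the remaining edges have lost none of their four, so they are
    adjacent neither to [v] nor to each other. Without such triples the degree clause of [good_pair]
    is automatic. *)
Lemma bad_pair_triple v f a b : #|nbr E v| = 4 -> f \in del E v -> a != b ->
  7 < #|nbr (del E v :\ f) a| + #|nbr (del (del E v :\ f) a) b| ->
  independent_triple v a b.
Proof.
move=> v4 fD ab bad; have [a4 b4] := bad_pair_degrees ab bad.
have HD : del E v :\ f \subset del E v by apply: subD1set.
have full y : #|nbr (del E v :\ f) y| = 4 ->
    [/\ nbr (del E v :\ f) y = nbr E y, y != v & y \notin nbr E v].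
  move=> y4; have HEy : nbr (del E v :\ f) y = nbr E y.
    by apply: (sub_cards_eq (k := 4)) => //; apply/nbr_sub/(subset_trans HD)/del_sub.
  have yv : y != v.
    apply/eqP => yv; have := card_nbr_sub y HD; rewrite y4 yv nbr_del_self cards0 //.
  split=> //; rewrite nbrC -HEy; apply/negP => /(subsetP (nbr_sub y HD)).
  by rewrite nbr_del // !inE eqxx.
have [na av avN] := full a a4; have [nb bv bvN] := full b b4.
split; split; rewrite // -?na -?nb ?a4 ?b4 //.
apply/negP; rewrite nbrC => /cardD1_in; move: bad; rewrite nbr_del 1?eq_sym // a4 b4.
by move=> bad b3; move: bad; rewrite b3 in b4 *; clia.
Qed.

(** * Three pairwise nonadjacent vertices of degree 4 *)

Section Triple.
Variables v a b x : V.
Hypotheses (trip : independent_triple v a b) (xa : x \in nbr E a) (xv : x \notin nbr E v).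

Let v4 : #|nbr E v| = 4. Proof. by case: trip => -[]. Qed.
Let a4 : #|nbr E a| = 4. Proof. by case: trip => -[]. Qed.
Let b4 : #|nbr E b| = 4. Proof. by case: trip => -[]. Qed.
Let av : a != v. Proof. by case: trip => _ []. Qed.
Let bv : b != v. Proof. by case: trip => _ []. Qed.
Let ab : a != b. Proof. by case: trip => _ []. Qed.
Let avN : a \notin nbr E v. Proof. by case: trip => _ _ []. Qed.
Let bvN : b \notin nbr E v. Proof. by case: trip => _ _ []. Qed.
Let baN : b \notin nbr E a. Proof. by case: trip => _ _ []. Qed.
Let rest := del (del (del E v) a) b.
Let H := del E v :\ [set a; x].

Lemma triple_card_rest : #|rest| = 3.
Proof.
have := card_del v sE; have := card_del a (simple_del (v := v) sE).
have := card_del b (simple_del (v := a) (simple_del (v := v) sE)).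
have na : nbr (del E v) a = nbr E a by rewrite nbr_del // setD1_notin // nbrC.
have nb : nbr (del (del E v) a) b = nbr E b.
  by rewrite nbr_del 1?eq_sym // nbr_del // !setD1_notin // nbrC.
by rewrite -/rest na nb; clia.
Qed.

(** Otherwise [c] together with [v], [a] and [b] would cover all edges. *)
Lemma triple_no_common c : exists2 e, e \in rest & c \notin e.
Proof.
apply: contrapT => no; apply: (no_cover4 (C := v |: (a |: (b |: [set c])))).
  apply: leq_trans (leq_card_setU _ _) _; rewrite cards1 add1n ltnS.
  apply: leq_trans (leq_card_setU _ _) _; rewrite cards1 add1n ltnS.
  by apply: leq_trans (leq_card_setU _ _) _; rewrite !cards1.
do 3!apply: covers_del; move=> e er; rewrite disjoint_sym disjoints1 negbK.
by apply/negPn/negP => ce; apply: no; exists e.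
Qed.

Let ax : [set a; x] \in del E v.
Proof.
rewrite inE; have := xa; rewrite inE => -> /=.
by rewrite !inE negb_or eq_sym av /=; apply: contraNneq avN => ->; rewrite nbrC.
Qed.

Let axN : [disjoint [set a; x] & nbr E v].
Proof. by rewrite set2_disjoint avN xv. Qed.

Let sH : simple H. Proof. exact: simple_del_remove. Qed.
Let cH : #|H| = 10. Proof. exact: card_del_remove. Qed.

Let nDa : nbr (del E v) a = nbr E a.
Proof. by rewrite nbr_del // setD1_notin // nbrC. Qed.

Let nHa : nbr H a = nbr E a :\ x.
Proof. by rewrite nbr_remove nDa. Qed.

Let nHa3 : #|nbr H a| = 3.
Proof. by rewrite nHa; have := cardD1_in xa; clia. Qed.

Let bx : b != x.
Proof. by apply: contraNneq baN => ->. Qed.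

Let nHb : nbr H b = nbr E b.
Proof.
rewrite nbr_remove_notin; first by rewrite nbr_del // setD1_notin // nbrC.
by rewrite !inE negb_or eq_sym ab bx.
Qed.

Let restP e : e \in rest -> [/\ e \in H, a \notin e & b \notin e].
Proof.
rewrite !inE -!andbA => /and4P[eE ve ae be]; split=> //.
by rewrite eE ve !andbT; apply: contraNneq ae => ->; rewrite set21.
Qed.

(** The vertex [b] of degree 4 must be in the cover; if [a] were not, [b] and the three neighbours
    left to [a] would be too many. The one remaining place would need a vertex common to all edges
    of [rest]. *)
Lemma triple_no_cover C : #|C| <= 3 -> covers C H -> False.
Proof.
move=> C3 cC; have bC : b \in C.
  apply/negPn/negP => /(cover_nbr cC) /subset_leq_card; rewrite nHb b4.
  by move: C3; clia.
have aC : a \in C.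
  apply/negPn/negP => /(cover_nbr cC) sub.
  apply: (setU1_cards (x := b) _ bC sub nHa3 C3).
  by rewrite nHa !inE negb_and; move: baN; rewrite inE => ->; rewrite orbT.
have C1 : #|C :\ a :\ b| <= 1.
  have bCa : b \in C :\ a by rewrite !inE eq_sym ab.
  by have := cardD1_in aC; have := cardD1_in bCa; clia.
have [c cP] : exists c, C :\ a :\ b \subset [set c].
  have [C0|[c cC']] := set_0Vmem (C :\ a :\ b); first by exists a; rewrite C0 sub0set.
  exists c; rewrite (sub_cards_eq (k := 1) (A := [set c]) (B := C :\ a :\ b)) ?cards1 //.
  by rewrite sub1set.
have [e er ce] := triple_no_common c; have [eH ae be] := restP er.
have /pred0Pn [z /= /andP[ze zC]] := cC e eH.
have : z \in [set c].
  apply: (subsetP cP); rewrite !inE zC andbT; apply/andP; split.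
    by apply: contraNneq be => <-.
  by apply: contraNneq ae => <-.
by rewrite inE => /eqP zc; rewrite -zc ze in ce.
Qed.

Let abH : b \notin nbr H a.
Proof. by rewrite nHa !inE negb_and; move: baN; rewrite inE => ->; rewrite orbT. Qed.

(** Being nonadjacent, [a] and [b] share a side. The three edges at its third vertex avoid [v], [a]
    and [b], so they are all of [rest], against [triple_no_common]. *)
Lemma triple_no_biclique : no_biclique H 3 3.
Proof.
suff side A B : #|A| = 3 -> #|B| = 3 -> biclique H A B -> a \in A -> b \in A -> False.
  move=> A B A3 B3 AB; have cH10 : #|H| <= 10 by rewrite cH.
  have aAB := biclique_contains (y := a) sH cH10 A3 B3 AB.
  have bAB := biclique_contains (y := b) sH cH10 A3 B3 AB.
  rewrite nHa3 in aAB; rewrite nHb b4 in bAB.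
  case/orP: (biclique_side sH AB abH (aAB isT) (bAB isT)) => /andP[aS bS].
    exact: (side A B).
  by apply: (side B A) => //; apply: bicliqueC.
move=> A3 B3 AB aA bA.
have bAa : b \in A :\ a by rewrite !inE eq_sym ab.
have A1 : #|A :\ a :\ b| = 1 by have := cardD1_in aA; have := cardD1_in bAa; clia.
have /cards1P [c cP] : #|A :\ a :\ b| == 1 by rewrite A1.
have : c \in A :\ a :\ b by rewrite cP inE.
rewrite !inE => /and3P[cb ca cA].
have dAB := biclique_disjoint sH AB.
have restE : (fun y => [set c; y]) @: B = rest.
  apply: (sub_cards_eq (k := 3)); rewrite ?triple_card_rest //; last first.
    by rewrite card_imset //; apply: set2_inj.
  apply/subsetP => _ /imsetP[y yB ->]; have cyH := AB c y cA yB.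
  have ya : a != y by apply: contraTneq aA => ->; rewrite (disjointFl dAB).
  have yb : b != y by apply: contraTneq bA => ->; rewrite (disjointFl dAB).
  rewrite !inE !negb_or [a == c]eq_sym ca ya [b == c]eq_sym cb yb !andbT.
  by move: cyH; rewrite !inE negb_or => /andP[_ ->].
have [e + ce] := triple_no_common c; rewrite -restE => /imsetP[y _ ey].
by rewrite ey set21 in ce.
Qed.

(** At least two edges at [a] avoid [b] and [q], and so does some edge of [rest]. *)
Lemma triple_uncovered_b q : q != a -> q != b -> #|del (del H b) q| <= 2 -> False.
Proof.
move=> qa qb; set U := del _ _ => U2.
have sU : simple U by do 2!apply: simple_del.
have nUa : nbr U a = nbr H a :\ q.
  by rewrite !nbr_del // 1?eq_sym // (setD1_notin abH).
have [e er qe] := triple_no_common q; have [eH ae be] := restP er.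
have eU : e \in del U a by rewrite inE ae andbT inE qe andbT inE be andbT.
have := card_del a sU; have := card_D1_ge (nbr H a) q; rewrite -nUa nHa3.
have := cardD1_in eU; clia.
Qed.

(** If [b] is neither [p] nor [q], at least two edges at [b] and one at [a] stay uncovered. The
    vertex [a] is excluded because it keeps only three edges and so belongs to no bad pair. *)
Lemma triple_uncovered p q : p != q -> p != a -> q != a -> #|del (del H p) q| <= 2 -> False.
Proof.
move=> pq pa qa; set U := del _ _ => U2.
have [pb|pb] := eqVneq p b.
  by apply: (triple_uncovered_b qa); rewrite -pb // eq_sym.
have [qb|qb] := eqVneq q b.
  apply: (triple_uncovered_b pa pb); rewrite -qb.
  suff -> : del (del H q) p = U by [].
  by apply/setP => e; rewrite !inE andbAC.
have sU : simple U by do 2!apply: simple_del.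
have nUa : nbr U a = nbr H a :\ p :\ q by rewrite !nbr_del // eq_sym.
have nUb : nbr U b = nbr E b :\ p :\ q by rewrite !nbr_del // 1?eq_sym // nHb.
have nDUa : nbr (del U b) a = nbr U a.
  by rewrite nbr_del // setD1_notin // nUa !in_setD1 !negb_and abH !orbT.
have := card_del b sU; have := card_del a (simple_del (v := b) sU); rewrite nDUa nUa nUb.
have := card_D1_ge (nbr E b) p; have := card_D1_ge (nbr E b :\ p) q; rewrite b4.
have := card_D1_ge (nbr H a) p; have := card_D1_ge (nbr H a :\ p) q; rewrite nHa3.
clia.
Qed.

Lemma indep_triple : indep R 5 E.
Proof.
apply: (good_pair_indep v4 ax axN); split; last exact: triple_no_biclique; last first.
  exact: triple_no_cover.
move=> p q pq; rewrite leqNgt; apply/negP => bad.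
have [p4 q4] := bad_pair_degrees pq bad.
apply: (@triple_uncovered p q) => //.
- by apply: contra_eq_neq p4 => ->; rewrite nHa3.
- by apply: contra_eq_neq q4 => ->; rewrite nHa3.
have := card_del p sH; have := card_del q (simple_del (v := p) sH); rewrite cH.
by move: bad; rewrite -/H; clia.
Qed.

End Triple.

(* If the three neighbourhoods coincide they form a $K_{3,4}$. *)
Lemma indep_triple_exists v a b : independent_triple v a b -> indep R 5 E.
Proof.
move=> trip; have [[v4 a4 b4] [av bv ab] [avN bvN baN]] := trip.
have [NaN|] := boolP (nbr E a \subset nbr E v); last first.
  by case/subsetPn => x xa xv; apply: (indep_triple trip xa xv).
have [NbN|] := boolP (nbr E b \subset nbr E v); last first.
  case/subsetPn => x xb xv; apply: (indep_triple (v := v) (a := b) (b := a) _ xb xv).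
  by split; split; rewrite // 1?eq_sym // nbrC.
have Na : nbr E a = nbr E v by apply: (sub_cards_eq NaN a4); rewrite v4.
have Nb : nbr E b = nbr E v by apply: (sub_cards_eq NbN b4); rewrite v4.
case: (noK34 (A := [set v; a; b]) (B := nbr E v)) => //.
  by rewrite -setUA cardsU1 cards2 ab !inE negb_or eq_sym av eq_sym bv.
move=> y z; rewrite !inE -orbA => /or3P[]/eqP -> zN.
- by [].
- by move/setP/(_ z): Na; rewrite !inE => ->.
by move/setP/(_ z): Nb; rewrite !inE => ->.
Qed.

(** * No three pairwise nonadjacent vertices of degree 4 *)

Section NoTriple.
Hypothesis no_triple : forall v a b, ~ independent_triple v a b.

Lemma no_triple_indep v f : #|nbr E v| = 4 -> f \in del E v -> [disjoint f & nbr E v] ->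
  (forall C, #|C| <= 3 -> covers C (del E v :\ f) -> False) ->
  no_biclique (del E v :\ f) 3 3 -> indep R 5 E.
Proof.
move=> v4 fD fN nC nK; apply: (good_pair_indep v4 fD fN); split=> // a b ab.
rewrite leqNgt; apply/negP => bad.
exact: no_triple (bad_pair_triple v4 fD ab bad).
Qed.

Section Biclique.
Variables (v : V) (A B : {set V}).
Hypotheses (v4 : #|nbr E v| = 4) (A3 : #|A| = 3) (B3 : #|B| = 3)
  (AB : biclique (del E v) A B).

(** If [A'] lay in the neighbourhood of [v], adding [v] to [B'] would give a $K_{3,4}$. Applied to
    both sides, this provides the ends of the edge to be removed. *)
Lemma biclique_not_sub A' B' : #|A'| = 3 -> #|B'| = 3 -> biclique (del E v) A' B' ->
  exists2 a, a \in A' & a \notin nbr E v.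
Proof.
move=> A'3 B'3 AB'.
have [/exists_inP //|/exists_inPn sub] := boolP [exists x in A', x \notin nbr E v].
have [a aA] : exists a, a \in A' by apply/card_gt0P; rewrite A'3.
have vB : v \notin B'.
  by apply/negP => vB; have := AB' a v aA vB; rewrite !inE eqxx orbT andbF.
exfalso; apply: (noK34 (A := A') (B := v |: B')) => //; first by rewrite cardsU1 vB B'3.
move=> x y xA; rewrite !inE => /orP[/eqP ->|yB].
  by rewrite setUC; move: (sub x xA); rewrite negbK inE.
by have := AB' x y xA yB; rewrite inE => /andP[].
Qed.

Variables a b : V.
Hypotheses (aA : a \in A) (bB : b \in B) (av : a \notin nbr E v) (bv : b \notin nbr E v).

Let ab : [set a; b] \in del E v. Proof. exact: AB. Qed.
Let H := del E v :\ [set a; b].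
Let sH : simple H. Proof. exact: simple_del_remove. Qed.
Let cH : #|H| = 10. Proof. exact: card_del_remove. Qed.
Let dAB : [disjoint A & B]. Proof. exact: biclique_disjoint (simple_del sE) AB. Qed.

Let HAB x y : x \in A -> y \in B -> (x != a) || (y != b) -> [set x; y] \in H.
Proof.
move=> xA yB xy; rewrite in_setD1 AB // andbT; apply: contraTneq xy.
case/set2_eq => [[-> ->]|[xb _]]; first by rewrite !eqxx.
by rewrite xb (disjointFl dAB) in xA.
Qed.

(** A cover containing [A] equals it and covers [E] together with [v]; likewise for [B]. Otherwise
    it omits only [a] and [b], and the other four vertices of the biclique are too many. *)
Lemma biclique_no_cover C : #|C| <= 3 -> covers C H -> False.
Proof.
move=> C3 cC.
have big (D : {set V}) : #|D| = 3 -> D \subset C -> (a \in D) || (b \in D) -> False.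
  move=> D3 DC abD; have CD : C = D by apply/esym/(sub_cards_eq DC D3 C3).
  apply: (no_cover4 (C := v |: D)).
    by apply: leq_trans (leq_card_setU _ _) _; rewrite cards1 D3.
  apply: covers_del => e eD; have [->|eab] := eqVneq e [set a; b].
    by rewrite set2_disjoint negb_and !negbK.
  by rewrite -CD; apply: cC; rewrite in_setD1 eab.
have [AC|/subsetPn[x xA xC]] := boolP (A \subset C); first by apply: (big A) => //; rewrite aA.
have [BC|/subsetPn[y yB yC]] := boolP (B \subset C); first by apply: (big B) => //; rewrite bB orbT.
have xyE x' y' : x' \in A -> y' \in B -> x' \notin C -> y' \notin C -> x' = a /\ y' = b.
  move=> x'A y'B x'C y'C; have [//|] := boolP ((x' == a) && (y' == b)).
    by case/andP => /eqP -> /eqP ->.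
  rewrite negb_and => /(HAB x'A y'B) /cC; by rewrite set2_disjoint x'C y'C.
have [xa yb] := xyE x y xA yB xC yC.
have sub : (A :\ a) :|: (B :\ b) \subset C.
  apply/subsetP => z; rewrite !inE => /orP[]/andP[zne zAB]; apply/negPn/negP => zC.
    by have [za _] := xyE z y zAB yB zC yC; rewrite za eqxx in zne.
  by have [_ zb] := xyE x z xA zAB xC zC; rewrite zb eqxx in zne.
have := subset_leq_card sub; rewrite cardsU.
have -> : (A :\ a) :&: (B :\ b) = set0.
  apply/setP => z; rewrite !inE; apply/negP => /andP[/andP[_ zA] /andP[_ zB]].
  by rewrite (disjointFl dAB) in zA.
by rewrite cards0; have := cardD1_in aA; have := cardD1_in bB; clia.
Qed.

Let deg2A x : x \in A -> 1 < #|nbr H x|.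
Proof.
move=> xA; have sub : B :\ b \subset nbr H x.
  by apply/subsetP => y; rewrite !inE => /andP[yb yB]; have := HAB xA yB; rewrite yb orbT !inE; apply.
by apply: leq_trans (subset_leq_card sub); have := cardD1_in bB; clia.
Qed.

Let deg2B y : y \in B -> 1 < #|nbr H y|.
Proof.
move=> yB; have sub : A :\ a \subset nbr H y.
  apply/subsetP => x; rewrite !inE => /andP[xa xA]; have := HAB xA yB.
  by rewrite xa setUC !inE; apply.
by apply: leq_trans (subset_leq_card sub); have := cardD1_in aA; clia.
Qed.

Lemma indep_biclique_at : indep R 5 E.
Proof.
apply: (no_triple_indep v4 ab); first by rewrite set2_disjoint av bv.
  exact: biclique_no_cover.
apply: (near_biclique_no_biclique (A := A) (B := B) (a := a) (b := b)) => //.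
- by rewrite cH.
- by rewrite in_setD1 eqxx.
by move=> x; rewrite inE => /orP[/deg2A|/deg2B].
Qed.

End Biclique.

Lemma indep_biclique v A B : #|nbr E v| = 4 -> #|A| = 3 -> #|B| = 3 ->
  biclique (del E v) A B -> indep R 5 E.
Proof.
move=> v4 A3 B3 AB; have [a aA av] := biclique_not_sub A3 B3 AB.
have [b bB bv] := biclique_not_sub B3 A3 (bicliqueC AB).
exact: (indep_biclique_at v4 A3 B3 AB aA bB av bv).
Qed.

Lemma three_stars_indep s (f' : {set V}) p q r (f : {set V}) : #|nbr E s| = 4 -> f' \in del E s ->
  [disjoint f' & nbr E s] -> p != q -> p != r -> q != r ->
  #|nbr (del E s :\ f') p| = 3 -> #|nbr (del E s :\ f') q| = 3 ->
  #|nbr (del E s :\ f') r| = 3 ->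
  q \notin nbr (del E s :\ f') p -> r \notin nbr (del E s :\ f') p ->
  r \notin nbr (del E s :\ f') q ->
  f \in E -> f != f' -> s \notin f -> p \notin f -> q \notin f -> r \notin f ->
  ~ (nbr (del E s :\ f') q = nbr (del E s :\ f') p /\
     nbr (del E s :\ f') r = nbr (del E s :\ f') p) -> indep R 5 E.
Proof.
move=> s4 f'D f'N pq pr qr p3 q3 r3 qp rp rq fE ff' sf pf qf rf neq.
have fH : f \in del E s :\ f' by rewrite in_setD1 ff' inE fE.
have [nC nK] := three_stars_good (@simple_del_remove s f') (card_del_remove s4 f'D)
  pq pr qr p3 q3 r3 qp rp rq fH pf qf rf neq.
exact: no_triple_indep s4 f'D f'N nC nK.
Qed.

Lemma nbr_off s (f' : {set V}) y : y != s -> y \notin f' -> nbr (del E s :\ f') y = nbr E y :\ s.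
Proof. by move=> ys yf'; rewrite nbr_remove_notin // nbr_del. Qed.

Lemma nbr_on s y z : y != s -> nbr (del E s :\ [set y; z]) y = nbr E y :\ s :\ z.
Proof. by move=> ys; rewrite nbr_remove nbr_del. Qed.

Lemma nbr_on_r s y z : y != s -> nbr (del E s :\ [set z; y]) y = nbr E y :\ s :\ z.
Proof. by rewrite setUC; apply: nbr_on. Qed.

(** Repeated failure of [three_stars_indep] ends in this $K_{3,4}$. *)
Lemma common_three_false (L : {set V}) al be ga de : uniq [:: al; be; ga; de] -> #|L| = 3 ->
  L \subset nbr E al -> L \subset nbr E be -> L \subset nbr E ga -> L \subset nbr E de -> False.
Proof.
move=> un L3 La Lb Lc Ld.
apply: (noK34 (A := L) (B := [set x in [:: al; be; ga; de]])) => //.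
  by rewrite cardsE (card_uniqP un).
move=> y x yL; rewrite !inE setUC => /or4P[]/eqP ->.
- by have := subsetP La y yL; rewrite inE.
- by have := subsetP Lb y yL; rewrite inE.
- by have := subsetP Lc y yL; rewrite inE.
by have := subsetP Ld y yL; rewrite inE.
Qed.

Lemma card_D1_in4 y z : #|nbr E y| = 4 -> z \in nbr E y -> #|nbr E y :\ z| = 3.
Proof. by move=> y4 /cardD1_in; rewrite y4 => -[]. Qed.

(** * Four vertices covering all edges but one *)

Section Uncovered.
Variable f : {set V}.
Hypothesis fE : f \in E.

(** Deleting [al] and the edge between [ga] and [de] leaves the stars of [be], [ga] and [de], with
    [f] as the tenth edge. *)
Lemma matching_step al be ga de : uniq [:: al; be; ga; de] ->
  #|nbr E al| = 4 -> #|nbr E be| = 4 -> #|nbr E ga| = 4 -> #|nbr E de| = 4 ->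
  be \in nbr E al -> de \in nbr E ga -> ga \notin nbr E al -> de \notin nbr E al ->
  ga \notin nbr E be -> de \notin nbr E be ->
  al \notin f -> be \notin f -> ga \notin f -> de \notin f ->
  ~ (nbr E ga :\ de = nbr E be :\ al /\ nbr E de :\ ga = nbr E be :\ al) -> indep R 5 E.
Proof.
case/uniq4P=> ab ac ad [bc bd cd].
move=> a4 b4 c4 d4 ba dc ca da cb db af bf cf df neq.
have acN : al \notin nbr E ga by rewrite nbrC.
have adN : al \notin nbr E de by rewrite nbrC.
have nb : nbr (del E al :\ [set ga; de]) be = nbr E be :\ al.
  by rewrite nbr_off // 1?eq_sym // !inE negb_or bc bd.
have nc : nbr (del E al :\ [set ga; de]) ga = nbr E ga :\ de.
  by rewrite nbr_on 1?eq_sym // (setD1_notin acN).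
have nd : nbr (del E al :\ [set ga; de]) de = nbr E de :\ ga.
  by rewrite nbr_on_r 1?eq_sym // (setD1_notin adN).
apply: (@three_stars_indep al [set ga; de] be ga de f); rewrite ?nb ?nc ?nd //.
- by move: dc; rewrite !inE => -> /=; rewrite negb_or ac ad.
- by rewrite set2_disjoint ca da.
- by rewrite card_D1_in4 // nbrC.
- by rewrite card_D1_in4.
- by rewrite card_D1_in4 // nbrC.
- by rewrite in_setD1 negb_and cb orbT.
- by rewrite in_setD1 negb_and db orbT.
- by rewrite in_setD1 eqxx.
- by apply: contraNneq cf => ->; rewrite set21.
Qed.

(** If the step fails both with [al] and with [be] deleted, the resulting equalities give all four
    vertices three common neighbours. *)
Lemma indep_matching al be ga de : uniq [:: al; be; ga; de] ->
  #|nbr E al| = 4 -> #|nbr E be| = 4 -> #|nbr E ga| = 4 -> #|nbr E de| = 4 ->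
  be \in nbr E al -> de \in nbr E ga -> ga \notin nbr E al -> de \notin nbr E al ->
  ga \notin nbr E be -> de \notin nbr E be ->
  al \notin f -> be \notin f -> ga \notin f -> de \notin f -> indep R 5 E.
Proof.
move=> un a4 b4 c4 d4 ba dc ca da cb db af bf cf df.
have [[e1 e2]|neq] := pselect (nbr E ga :\ de = nbr E be :\ al /\ nbr E de :\ ga = nbr E be :\ al);
  last exact: (matching_step un).
have un' : uniq [:: be; al; ga; de] by rewrite -(perm_uniq (permEl (perm_catCA [:: al] [:: be] _))).
have ab : al \in nbr E be by rewrite nbrC.
have [[e3 e4]|neq] := pselect (nbr E ga :\ de = nbr E al :\ be /\ nbr E de :\ ga = nbr E al :\ be);
  last exact: (matching_step un').
exfalso; apply: (common_three_false (L := nbr E be :\ al) un).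
- exact: card_D1_in4.
- by rewrite -e1 e3 subD1set.
- exact: subD1set.
- by rewrite -e1 subD1set.
by rewrite -e2 subD1set.
Qed.

(** Two choices: [ga] with the edge between [al] and [be], or [al] with an edge from [ga] to some
    [z]. If both fail, the four vertices have three common neighbours. *)
Lemma indep_one_edge al be ga de : uniq [:: al; be; ga; de] ->
  #|nbr E al| = 4 -> #|nbr E be| = 4 -> #|nbr E ga| = 4 -> #|nbr E de| = 3 ->
  be \in nbr E al -> ga \notin nbr E al -> de \notin nbr E al ->
  ga \notin nbr E be -> de \notin nbr E be -> de \notin nbr E ga ->
  al \notin f -> be \notin f -> ga \notin f -> de \notin f -> indep R 5 E.
Proof.
move=> un; have [ab ac ad [bc bd cd]] := uniq4P un.
move=> a4 b4 c4 d3 ba ca da cb db dc af bf cf df.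
have acN : al \notin nbr E ga by rewrite nbrC.
have bcN : be \notin nbr E ga by rewrite nbrC.
have adN : al \notin nbr E de by rewrite nbrC.
have cdN : ga \notin nbr E de by rewrite nbrC.
have abN : al \in nbr E be by rewrite nbrC.
have [[e1 e2]|neq] := pselect (nbr E be :\ al = nbr E al :\ be /\ nbr E de = nbr E al :\ be);
    last first.
  have na : nbr (del E ga :\ [set al; be]) al = nbr E al :\ be.
    by rewrite nbr_on // (setD1_notin ca).
  have nb : nbr (del E ga :\ [set al; be]) be = nbr E be :\ al.
    by rewrite nbr_on_r // (setD1_notin cb).
  have nd : nbr (del E ga :\ [set al; be]) de = nbr E de.
    by rewrite nbr_off 1?eq_sym // ?setD1_notin // !inE negb_or ![de == _]eq_sym ad bd.
  apply: (@three_stars_indep ga [set al; be] al be de f); rewrite ?na ?nb ?nd ?d3 //.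
  - by move: ba; rewrite !inE => -> /=; rewrite negb_or ![ga == _]eq_sym ac bc.
  - by rewrite set2_disjoint acN bcN.
  - exact: card_D1_in4.
  - exact: card_D1_in4.
  - by rewrite in_setD1 eqxx.
  - by rewrite in_setD1 negb_and da orbT.
  - by rewrite in_setD1 negb_and db orbT.
  - by apply: contraNneq af => ->; rewrite set21.
(* The neighbourhoods of [ga] and [al] have the same size, and [be] belongs only to the latter. *)
have /subsetPn [z zc za] : ~~ (nbr E ga \subset nbr E al).
  apply: contra bcN => sub; have -> : nbr E ga = nbr E al by apply: (sub_cards_eq sub c4); rewrite a4.
  exact: ba.
have zb : z != be by apply: contraNneq za => ->.
have zd : z != de by apply: contraNneq dc => <-.
have za' : z != al by apply: contraNneq acN => <-.
have [[e3 e4]|neq] := pselect (nbr E ga :\ z = nbr E be :\ al /\ nbr E de = nbr E be :\ al);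
    last first.
  have nb : nbr (del E al :\ [set ga; z]) be = nbr E be :\ al.
    by rewrite nbr_off // 1?eq_sym // !inE negb_or bc eq_sym zb.
  have nc : nbr (del E al :\ [set ga; z]) ga = nbr E ga :\ z.
    by rewrite nbr_on 1?eq_sym // (setD1_notin acN).
  have nd : nbr (del E al :\ [set ga; z]) de = nbr E de.
    by rewrite nbr_off 1?eq_sym // ?setD1_notin // !inE negb_or ![de == _]eq_sym cd zd.
  apply: (@three_stars_indep al [set ga; z] be ga de f); rewrite ?nb ?nc ?nd ?d3 //.
  - by move: zc; rewrite !inE => -> /=; rewrite negb_or ac eq_sym za'.
  - by rewrite set2_disjoint ca za.
  - exact: card_D1_in4.
  - exact: card_D1_in4.
  - by rewrite in_setD1 negb_and cb orbT.
  - by rewrite in_setD1 negb_and db orbT.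
  - by rewrite in_setD1 negb_and dc orbT.
  - by apply: contraNneq cf => ->; rewrite set21.
exfalso; apply: (common_three_false (L := nbr E be :\ al) un).
- exact: card_D1_in4.
- by rewrite e1 subD1set.
- exact: subD1set.
- by rewrite -e3 subD1set.
by rewrite e4.
Qed.

(** Deleting [ga] and an edge from [ga'] to a non-neighbour [z] of [ga] leaves the stars of [ga'],
    [de] and [de']. *)
Lemma different_step ga ga' de de' z : uniq [:: ga; ga'; de; de'] ->
  #|nbr E ga| = 4 -> #|nbr E ga'| = 4 -> #|nbr E de| = 3 -> #|nbr E de'| = 3 ->
  ga' \notin nbr E ga -> de \notin nbr E ga -> de' \notin nbr E ga ->
  de \notin nbr E ga' -> de' \notin nbr E ga' -> de' \notin nbr E de ->
  ga \notin f -> ga' \notin f -> de \notin f -> de' \notin f ->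
  z \in nbr E ga' -> z \notin nbr E ga ->
  ~ (nbr E de = nbr E ga' :\ z /\ nbr E de' = nbr E ga' :\ z) -> indep R 5 E.
Proof.
case/uniq4P=> ab ac ad [bc bd cd].
move=> a4 b4 c3 d3 ba ca da cb db dc af bf cf df zb za neq.
have acN : ga \notin nbr E de by rewrite nbrC.
have adN : ga \notin nbr E de' by rewrite nbrC.
have abN : ga \notin nbr E ga' by rewrite nbrC.
have zc : z != de by apply: contraNneq cb => <-.
have zd : z != de' by apply: contraNneq db => <-.
have zg : z != ga by apply: contraNneq abN => <-.
have nb : nbr (del E ga :\ [set ga'; z]) ga' = nbr E ga' :\ z.
  by rewrite nbr_on 1?eq_sym // (setD1_notin abN).
have nc : nbr (del E ga :\ [set ga'; z]) de = nbr E de.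
  by rewrite nbr_off 1?eq_sym // ?setD1_notin // !inE negb_or ![de == _]eq_sym bc zc.
have nd : nbr (del E ga :\ [set ga'; z]) de' = nbr E de'.
  by rewrite nbr_off 1?eq_sym // ?setD1_notin // !inE negb_or ![de' == _]eq_sym bd zd.
apply: (@three_stars_indep ga [set ga'; z] ga' de de' f); rewrite ?nb ?nc ?nd ?c3 ?d3 //.
- by move: zb; rewrite !inE => -> /=; rewrite negb_or ab eq_sym zg.
- by rewrite set2_disjoint ba za.
- exact: card_D1_in4.
- by rewrite in_setD1 negb_and cb orbT.
- by rewrite in_setD1 negb_and db orbT.
- by apply: contraNneq bf => ->; rewrite set21.
Qed.

(** Here [ga] is deleted with an edge at [de]. The two edges left at [de] force it into any
    $K_{3,3}$ but are too few for one; a cover by three vertices must consist of [ga'], [de] and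
    [de'], and misses [f]. *)
Lemma same_step ga ga' de de' z : uniq [:: ga; ga'; de; de'] ->
  #|nbr E ga| = 4 -> nbr E ga' = nbr E ga -> #|nbr E de| = 3 -> #|nbr E de'| = 3 ->
  ga' \notin nbr E ga -> de \notin nbr E ga -> de' \notin nbr E ga -> de' \notin nbr E de ->
  ga \notin f -> ga' \notin f -> de \notin f -> de' \notin f ->
  z \in nbr E de -> z \notin nbr E ga -> indep R 5 E.
Proof.
case/uniq4P=> ab ac ad [bc bd cd].
move=> a4 eqN c3 d3 ba ca da dc af bf cf df zc za.
have acN : ga \notin nbr E de by rewrite nbrC.
have adN : ga \notin nbr E de' by rewrite nbrC.
have bcN : ga' \notin nbr E de by rewrite nbrC eqN.
have bdN : ga' \notin nbr E de' by rewrite nbrC eqN.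
have abN : ga \notin nbr E ga' by rewrite nbrC.
have cdN : de \notin nbr E de' by rewrite nbrC.
have zb : z != ga' by apply: contraNneq bcN => <-.
have zd : z != de' by apply: contraNneq dc => <-.
have zg : z != ga by apply: contraNneq acN => <-.
set f' := [set de; z]; set H := del E ga :\ f'.
have f'D : f' \in del E ga.
  by move: zc; rewrite !inE => -> /=; rewrite negb_or ac eq_sym zg.
have f'N : [disjoint f' & nbr E ga] by rewrite set2_disjoint ca za.
have nb : nbr H ga' = nbr E ga.
  rewrite nbr_off 1?eq_sym //; first by rewrite (setD1_notin abN).
  by rewrite !inE negb_or bc eq_sym zb.
have nc : nbr H de = nbr E de :\ z by rewrite nbr_on 1?eq_sym // (setD1_notin acN).
have nd : nbr H de' = nbr E de'.
  by rewrite nbr_off 1?eq_sym // ?setD1_notin // !inE negb_or ![de' == _]eq_sym cd zd.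
have c2 : #|nbr H de| = 2 by rewrite nc; have := cardD1_in zc; rewrite c3 => -[].
have sH : simple H := @simple_del_remove _ _.
have cH : #|H| = 10 := card_del_remove a4 f'D.
have fH : f \in H.
  by rewrite !in_setD1 inE fE af !andbT; apply: contraNneq cf => ->; rewrite set21.
apply: (no_triple_indep a4 f'D f'N) => [C C3|].
  rewrite -/H => cC.
  have bC : ga' \in C.
    apply/negPn/negP => /(cover_nbr cC) /subset_leq_card; rewrite nb a4.
    by move: C3; clia.
  have dC : de' \in C.
    apply/negPn/negP => /(cover_nbr cC) sub.
    by apply: (setU1_cards (x := ga') _ bC sub _ C3); rewrite nd.
  have cCde : de \in C.
    apply/negPn/negP => /(cover_nbr cC) sub.
    have dbC : de' \in C :\ ga' by rewrite !inE eq_sym bd.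
    have : nbr H de \subset C :\ ga' :\ de'.
      apply/subsetP => y yN; rewrite !inE (subsetP sub y yN) andbT; apply/andP; split.
        by apply: contraTneq yN => ->; rewrite nc in_setD1 negb_and dc orbT.
      by apply: contraTneq yN => ->; rewrite nc in_setD1 negb_and bcN orbT.
    move/subset_leq_card; rewrite c2.
    by have := cardD1_in bC; have := cardD1_in dbC; move: C3; clia.
  have CE := cards3_eq C3 bC cCde dC bc bd cd.
  have := cC f fH; rewrite disjoint_sym CE => /pred0Pn [y /= /andP[]].
  by rewrite !inE -orbA => /or3P[]/eqP -> yf; move: yf; apply/negP.
rewrite -/H; suff side A B : #|A| = 3 -> #|B| = 3 -> biclique H A B -> de \in A -> False.
  move=> A B A3 B3 AB; have : (de \in A) || (de \in B).
    by apply: (biclique_contains sH _ A3 B3 AB); rewrite ?cH ?c2.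
  by case/orP => deS; [apply: (side A B) | apply: (side B A) => //; apply: bicliqueC].
move=> A3 B3 AB deA; have : B \subset nbr H de.
  by apply/subsetP => y yB; rewrite inE AB.
by move/subset_leq_card; rewrite c2 B3.
Qed.

(** If every choice fails without giving a $K_{3,4}$, all four neighbourhoods lie in that of [ga].
    The 14 edges other than [f] then run between two disjoint 4-sets, one more than allowed. *)
Lemma indep_no_edge ga ga' de de' : uniq [:: ga; ga'; de; de'] ->
  (forall A B, #|A| = 4 -> #|B| = 4 -> [disjoint A & B] -> #|cross E A B| <= 13) ->
  covers [set x in [:: ga; ga'; de; de']] (E :\ f) ->
  #|nbr E ga| = 4 -> #|nbr E ga'| = 4 -> #|nbr E de| = 3 -> #|nbr E de'| = 3 ->
  ga' \notin nbr E ga -> de \notin nbr E ga -> de' \notin nbr E ga ->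
  de \notin nbr E ga' -> de' \notin nbr E ga' -> de' \notin nbr E de ->
  ga \notin f -> ga' \notin f -> de \notin f -> de' \notin f -> indep R 5 E.
Proof.
move=> un no44 cov a4 b4 c3 d3 ba ca da cb db dc af bf cf df.
have abN : ga \notin nbr E ga' by rewrite nbrC.
have cdN : de \notin nbr E de' by rewrite nbrC.
have [sub|/subsetPn [z zb za]] := boolP (nbr E ga' \subset nbr E ga); last first.
  have [[e1 e2]|neq] := pselect (nbr E de = nbr E ga' :\ z /\ nbr E de' = nbr E ga' :\ z);
    last exact: (different_step un a4 b4 c3 d3 ba ca da cb db dc af bf cf df zb za).
  have /subsetPn [z' zb' za'] : ~~ (nbr E ga \subset nbr E ga').
    apply: contra za => sub; suff -> : nbr E ga = nbr E ga' by [].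
    by apply: (sub_cards_eq sub a4); rewrite b4.
  have un' : uniq [:: ga'; ga; de; de'].
    by rewrite -(perm_uniq (permEl (perm_catCA [:: ga] [:: ga'] _))).
  have [[e3 e4]|neq] := pselect (nbr E de = nbr E ga :\ z' /\ nbr E de' = nbr E ga :\ z');
    last exact: (different_step un' b4 a4 c3 d3 abN cb db ca da dc bf af cf df zb' za').
  exfalso; apply: (common_three_false (L := nbr E de) un) => //.
  - by rewrite e3 subD1set.
  - by rewrite e1 subD1set.
  by rewrite e2 e1.
have eqN : nbr E ga' = nbr E ga by apply: (sub_cards_eq sub b4); rewrite a4.
have [subc|/subsetPn [z zc za]] := boolP (nbr E de \subset nbr E ga); last first.
  exact: (same_step un a4 eqN c3 d3 ba ca da dc af bf cf df zc za).
have [subd|/subsetPn [z zd za]] := boolP (nbr E de' \subset nbr E ga); last first.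
  have un' : uniq [:: ga; ga'; de'; de].
    by move: un; rewrite /= !inE !negb_or [de' == de]eq_sym => /and4P[/and3P[-> -> ->] /andP[-> ->] ->].
  exact: (same_step un' a4 eqN d3 c3 ba da ca cdN af bf df cf zd za).
exfalso; set S := [set x in [:: ga; ga'; de; de']] in cov.
have S4 : #|S| = 4 by rewrite cardsE (card_uniqP un).
have subS x : x \in S -> nbr E x \subset nbr E ga.
  by rewrite inE !inE => /or4P[]/eqP -> //; rewrite eqN.
have dS : [disjoint S & nbr E ga].
  apply/pred0P => x /=; apply/negbTE/negP => /andP[]; rewrite inE !inE.
  have gg : ga \notin nbr E ga by apply/negP => /(nbr_neq sE); rewrite eqxx.
  rewrite -[_ \in E]/(_) => /or4P[]/eqP -> gx.
  - by move: gg; rewrite inE gx.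
  - by move: ba; rewrite inE gx.
  - by move: ca; rewrite inE gx.
  by move: da; rewrite inE gx.
have := no44 S (nbr E ga) S4 a4 dS; rewrite leqNgt => /negP; apply.
have <- : #|E :\ f| = 14 by have := cardD1_in fE; rewrite cE => -[].
apply/subset_leq_card/subsetP => e eEf; have := cov e eEf.
have eE : e \in E by move: eEf; rewrite inE => /andP[].
case/pred0Pn => x /= /andP[xe xS]; have [y yx exy] := edge_at sE eE xe.
have yN : y \in nbr E ga by apply: (subsetP (subS x xS)); rewrite inE -exy.
by rewrite !inE eE /= exy !set2_disjoint !negb_and !negbK xS yN orbT.
Qed.

End Uncovered.

Lemma quad_count v p q r : uniq [:: v; p; q; r] ->
  #|E| + ((p \in nbr E v) + (q \in nbr E v) + (r \in nbr E v) + (q \in nbr E p)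
    + (r \in nbr E p) + (r \in nbr E q)) =
  #|nbr E v| + #|nbr E p| + #|nbr E q| + #|nbr E r| + #|del (del (del (del E v) p) q) r|.
Proof.
case/uniq4P=> vp vq vr [pq pr qr]; have sv := simple_del (v := v) sE.
have svp := simple_del (v := p) sv; have svpq := simple_del (v := q) svp.
have := card_del v sE; have := card_del p sv; have := card_del q svp.
have := card_del r svpq; have ne x y : x != y -> y != x by rewrite eq_sym.
have -> : nbr (del E v) p = nbr E p :\ v by rewrite nbr_del // ne.
have -> : nbr (del (del E v) p) q = nbr E q :\ v :\ p by rewrite !nbr_del // ne.
have -> : nbr (del (del (del E v) p) q) r = nbr E r :\ v :\ p :\ q by rewrite !nbr_del // ne.
have := cardsD1 v (nbr E p); have := cardsD1 v (nbr E q); have := cardsD1 v (nbr E r).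
have := cardsD1 p (nbr E q :\ v); have := cardsD1 p (nbr E r :\ v).
have := cardsD1 q (nbr E r :\ v :\ p).
have -> : (q \in nbr E r :\ v :\ p) = (q \in nbr E r) by rewrite !in_setD1 ![q == _]eq_sym pq vq.
have -> : (p \in nbr E r :\ v) = (p \in nbr E r) by rewrite !in_setD1 eq_sym vp.
have -> : (p \in nbr E q :\ v) = (p \in nbr E q) by rewrite !in_setD1 eq_sym vp.
rewrite ![v \in _]nbrC ![p \in nbr E q]nbrC ![p \in nbr E r]nbrC ![q \in nbr E r]nbrC.
move: (nat_of_bool (p \in nbr E v)) (nat_of_bool (q \in nbr E v)) (nat_of_bool (r \in nbr E v))
  (nat_of_bool (q \in nbr E p)) (nat_of_bool (r \in nbr E p)) (nat_of_bool (r \in nbr E q)).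
move=> n1 n2 n3 n4 n5 n6; clia.
Qed.

(** The vertex [v] and the cover [C] form a quadruple meeting all edges but [f], and [f] avoids it
    because no four vertices cover [E]. Its degrees and adjacencies fall under the three cases of
    [quad_type]. *)
Lemma indep_uncovered v f C : #|nbr E v| = 4 -> f \in del E v -> #|C| <= 3 ->
  (forall A B, #|A| = 4 -> #|B| = 4 -> [disjoint A & B] -> #|cross E A B| <= 13) ->
  covers C (del E v :\ f) -> indep R 5 E.
Proof.
move=> v4 fD C3 no44 cC; have fE := subsetP (del_sub E v) f fD.
have sH : simple (del E v :\ f) := @simple_del_remove v f.
have cH := card_del_remove v4 fD.
have vcov e : e \in E -> e != f -> ~~ [disjoint e & v |: C].
  move=> eE ef; have [ve|ve] := boolP (v \in e).
    by apply/pred0Pn; exists v; rewrite /= ve !inE eqxx.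
  have /cC/pred0Pn[z /= /andP[ze zC]] : e \in del E v :\ f by rewrite in_setD1 ef inE eE.
  by apply/pred0Pn; exists z; rewrite /= ze inE zC orbT.
have S4 : #|v |: C| <= 4.
  by apply: leq_trans (leq_card_setU _ _) _; rewrite cards1 add1n ltnS.
have fS : [disjoint f & v |: C].
  apply/negPn/negP => fS; apply: (no_cover4 S4) => e eE.
  by have [->|ef] := eqVneq e f; [|apply: vcov].
have C3' : #|C| = 3.
  by have := covers_card sH (@del_remove_le4 v f) cC; rewrite cH; clia.
have vC : v \notin C.
  apply/negP => vC; have : covers (C :\ v) (del E v :\ f).
    move=> e eH; have /pred0Pn[z /= /andP[ze zC]] := cC e eH.
    apply/pred0Pn; exists z; rewrite /= ze !inE zC andbT.
    by apply: contraTneq eH => <-; rewrite !inE ze !andbF.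
  move/(covers_card sH (@del_remove_le4 v f)); rewrite cH.
  by have := cardD1_in vC; clia.
have [p pC] : exists p, p \in C by apply/card_gt0P; rewrite C3'.
have /cards2P[q [r [qr CE]]] : #|C :\ p| == 2 by have := cardD1_in pC; rewrite C3' => -[->].
have qrC x : (x == q) || (x == r) -> (x \in C) && (x != p).
  move=> xqr; have : x \in C :\ p by rewrite CE !inE.
  by rewrite !inE andbC.
have /andP[qC qp] := qrC q (introT orP (or_introl (eqxx q))).
have /andP[rC rp] := qrC r (introT orP (or_intror (eqxx r))).
have un : uniq [:: v; p; q; r].
  rewrite /= !inE !negb_or qr ![p == _]eq_sym qp rp !andbT /=.
  by do ![apply/andP; split]; apply: contraNneq vC => ->.
have SE : v |: C = [set x in [:: v; p; q; r]].
  by rewrite -(setD1K pC) CE; apply/setP => x; rewrite !inE !orbA.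
have D4 : del (del (del (del E v) p) q) r = [set f].
  apply/setP => e; rewrite in_set1; apply/idP/eqP => [|->].
    rewrite !inE -!andbA => /and5P[eE ve pe qe re]; apply/eqP.
    apply: contraT => /(vcov e eE); rewrite SE => /pred0Pn[z /= /andP[ze]].
    rewrite inE !inE => /or4P[]/eqP zE; move: ze; rewrite zE;
      by [rewrite (negPf ve)|rewrite (negPf pe)|rewrite (negPf qe)|rewrite (negPf re)].
  have nf x : x \in v |: C -> x \notin f by move=> xS; rewrite (disjointFl fS).
  by rewrite !inE fE !nf ?setU11 ?setU1r.
have := quad_count un; rewrite D4 cards1 cE => cnt.
have trip x y z : x != y -> x != z -> y != z ->
    ~~ [&& #|nbr E x| == 4, #|nbr E y| == 4, #|nbr E z| == 4,
        y \notin nbr E x, z \notin nbr E x & z \notin nbr E y].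
  move=> xy xz yz; apply/negP => /and5P[/eqP x4 /eqP y4 /eqP z4 yx /andP[zx zy]].
  by apply: (no_triple (v := x) (a := y) (b := z)); split; split; rewrite // eq_sym.
have [vp vq vr [pq pr _]] := uniq4P un.
have := @quad_claim_true #|nbr E v| #|nbr E p| #|nbr E q| #|nbr E r|
  (p \in nbr E v) (q \in nbr E v) (r \in nbr E v) (q \in nbr E p) (r \in nbr E p)
  (r \in nbr E q) (E4 v) (E4 p) (E4 q) (E4 r).
rewrite /quad_claim; set D := nth 0 _; set B := quad_table _ _ _ _ _ _.
have cnt' : 14 + ((p \in nbr E v) + (q \in nbr E v) + (r \in nbr E v) + (q \in nbr E p)
    + (r \in nbr E p) + (r \in nbr E q)) == #|nbr E v| + #|nbr E p| + #|nbr E q| + #|nbr E r|.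
  by apply/eqP/(@addIn 1); rewrite -cnt addnAC.
case: ifP => [_|/negP[]]; last first.
  by apply/and5P; split; rewrite /quad_triple /D /B /= ?trip.
case/hasP=> -[|i [|j [|k [|l [|]]]]] //; rewrite mem_permutations => sP.
pose X := nth v [:: v; p; q; r].
have un' : uniq (map X [:: i; j; k; l]) by rewrite (perm_uniq (perm_map X sP)).
have cov' : covers [set x in map X [:: i; j; k; l]] (E :\ f).
  move=> e; rewrite in_setD1 => /andP[ef eE]; have := vcov e eE ef; rewrite SE.
  rewrite (_ : [set x in map X _] = [set x in [:: v; p; q; r]]) //.
  by apply/setP => x; rewrite !inE; have := perm_mem (perm_map X sP) x; rewrite !inE.
have := perm_all (fun x => x < 4) sP; rewrite /= !andbT => /and4P[i4 j4 k4 l4].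
have nf x : x < 4 -> X x \notin f.
  move=> x4; have xS : X x \in v |: C.
    by move: x x4 => [|[|[|[|]]]] // _; rewrite /X /= ?setU11 ?setU1r.
  by rewrite (disjointFl fS xS).
have DE x : x < 4 -> D x = #|nbr E (X x)| by move: x => [|[|[|[|]]]].
have self x : (x \in nbr E x) = false by apply/negP => /(nbr_neq sE); rewrite eqxx.
have BE x y : x < 4 -> y < 4 -> B x y = (X y \in nbr E (X x)).
  move=> x4 y4; case: x x4 => [|[|[|[|]]]] // _; case: y y4 => [|[|[|[|]]]] // _;
  by rewrite /B /quad_table /X /= ?self // nbrC.
case/andP; rewrite !BE // => /and4P[ik il jk jl] /or3P[]; rewrite !DE //.
- case/and5P=> /eqP di /eqP dj /eqP dk /eqP dl /andP[ij kl].
  by apply: (indep_matching fE un'); rewrite ?nf.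
- case/and5P=> /eqP di /eqP dj /eqP dk /eqP dl /andP[ij kl].
  by apply: (indep_one_edge fE un'); rewrite ?nf.
case/and5P=> /eqP di /eqP dj /eqP dk /eqP dl /andP[ij kl].
by apply: (indep_no_edge fE un' no44 cov'); rewrite ?nf.
Qed.

End NoTriple.

Lemma indep_dim5_deg4 v : #|nbr E v| = 4 ->
  (forall A B, #|A| = 4 -> #|B| = 4 -> [disjoint A & B] -> #|cross E A B| <= 13) ->
  indep R 5 E.
Proof.
move=> v4 no44; have [[u [a [b trip]]]|no] := pselect (exists u a b, independent_triple u a b).
  exact: indep_triple_exists trip.
have no_triple u a b : ~ independent_triple u a b by move=> trip; apply: no; exists u, a, b.
(* The four neighbours of [v] do not cover [E], which provides [f]. *)
have [f fE fN] : exists2 f, f \in E & [disjoint f & nbr E v].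
  apply: contrapT => none; apply: (no_cover4 (C := nbr E v)); first by rewrite v4.
  by move=> e eE; apply/negP => eN; apply: none; exists e.
have fD : f \in del E v.
  rewrite inE fE; apply/negP => vf; have [z zv fz] := edge_at sE fE vf.
  by move: fN; rewrite fz set2_disjoint !inE -fz fE andbF.
have [[C [C3 cC]]|nC] := pselect (exists C, #|C| <= 3 /\ covers C (del E v :\ f)).
  exact: (indep_uncovered no_triple v4 fD C3 no44 cC).
have [[A [B [A3 B3 AB]]]|nK] := pselect (exists A B, [/\ #|A| = 3, #|B| = 3 &
    biclique (del E v :\ f) A B]).
  apply: (indep_biclique no_triple v4 A3 B3) => a b aA bB.
  by have := AB a b aA bB; rewrite in_setD1 => /andP[].
apply: (no_triple_indep no_triple v4 fD fN) => [C C3 cC|A B A3 B3 AB].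
  by apply: nC; exists C.
by apply: nK; exists A, B.
Qed.

End ExactlyFifteen.
End DimensionFive.

(** * The case t = 5 in low degree *)

Section LowDegree.
Variables (R : realType) (V : finType).
Implicit Types (E H : {set {set V}}) (A B C : {set V}).

Lemma nbr_del_subset E v y : nbr (del E v) y \subset nbr E y.
Proof. exact/nbr_sub/del_sub. Qed.

(** With maximum degree 3 the biclique is a whole component. After deleting [u] and [v] its other
    four vertices have degree at most 2, so they lie in no $K_{3,3}$; yet they span two edges, and
    ten edges leave room for only one. *)
Lemma del_edge_no_biclique E A B u v : simple E -> #|E| = 15 ->
  (forall y, #|nbr E y| <= 3) -> #|A| = 3 -> #|B| = 3 -> biclique E A B ->
  u \in A -> v \in B -> #|del (del E v) u| = 10 -> no_biclique (del (del E v) u) 3 3.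
Proof.
move=> sE cE E3 A3 B3 AB uA vB; set H := del _ _ => cH.
have sH : simple H by do 2!apply: simple_del.
have dAB := biclique_disjoint sE AB.
have nbrA a : a \in A -> nbr E a = B.
  move=> aA; apply/esym/(sub_cards_eq (k := 3)) => //.
  by apply/subsetP => b bB; rewrite inE AB.
have nbrB b : b \in B -> nbr E b = A.
  move=> bB; apply/esym/(sub_cards_eq (k := 3)) => //.
  by apply/subsetP => a aA; rewrite inE setUC AB.
have uv : u != v by apply: contraTneq uA => ->; rewrite (disjointFl dAB).
have lowA a : a \in A -> a != u -> #|nbr H a| <= 2.
  move=> aA au; have av : a != v by apply: contraTneq aA => ->; rewrite (disjointFl dAB).
  apply: leq_trans (subset_leq_card (nbr_del_subset _ _ _)) _.
  by rewrite nbr_del // nbrA //; have := cardD1_in vB; clia.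
have lowB b : b \in B -> b != v -> #|nbr H b| <= 2.
  move=> bB bv; have bu : b != u by apply: contraTneq bB => ->; rewrite (disjointFr dAB).
  rewrite nbr_del // nbr_del // nbrB //.
  apply: leq_trans (_ : #|A :\ u| <= _); last by have := cardD1_in uA; clia.
  by apply/subset_leq_card/setSD/subD1set.
move=> A' B' A'3 B'3 AB'.
have notin y : #|nbr H y| <= 2 -> (y \notin A') && (y \notin B').
  move=> y2; rewrite -negb_or; apply/negP => /orP[yS|yS].
    have : B' \subset nbr H y by apply/subsetP => z zB; rewrite inE AB'.
    by move/subset_leq_card; move: y2; clia.
  have : A' \subset nbr H y by apply/subsetP => z zA; rewrite inE setUC AB'.
  by move/subset_leq_card; move: y2; clia.
have [a1] : exists a1, a1 \in A :\ u.
  by apply/card_gt0P; have := cardD1_in uA; clia.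
move=> a1A; have [a2] : exists a2, a2 \in A :\ u :\ a1.
  by apply/card_gt0P; have := cardD1_in uA; have := cardD1_in a1A; clia.
move: a1A; rewrite !inE => /andP[a1u a1A] /and3P[a2a1 a2u a2A].
have [b1] : exists b1, b1 \in B :\ v by apply/card_gt0P; have := cardD1_in vB; clia.
rewrite !inE => /andP[b1v b1B].
have inH a : a \in A -> a != u -> [set a; b1] \in H.
  move=> aA au; have va : v != a by apply: contraTneq aA => <-; rewrite (disjointFl dAB).
  have ub : u != b1 by apply: contraTneq uA => ->; rewrite (disjointFl dAB).
  by rewrite !inE AB //= !negb_or va eq_sym b1v eq_sym au ub.
have /andP[a1A' _] := notin a1 (lowA a1 a1A a1u).
have /andP[a2A' _] := notin a2 (lowA a2 a2A a2u).
have /andP[b1A' _] := notin b1 (lowB b1 b1B b1v).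
apply: (noncross2 (e1 := [set a1; b1]) (e2 := [set a2; b1]) sH _ A'3 B'3 AB'); rewrite ?cH ?inH //.
- by rewrite ![[set _; b1]]setUC; apply: contra_neq a2a1 => /set2_inj.
- by rewrite set2_disjoint a1A' b1A'.
by rewrite set2_disjoint a2A' b1A'.
Qed.

Definition cubic_triangular E := [/\ simple E,
  forall y, nbr E y != set0 -> #|nbr E y| = 3 &
  forall u v, v \in nbr E u -> exists2 z, z \in nbr E u & z \in nbr E v].

(* Every component is a $K_4$. *)
Lemma cubic_triangular_remove E : cubic_triangular E -> E != set0 ->
  exists2 H, cubic_triangular H & #|E| = #|H| + 6.
Proof.
move=> [sE E3 tri] /set0Pn[e eE].
have [u [y [_ euy]]] := edge2 sE eE.
have u3 : #|nbr E u| = 3 by apply: E3; apply/set0Pn; exists y; rewrite inE -euy.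
have in3 w z : z \in nbr E w -> #|nbr E w| = 3 /\ #|nbr E z| = 3.
  by move=> wz; split; apply: E3; apply/set0Pn; [exists z | exists w; rewrite nbrC].
have nn w : w \notin nbr E w by apply/negP => /(nbr_neq sE); rewrite eqxx.
have full w x1 x2 x3 z : x1 \in nbr E w -> x2 \in nbr E w -> x3 \in nbr E w ->
    x1 != x2 -> x1 != x3 -> x2 != x3 -> z \in nbr E w -> [|| z == x1, z == x2 | z == x3].
  move=> w1 w2 w3 n12 n13 n23; have [w3' _] := in3 w x1 w1.
  by rewrite (cards3_eq (A := nbr E w) _ w1 w2 w3) ?w3' // !inE orbA.
have third w x1 x2 : x1 \in nbr E w -> x2 \in nbr E w -> x1 != x2 ->
    exists x3, [/\ x3 \in nbr E w, x3 != x1 & x3 != x2].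
  move=> w1 w2 n12; have [w3 _] := in3 w x1 w1.
  have w2' : x2 \in nbr E w :\ x1 by rewrite in_setD1 eq_sym n12.
  have [x3] : exists x3, x3 \in nbr E w :\ x1 :\ x2.
    by apply/card_gt0P; have := cardD1_in w1; have := cardD1_in w2'; clia.
  by rewrite !in_setD1 => /and3P[x32 x31 wx3]; exists x3.
have neqN w z : z \in nbr E w -> z != w by apply: nbr_neq.
(* If [a] and [b] were nonadjacent, the triangles on [ua] and [ub] would make the third neighbour
   [c] of [u] adjacent to both. The edge from [a] to its third neighbour [a'] then lies in no
   triangle, since the neighbourhoods of [u] and [c] are already full. *)
have clique a b : a \in nbr E u -> b \in nbr E u -> a != b -> b \in nbr E a.
  move=> ua ub ab; apply/negPn/negP => nab; have [c [uc ca cb]] := third u a b ua ub ab.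
  have uP := full u a b c; have ac : a != c by rewrite eq_sym.
  have bc : b != c by rewrite eq_sym.
  have cNa : c \in nbr E a.
    have [z uz az] := tri u a ua; have := uP z ua ub uc ab ac bc uz.
    case/or3P => /eqP zE; move: az; rewrite zE //; first by rewrite (negPf (nn a)).
    by rewrite (negPf nab).
  have cNb : c \in nbr E b.
    have [z uz bz] := tri u b ub; have := uP z ua ub uc ab ac bc uz.
    case/or3P => /eqP zE; move: bz; rewrite zE //; last by rewrite (negPf (nn b)).
    by rewrite nbrC (negPf nab).
  have au : u \in nbr E a by rewrite nbrC.
  have uc' : u != c by rewrite eq_sym; apply: neqN.
  have [a' [aa' a'u a'c]] := third a u c au cNa uc'.
  have a'a := neqN a a' aa'.
  have a'b : a' != b by apply: contraNneq nab => <-.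
  have [z az a'z] := tri a a' aa'.
  have := full a u c a' z au cNa aa' uc' _ _ az; rewrite ![_ == a']eq_sym.
  case/(_ a'u a'c)/or3P => /eqP zE; move: a'z; rewrite zE => a'z.
  - rewrite nbrC in a'z; by have := uP a' ua ub uc ab ac bc a'z; rewrite (negPf a'a) (negPf a'b) (negPf a'c).
  - rewrite nbrC in a'z; have cu : u \in nbr E c by rewrite nbrC.
    have ca' : a \in nbr E c by rewrite nbrC.
    have cb' : b \in nbr E c by rewrite nbrC.
    have := full c u a b a' cu ca' cb' _ _ ab a'z.
    rewrite ![u == _]eq_sym (neqN u a ua) (neqN u b ub) (negPf a'a) (negPf a'b) (negPf a'u).
    by move=> /(_ isT isT).
  by move: a'z; rewrite (negPf (nn z)).
have [a [b [c [ua ub uc [ab ac bc]]]]] : exists a b c, [/\ a \in nbr E u, b \in nbr E u,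
    c \in nbr E u & [/\ a != b, a != c & b != c]].
  have [a ua] : exists a, a \in nbr E u by exists y; rewrite inE -euy.
  have [b] : exists b, b \in nbr E u :\ a.
    by apply/card_gt0P; have := cardD1_in ua; clia.
  rewrite in_setD1 => /andP[ba ub]; rewrite eq_sym in ba.
  have [c [uc ca cb]] := third u a b ua ub ba.
  by exists a, b, c; split=> //; split=> //; rewrite eq_sym.
have nbrK w x1 x2 x3 : x1 \in nbr E w -> x2 \in nbr E w -> x3 \in nbr E w ->
    x1 != x2 -> x1 != x3 -> x2 != x3 -> nbr E w = [set x1; x2; x3].
  move=> w1 w2 w3 n12 n13 n23; have [w3' _] := in3 w x1 w1.
  by apply: cards3_eq; rewrite ?w3'.
have Nu : nbr E u = [set a; b; c] by apply: nbrK.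
have ba := clique a b ua ub ab; have ca := clique a c ua uc ac; have cb := clique b c ub uc bc.
have au := neqN u a ua; have bu := neqN u b ub; have cu := neqN u c uc.
have Na : nbr E a = [set u; b; c] by apply: nbrK; rewrite // ?[u == _]eq_sym // nbrC.
have Nb : nbr E b = [set u; a; c].
  by apply: nbrK; rewrite // ?[u == _]eq_sym //; rewrite nbrC.
have Nc : nbr E c = [set u; a; b].
  by apply: nbrK; rewrite // ?[u == _]eq_sym //; rewrite nbrC.
pose K := [set u; a; b; c]; pose H := del (del (del (del E u) a) b) c.
have NK w : w \in K -> nbr E w \subset K.
  rewrite !inE -!orbA => /or4P[]/eqP ->; rewrite ?Nu ?Na ?Nb ?Nc; apply/subsetP => z;
    by rewrite !inE -!orbA => /or3P[]->; rewrite ?orbT.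
have NHK w : w \in K -> nbr H w = set0.
  move=> wK; apply/eqP; rewrite -subset0; apply/subsetP => z.
  rewrite inE !inE !negb_or -!andbA; move: wK; rewrite !inE -!orbA.
  by case/or4P=> /eqP ->; rewrite !eqxx ?andbF.
have NHn w : w \notin K -> nbr H w = nbr E w.
  move=> wK; have := wK; rewrite !inE !negb_or -!andbA => /and4P[wu wa wb wc].
  have out x1 : x1 \in K -> x1 \notin nbr E w.
    by move=> xK; apply: contra wK => wx; apply: (subsetP (NK x1 xK)); rewrite nbrC.
  rewrite !nbr_del // (setD1_notin (out u _)) ?(setD1_notin (out a _)) ?(setD1_notin (out b _))
    ?(setD1_notin (out c _)) // !inE eqxx ?orbT //.
have inH w z : z \in nbr H w -> w \notin K /\ z \in nbr E w.
  move=> zw; have wK : w \notin K by apply: contraTN zw => /NHK ->; rewrite inE.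
  by rewrite -(NHn w wK).
have sEu := simple_del (v := u) sE; have sEa := simple_del (v := a) sEu.
have sEb := simple_del (v := b) sEa.
exists H.
  split; first exact: simple_del.
    move=> w; have [wK|wK] := boolP (w \in K); first by rewrite (NHK w wK) eqxx.
    by rewrite (NHn w wK); apply: E3.
  move=> w z zw; have [wK zwE] := inH w z zw.
  have zK : z \notin K by rewrite nbrC in zw; have [] := inH z w zw.
  by have [x xw xz] := tri w z zwE; exists x; rewrite NHn.
have := card_del u sE; have := card_del a sEu; have := card_del b sEa; have := card_del c sEb.
have ne x1 x2 : x1 != x2 -> x2 != x1 by rewrite eq_sym.
have -> : nbr (del E u) a = nbr E a :\ u by rewrite nbr_del.
have -> : nbr (del (del E u) a) b = nbr E b :\ u :\ a by rewrite !nbr_del // ne.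
have -> : nbr (del (del (del E u) a) b) c = nbr E c :\ u :\ a :\ b by rewrite !nbr_del // ne.
have [_ a3] := in3 u a ua; have [_ b3] := in3 u b ub; have [_ c3] := in3 u c uc.
have a1 : u \in nbr E a by rewrite nbrC.
have b1 : u \in nbr E b by rewrite nbrC.
have c1 : u \in nbr E c by rewrite nbrC.
have b2 : a \in nbr E b :\ u by rewrite in_setD1 au nbrC.
have c2 : a \in nbr E c :\ u by rewrite in_setD1 au nbrC.
have c4 : b \in nbr E c :\ u :\ a by rewrite !in_setD1 bu nbrC cb (ne _ _ _ ab).
have := cardD1_in a1; have := cardD1_in b1; have := cardD1_in c1.
have := cardD1_in b2; have := cardD1_in c2; have := cardD1_in c4.
rewrite -/H; clia.
Qed.

(** Each removed $K_4$ takes six edges, and 15 is not a multiple of 6. *)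
Lemma cubic_triangular_not15 E : cubic_triangular E -> #|E| = 15 -> False.
Proof.
move=> cE E15; have [|H1 cH1 E1] := cubic_triangular_remove cE.
  by rewrite -card_gt0 E15.
have [|H2 cH2 E2] := cubic_triangular_remove cH1; first by rewrite -card_gt0; clia.
have [|H3 cH3 E3] := cubic_triangular_remove cH2; first by rewrite -card_gt0; clia.
by clia.
Qed.

(** An edge of a $K_{3,3}$, or an edge in no triangle between vertices of degree 3, is coned off
    with five edges. Otherwise a vertex of degree at most 2 is merged with a far one: sum 5 allows a
    cone, sum 4 an extension, and smaller sums keep the maximum degree 3 with fewer non-isolated
    vertices. If none applies, the graph is cubic up to isolated vertices, with every edge in a
    triangle. *)
Lemma indep_dim5_low E : simple E -> #|E| = 15 -> (forall y, #|nbr E y| <= 3) -> indep R 5 E.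
Proof.
have [n] := ubnP #|[set y | nbr E y != set0]|; elim: n E => // n IH E ltn sE cE E3.
have low4 H : H \subset E -> #|H| <= 10 -> no_biclique E 3 3 -> indep R 4 H.
  move=> HE H10 nK; apply: indep_dim4_deg_le3 => //; first exact: simple_sub sE.
    by move=> y; apply: leq_trans (card_nbr_sub _ HE) (E3 y).
  exact: no_biclique_sub nK.
have [[A [B [A3 B3 AB]]]|noK] := pselect (exists A B, [/\ #|A| = 3, #|B| = 3 & biclique E A B]).
  have [u uA] : exists u, u \in A by apply/card_gt0P; rewrite A3.
  have [v vB] : exists v, v \in B by apply/card_gt0P; rewrite B3.
  have dAB := biclique_disjoint sE AB.
  have uv : u != v by apply: contraTneq uA => ->; rewrite (disjointFl dAB).
  have nu : nbr E u = B.
    by apply/esym/(sub_cards_eq (k := 3)) => //; apply/subsetP => b bB; rewrite inE AB.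
  have nv : nbr E v = A.
    by apply/esym/(sub_cards_eq (k := 3)) => //; apply/subsetP => a aA; rewrite inE setUC AB.
  have cD : #|del (del E v) u| = 10.
    have := card_del v sE; have := card_del u (simple_del (v := v) sE).
    by rewrite nbr_del // nu nv; have := cardD1_in vB; clia.
  apply: (edge_cone_reduction (u := u) (v := v)) => //.
  - by rewrite nv.
  - by rewrite nu nv disjoint_sym.
  - by rewrite nu nv A3 B3.
  apply: indep_dim4_deg_le3; rewrite ?cD //; first by do 2!apply: simple_del.
    by move=> y; apply: leq_trans (subset_leq_card (subset_trans (nbr_del_subset _ _ _) (nbr_del_subset _ _ _))) (E3 y).
  exact: (del_edge_no_biclique sE cE E3 A3 B3 AB uA vB cD).
have nK : no_biclique E 3 3 by move=> A B A3 B3 AB; apply: noK; exists A, B.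
have [[u [v [u3 v3 uv dis]]]|no_edge] := pselect (exists u v,
    [/\ #|nbr E u| = 3, #|nbr E v| = 3, u \in nbr E v & [disjoint nbr E u & nbr E v]]).
  apply: (edge_cone_reduction (u := u) (v := v)) => //; first by rewrite u3 v3.
  apply: low4 => //; first by apply: subset_trans (del_sub _ _) (del_sub _ _).
  have := card_del v sE; have := card_del u (simple_del (v := v) sE).
  rewrite nbr_del ?(nbr_neq sE uv) //; have vu : v \in nbr E u by rewrite nbrC.
  by have := cardD1_in vu; clia.
have [[u [u0 u2]]|no2] := pselect (exists u, nbr E u != set0 /\ #|nbr E u| <= 2).
  have u1 : 0 < #|nbr E u| by rewrite card_gt0.
  have [|w [wu wuN dis w0]] := @far_vertex _ E u 3 sE E3.
    by rewrite cE; move: u2; clia.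
  have w1 : 0 < #|nbr E w| by rewrite card_gt0.
  have cDu := card_del u sE; have cDw := card_del w (simple_del (v := u) sE).
  have wD : nbr (del E u) w = nbr E w by rewrite nbr_del // setD1_notin // nbrC.
  rewrite wD in cDw; have w3 := E3 w.
  have DE : del (del E u) w \subset E by apply: subset_trans (del_sub _ _) (del_sub _ _).
  have [s5|s4] := leqP 5 (#|nbr E u| + #|nbr E w|).
    apply: (merge_cone sE wu wuN dis); first by clia.
    by apply: low4 => //; clia.
  have [s4'|s3] := leqP 4 (#|nbr E u| + #|nbr E w|).
    apply: (@merge_extension _ _ E u w sE wu wuN dis 4 2); [clia|by []|by clia|] => f fD.
    apply: low4 => //; first exact: subset_trans (subD1set _ _) DE.
    by have := cardD1_in fD; clia.
  apply: (indep_merge sE wu wuN dis); apply: IH.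
  - rewrite -ltnS; apply: leq_trans ltn; rewrite ltnS; apply/proper_card/properP; split.
      apply/subsetP => z; rewrite !inE; have [->|zw] := eqVneq z w; first by [].
      have := card_nbr_merge sE wu zw; rewrite -!card_gt0; clia.
    exists u; rewrite !inE; first by rewrite -card_gt0.
    by rewrite nbr_merge_self ?eqxx.
  - exact: simple_merge.
  - by rewrite card_merge.
  move=> z; have [->|zw] := eqVneq z w; first by rewrite card_nbr_merged //; clia.
  exact: leq_trans (card_nbr_merge sE wu zw) (E3 z).
exfalso; apply: (cubic_triangular_not15 (E := E)) => //.
have E3' y : nbr E y != set0 -> #|nbr E y| = 3.
  move=> y0; have := E3 y; rewrite leq_eqVlt => /orP[/eqP //|y2].
  by case: no2; exists y.
split=> // u v uv; have u3 : #|nbr E u| = 3 by apply: E3'; apply/set0Pn; exists v.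
have v3 : #|nbr E v| = 3 by apply: E3'; apply/set0Pn; exists u; rewrite nbrC.
apply: contrapT => no; apply: no_edge; exists u, v; split; rewrite // 1?nbrC //.
apply/pred0P => z /=; apply/negbTE/negP => /andP[zu zv]; apply: no; by exists z.
Qed.

End LowDegree.

(** * Dimension five: padding, and vertices of degree five *)

Section DimensionFivePad.
Variables (R : realType).

Definition bounded5 (V : finType) (E : {set {set V}}) :=
  [/\ simple E, forall y, #|nbr E y| <= 4,
    forall C : {set V}, #|E| = 15 -> #|C| <= 4 -> covers C E -> False,
    no_biclique E 3 4 &
    forall A B : {set V}, #|A| = 4 -> #|B| = 4 -> [disjoint A & B] -> #|cross E A B| <= 13].

(** At most one edge at [a] and $3\cdot 4$ at the other vertices of [A]: just the bound 13, so
    padding preserves it. *)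
Lemma cross_low (V : finType) (E : {set {set V}}) (A B : {set V}) a : simple E ->
  #|A| = 4 -> #|B| = 4 -> [disjoint A & B] -> a \in A -> #|nbr E a| <= 1 ->
  #|cross E A B| <= 13.
Proof.
move=> sE A4 B4 dAB aA a1.
have sub : cross E A B \subset star E a :|:
    (fun p : V * V => [set p.1; p.2]) @: setX (A :\ a) B.
  apply/subsetP => e /setIP[].
  rewrite !inE => /andP[eE eA] /andP[_ eB]; rewrite eE /=.
  have [ae|ae] := boolP (a \in e); first by [].
  case/pred0Pn: eA => x /= /andP[xe xA]; have [y yx exy] := edge_at sE eE xe.
  have xa : x != a by apply: contraNneq ae => <-.
  move: eB; rewrite exy set2_disjoint (disjointFr dAB xA) /= negbK => yB.
  by apply/imsetP; exists (x, y); rewrite // !inE xa xA yB.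
apply: leq_trans (subset_leq_card sub) _; apply: leq_trans (leq_card_setU _ _) _.
rewrite -card_nbr //; have := leq_imset_card (fun p : V * V => [set p.1; p.2]) (setX (A :\ a) B).
by rewrite cardsX B4; have := cardD1_in aA; rewrite A4 => -[<-]; clia.
Qed.

Lemma crossC (V : finType) (E : {set {set V}}) (A B : {set V}) : cross E A B = cross E B A.
Proof. exact: setIC. Qed.

(** A cover of the padded graph by four vertices spends one on the new edge, and the other three
    meet at most 12 of the 14 old edges. The new vertices have degree one, which [cross_low] and
    [biclique_pad] exploit. *)
Lemma bounded5_pad (V : finType) (E : {set {set V}}) :
  bounded5 E -> #|E| < 15 -> bounded5 (pad E).
Proof.
move=> [sE E4 _ nK cr] E15; pose pv := @pad_vertex V; split.
- exact: simple_pad.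
- exact: card_nbr_pad.
- move=> C cP C4 cC; have [n nC] : exists2 n, n \in C & n = None \/ n = Some None.
    have := cC [set None; Some None]; rewrite setU11 => /(_ isT)/pred0Pn[z /= /andP[]].
    by rewrite !inE => /orP[]/eqP -> zC; [exists None; [|left]|exists (Some None); [|right]].
  move=> nn; pose C' := pv @^-1: C; have C'3 : #|C'| <= 3.
    have : pv @: C' \subset C :\ n.
      apply/subsetP => _ /imsetP[x + ->]; rewrite !inE => ->; rewrite andbT.
      by case: nn => ->.
    move/subset_leq_card; rewrite card_imset; last exact: pad_vertex_inj.
    by have := cardD1_in nC; clia.
  have cC' : covers C' E.
    move=> e eE; have := cC (pv @: e); rewrite setU1r; last exact: imset_f.
    case/(_ isT)/pred0Pn => _ /= /andP[/imsetP[x xe ->] xC].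
    by apply/pred0Pn; exists x; rewrite /= xe inE.
  by have := covers_card sE E4 cC'; rewrite card_pad in cP; clia.
- move=> A B A3 B4 AB.
  have [||A' [B' [A'3 B'4]]] := biclique_pad _ _ AB; rewrite ?A3 ?B4 //.
  by apply: nK; rewrite ?A'3 ?B'4.
move=> A B A4 B4 dAB.
have low (A0 B0 : {set option (option V)}) n : n = None \/ n = Some None ->
    #|A0| = 4 -> #|B0| = 4 -> [disjoint A0 & B0] -> n \in A0 -> #|cross (pad E) A0 B0| <= 13.
  move=> nn A04 B04 d0 nA; apply: (cross_low (a := n)) => //; first exact: simple_pad.
  exact: card_nbr_pad_new.
have dBA : [disjoint B & A] by rewrite disjoint_sym.
have [nA|nA] := boolP (None \in A); first by apply: (low _ _ None) => //; left.
have [sA|sA] := boolP (Some None \in A); first by apply: (low _ _ (Some None)) => //; right.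
have [nB|nB] := boolP (None \in B); first by rewrite crossC; apply: (low _ _ None) => //; left.
have [sB|sB] := boolP (Some None \in B).
  by rewrite crossC; apply: (low _ _ (Some None)) => //; right.
have preE (S : {set option (option V)}) : None \notin S -> Some None \notin S ->
    #|pv @^-1: S| = #|S|.
  move=> nS sS; rewrite -(card_imset _ (@pad_vertex_inj V)); congr #|pred_of_set _|.
  apply/setP => y; apply/imsetP/idP => [[x + ->]|yS]; first by rewrite inE.
  case: y yS => [[x|]|] yS; last 2 first.
  - by rewrite yS in sS.
  - by rewrite yS in nS.
  by exists x; rewrite // inE.
have := cr (pv @^-1: A) (pv @^-1: B); rewrite !preE // => /(_ A4 B4).
have dAB' : [disjoint pv @^-1: A & pv @^-1: B].
  by apply/pred0P => x /=; rewrite !inE; apply: (pred0P dAB).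
move=> /(_ dAB'); apply: leq_trans.
rewrite -(card_imset _ (imset_inj (@pad_vertex_inj V))); apply/subset_leq_card/subsetP => e.
case/setIP; rewrite !inE => /andP[/orP[/eqP ->|/imsetP[g gE ->]] eA] /andP[_ eB].
  by move: eA; rewrite set2_disjoint nA sA.
apply: imset_f; rewrite !inE gE /=; apply/andP; split.
  case/pred0Pn: eA => _ /= /andP[/imsetP[x xg ->] xA].
  by apply/pred0Pn; exists x; rewrite /= xg inE.
case/pred0Pn: eB => _ /= /andP[/imsetP[x xg ->] xB].
by apply/pred0Pn; exists x; rewrite /= xg inE.
Qed.

Lemma indep_dim5_bounded (V : finType) (E : {set {set V}}) :
  bounded5 E -> #|E| <= 15 -> indep R 5 E.
Proof.
apply: (@pad_induction R bounded5 5 15) => [{}V {}E [] //|{}V {}E|{}V {}E [sE E4 nC nK cr] E15].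
  exact: bounded5_pad.
have [[v v4]|no4] := pselect (exists v, #|nbr E v| = 4).
  by apply: (indep_dim5_deg4 R sE E15 E4 _ nK v4 cr) => C; apply: nC.
apply: indep_dim5_low => // y; have := E4 y; rewrite leq_eqVlt => /orP[/eqP y4|//].
by case: no4; exists y.
Qed.

(** After coning at a vertex of degree 5, the bounds 9 and 12 become the degree bound 4 and the pair
    bound 7 of [indep_dim4]. *)
Lemma indep_dim5 (V : finType) (E : {set {set V}}) : simple E -> #|E| <= 15 ->
  (forall y, #|nbr E y| <= 5) ->
  (forall a b, a != b -> #|nbr E a| + #|nbr (del E a) b| <= 9) ->
  (forall a b c, a != b -> a != c -> b != c ->
    #|nbr E a| + #|nbr (del E a) b| + #|nbr (del (del E a) b) c| <= 12) ->
  (forall C : {set V}, #|E| = 15 -> #|C| <= 4 -> covers C E -> False) ->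
  no_biclique E 3 4 ->
  (forall A B : {set V}, #|A| = 4 -> #|B| = 4 -> [disjoint A & B] -> #|cross E A B| <= 13) ->
  (forall v, #|nbr E v| = 5 -> no_biclique (del E v) 3 3) ->
  indep R 5 E.
Proof.
move=> sE E15 E5 pair triple nC nK cr cone.
have [[v v5]|no5] := pselect (exists v, #|nbr E v| = 5); last first.
  apply: indep_dim5_bounded => //; split=> // y; have := E5 y.
  by rewrite leq_eqVlt => /orP[/eqP y5|//]; case: no5; exists y.
have cD := card_del v sE; apply: (cone_reduction (v := v)) => //.
apply: indep_dim4; [exact: simple_del|clia| | | |exact: cone].
- move=> y; have [->|yv] := eqVneq y v; first by rewrite nbr_del_self cards0.
  by have := pair v y; rewrite eq_sym yv v5 => /(_ isT); clia.
- move=> a b ab; have [av|av] := eqVneq a v.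
    rewrite av nbr_del_self cards0 add0n.
    apply: leq_trans (card_nbr_sub _ (del_sub _ _)) _.
    have bv : b != v by rewrite -av eq_sym.
    by have := pair v b; rewrite eq_sym bv v5 => /(_ isT); clia.
  have [bv|bv] := eqVneq b v.
    have -> : nbr (del (del E v) a) b = set0.
      apply/eqP; rewrite -subset0 bv -(nbr_del_self E v); exact/nbr_sub/del_sub.
    rewrite cards0 addn0; have := pair v a; rewrite eq_sym av v5 => /(_ isT); clia.
  by have := triple v a b; rewrite ![v == _]eq_sym av bv ab v5 => /(_ isT isT isT); clia.
move=> C c10 C3 cC; apply: (nC (v |: C)); [clia| |exact: covers_del].
by apply: leq_trans (leq_card_setU _ _) _; rewrite cards1; clia.
Qed.

End DimensionFivePad.

(** * Sufficiency: the conditions drawn from the families *)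

Section Touching.
Variable V : finType.
Implicit Types (E : {set {set V}}) (S C : {set V}).

Lemma card_touching1 E v : simple E -> #|touching E [set v]| = #|nbr E v|.
Proof.
move=> sE; rewrite card_nbr //; apply: eq_card => e.
by rewrite !inE disjoint_sym disjoints1 negbK.
Qed.

(** Turns bounds on the edges touching a set into bounds on degrees after successive deletions. *)
Lemma card_touchingU1 E v S : simple E ->
  #|touching E (v |: S)| = #|nbr E v| + #|touching (del E v) S|.
Proof.
move=> sE; rewrite card_nbr // (card_star_del (touching E _) v); congr (_ + _).
  apply: eq_card => e; rewrite !inE; case: (boolP (v \in e)) => ve; rewrite ?andbF // !andbT.
  case: (e \in E) => //=; apply/pred0Pn; exists v; by rewrite /= ve !inE eqxx.
apply: eq_card => e; rewrite !inE; case: (boolP (v \in e)) => ve; rewrite ?andbF // !andbT.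
congr (_ && ~~ _); apply/pred0P/pred0P => dis x; have := dis x; rewrite /= !inE.
  by case: (x =P v) => [->|_] //=; rewrite (negPf ve).
by case: (x =P v) => [->|_] //=; rewrite (negPf ve).
Qed.

Lemma covers_touching E C : covers C E -> touching E C = E.
Proof.
by move=> cC; apply/setP => e; rewrite inE; case: (boolP (e \in E)) => //= /cC ->.
Qed.

End Touching.

Section Sufficiency.
Variables (R : realType) (G : sgraph) (t : nat).
Hypotheses (CG : C_independent t G) (t0 : 0 < t) (tG : t.+1 < #|G|).
Let E := edges G.
Let sE : simple E := @simple_edges G.
Implicit Types (A B C : {set G}).

Let size_le : #|E| <= 'C(t.+1, 2). Proof. exact: C_independent_size CG t0 tG. Qed.

Let touch_le C k : #|C| = k -> k < t -> #|touching E C| <= \sum_(i < k) (t - i).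
Proof. by move=> Ck kt; have := C_independent_cover CG tG (S := C); rewrite Ck; apply. Qed.

Let sum1 : \sum_(i < 1) (t - i) = t.
Proof. by rewrite big_ord_recl big_ord0 addn0 subn0. Qed.

Let sum2 : \sum_(i < 2) (t - i) = t + (t - 1).
Proof. by rewrite big_ord_recr sum1. Qed.

Let sum3 : \sum_(i < 3) (t - i) = t + (t - 1) + (t - 2).
Proof. by rewrite big_ord_recr sum2. Qed.

Let sum4 : \sum_(i < 4) (t - i) = t + (t - 1) + (t - 2) + (t - 3).
Proof. by rewrite big_ord_recr sum3. Qed.

Let degree_le v : 1 < t -> #|nbr E v| <= t.
Proof.
by move=> t1; rewrite -card_touching1 // -[X in _ <= X]sum1; apply: touch_le; rewrite ?cards1.
Qed.

Let pair_le a b : 2 < t -> a != b -> #|nbr E a| + #|nbr (del E a) b| <= t + (t - 1).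
Proof.
move=> t2 ab; rewrite -(card_touching1 b (simple_del (v := a) sE)).
by rewrite -card_touchingU1 // -sum2; apply: touch_le; rewrite ?cards2 ?ab.
Qed.

Let triple_le a b c : 3 < t -> a != b -> a != c -> b != c ->
  #|nbr E a| + #|nbr (del E a) b| + #|nbr (del (del E a) b) c| <= t + (t - 1) + (t - 2).
Proof.
move=> t3 ab ac bc; have sD : simple (del E a) := simple_del sE.
rewrite -(card_touching1 c (simple_del (v := b) sD)) -addnA -(card_touchingU1 _ _ sD) -card_touchingU1 // -sum3; apply: touch_le => //.
by rewrite cardsU1 cards2 bc !inE negb_or ab ac.
Qed.

Let covers_le C k : #|C| <= k -> k < t -> covers C E -> #|E| <= \sum_(i < k) (t - i).
Proof.
move=> Ck kt cC; rewrite -(covers_touching cC); apply: leq_trans (touch_le erefl _) _.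
  exact: leq_ltn_trans kt.
by rewrite -(subnK Ck) addnC big_split_ord leq_addr.
Qed.

(** A biclique has all $ij$ edges, while the weight is smaller as soon as $i+j-t\ge 2$. *)
Let bipartite_free i j : 3 <= i < t -> 3 <= j < t -> t.+2 <= i + j ->
  1 < i + j - t -> no_biclique E i j.
Proof.
move=> it jt ij d2 A B Ai Bj AB; have := biclique_cross sE AB.
have := C_independent_bipartite CG t0 tG (biclique_disjoint sE AB); rewrite Ai Bj.
move=> /(_ it jt ij) le1 le2; have := leq_trans (leq_add le2 (leqnn _)) le1.
by rewrite -[X in _ <= X]addn0 leq_add2l leqn0 -leqn0 leqNgt bin_gt0 d2.
Qed.

Lemma C_independent_indep : t <= 5 -> indep R t E.
Proof.
move=> t5; have : [|| t == 1, t == 2, t == 3, t == 4 | t == 5].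
  by case: t t0 t5 => [|[|[|[|[|[|]]]]]].
case/or4P => [/eqP tE|/eqP tE|/eqP tE|/orP[]/eqP tE].
- by move: size_le; rewrite tE => sz; apply: indep_dim1.
- move: size_le degree_le; rewrite tE => sz dl; apply: indep_dim2 => // y; exact: dl.
- move: size_le degree_le covers_le sum2; rewrite tE => sz dl cl s2.
  apply: indep_dim3 => // [y|C E6 C2 cC]; first exact: dl.
  by have := cl C 2 C2 isT cC; rewrite s2 E6.
- move: size_le degree_le pair_le covers_le sum3 (@bipartite_free 3 3).
  rewrite tE => sz dl pl cl s3 bf.
  apply: indep_dim4 => // [y|a b|C E10 C3 cC|]; [exact: dl|exact: pl| |exact: bf].
  by have := cl C 3 C3 isT cC; rewrite s3 E10.
move: size_le degree_le pair_le triple_le covers_le sum4 (@bipartite_free 3 4).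
move: (CG) (tG); rewrite tE => CG5 G5 sz dl pl tl cl s4 bf.
apply: indep_dim5 => // [y|a b|a b c|C E15 C4 cC| |A B A4 B4 dAB|v v5 A B A3 B3 AB].
- exact: dl.
- exact: pl.
- exact: tl.
- by have := cl C 4 C4 isT cC; rewrite s4 E15.
- exact: bf.
- have := C_independent_bipartite CG5 isT G5 dAB; rewrite A4 B4 => /(_ isT isT isT).
  by rewrite (_ : 'C(4 + 4 - 5, 2) = 3) //; clia.
have sD : simple (del E v) := simple_del sE.
have vAB : v \notin A :|: B.
  have [a aA] : exists a, a \in A by apply/card_gt0P; rewrite A3.
  have [b bB] : exists b, b \in B by apply/card_gt0P; rewrite B3.
  rewrite inE negb_or; apply/andP; split; apply/negP => vS.
    by have := AB v b vS bB; rewrite inE set21 andbF.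
  by have := AB a v aA vS; rewrite inE set22 andbF.
(* Nine edges of the biclique and five at [v] make 14, one more than the weight of the cone. *)
have := C_independent_cone_bipartite CG5 G5 vAB (biclique_disjoint sD AB).
rewrite A3 B3 => /(_ isT isT isT); rewrite (_ : 'C(3 + 3 - 4, 2) = 1) //.
have := biclique_cross sD AB; rewrite A3 B3.
have : star E v :|: cross (del E v) A B \subset star E v :|: cross E A B.
  by apply: setUS; apply/subsetP => e; rewrite !inE => /andP[/andP[/andP[-> _] ->] /andP[_ ->]].
move/subset_leq_card; rewrite cardsU.
have -> : star E v :&: cross (del E v) A B = set0.
  by apply/setP => e; rewrite !inE; case: (v \in e); rewrite ?andbF.
rewrite cards0 -card_nbr // v5; clia.
Qed.

End Sufficiency.

Theorem theorem3p4 (R : realType) (G : sgraph) (t : nat) (ht : 1 <= t <= 5) :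
  S_independent R t G <-> C_independent t G.
Proof.
split=> [/S_independent_C //|CG]; apply/S_independentP; case/andP: ht => t0 t5.
have [small|big] := leqP #|G| t.+1; last exact: C_independent_indep.
apply: (indep_small R (W := [set: G])); rewrite ?cardsT //; first exact: simple_edges.
Qed.
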